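(* Let $5\le N\le 12$. There exist numbers $\beta_1>\beta_0>0$, depending on $N$ only, such that the following holds. Let $u$ be a radial solution of $\Delta^2u=e^u$ in $\mathbb{R}^N$ with $u(0)=0$, let $v=-\Delta u$ and $\beta=v(0)$. Then: (i) $\beta\ge\beta_0$; (ii) if $\beta=\beta_0$, then $u$ is unstable outside every compact set; (iii) if $\beta\in(\beta_0,\beta_1)$, then $u$ is unstable, but $u$ is stable outside a compact set; (iv) if $\beta\ge\beta_1$, then $u$ is stable.
   Context: Solutions are classical entire solutions ($u\in C^4(\mathbb{R}^N)$); radial means radial about the origin. For an open set $\Omega\subset\mathbb{R}^N$ consider the inequality $$\int_\Omega e^u\varphi^2\,dx\le\int_\Omega|\Delta\varphi|^2\,dx\quad\text{for all }\varphi\in H^2(\Omega)\cap H^1_0(\Omega).\qquad (S_\Omega)$$ The solution $u$ is stable if $(S_\Omega)$ holds with $\Omega=\mathbb{R}^N$, and unstable otherwise. It is stable outside a compact set if there is a compact $K\subset\mathbb{R}^N$ such that $(S_\Omega)$ holds with $\Omega=\mathbb{R}^N\setminus K$. It is unstable outside every compact set if there is no such $K$. *)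

(* Defs.v *)
From HB Require Import structures.
From mathcomp Require Import all_boot all_order all_algebra.
From mathcomp Require Import all_classical all_reals all_analysis.
Import Order.TTheory GRing.Theory Num.Theory.
Import numFieldNormedType.Exports.

Set Implicit Arguments.
Unset Strict Implicit.
Unset Printing Implicit Defensive.

Local Open Scope classical_set_scope.
Local Open Scope ring_scope.

(* The measurable structure on R^n (row vectors): the product of the Borel
   sigma-algebras, i.e. the Borel sigma-algebra of R^n. *)
Section measurable_row.
Context {R : realType}.
Variable n : nat.

Definition coord_rV (i : 'I_n) (x : 'rV[R]_n) : measurableTypeR R := x ord0 i.

Let rV_set0 : g_sigma_preimage coord_rV set0.
Proof. exact: sigma_algebra0. Qed.

Let rV_setC A : g_sigma_preimage coord_rV A -> g_sigma_preimage coord_rV (~` A).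
Proof. exact: sigma_algebraC. Qed.

Let rV_bigcup (F : (set 'rV[R]_n)^nat) :
  (forall i, g_sigma_preimage coord_rV (F i)) ->
  g_sigma_preimage coord_rV (\bigcup_i (F i)).
Proof. exact: sigma_algebra_bigcup. Qed.

HB.instance Definition _ := @isMeasurable.Build default_measure_display
  'rV[R]_n (g_sigma_preimage coord_rV) rV_set0 rV_setC rV_bigcup.

End measurable_row.

Definition cons_rV {R : realType} {n : nat}
    (p : 'rV[R]_n * measurableTypeR R) : 'rV[R]_n.+1 :=
  row_mx (p.2 : R)%:M p.1 : 'rV[R]_(1 + n).

Lemma measurable_coord_rV (R : realType) n (i : 'I_n) :
  measurable_fun setT (@coord_rV R n i).
Proof.
move=> _ Y mY; rewrite setTI; apply: sub_sigma_algebra => /=.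
rewrite -bigcup_seq/=; exists i => /=; first by rewrite mem_index_enum.
by exists Y => //; rewrite setTI.
Qed.

Lemma measurable_fun_coord_rVP d (T : measurableType d) (R : realType) n
    (f : T -> 'rV[R]_n) :
  (forall i, measurable_fun setT (coord_rV i \o f)) -> measurable_fun setT f.
Proof.
move=> mf; apply: (@measurability _ _ _ _ _ f
  (\big[setU/set0]_(i < n)
     preimage_set_system setT (@coord_rV R n i) measurable)) => //.
move=> _ [A +] <-; rewrite -bigcup_seq => -[i _ [B mB <-]].
by rewrite setTI; exact: mf.
Qed.

Lemma measurable_cons_rV (R : realType) (n : nat) :
  measurable_fun setT (@cons_rV R n).
Proof.
apply: measurable_fun_coord_rVP => i.
case: (@splitP 1 n i) => j ij.
  rewrite (_ : _ \o _ = snd); first exact: measurable_snd.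
  apply/funext => p; rewrite /= /coord_rV /cons_rV.
  have -> : i = lshift n j by apply: val_inj.
  by rewrite (row_mxEl (p.2)%:M) mxE (ord1 j).
rewrite (_ : _ \o _ = coord_rV j \o fst).
  exact: measurableT_comp (measurable_coord_rV j) measurable_fst.
apply/funext => p; rewrite /= /coord_rV /cons_rV.
have -> : i = rshift 1 j by apply: val_inj.
by rewrite (row_mxEr (p.2)%:M).
Qed.

HB.instance Definition _ (R : realType) (n : nat) :=
  isMeasurableFun.Build _ _ _ _ (@cons_rV R n) (@measurable_cons_rV R n).

Section lebesgue_rV_step.
Context {R : realType} {n : nat}.
Variable mu : {measure set 'rV[R]_n -> \bar R}.

Definition lebesgue_rVS : set 'rV[R]_n.+1 -> \bar R :=
  pushforward (mu \x @lebesgue_measure R)%E cons_rV.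

Let lebesgue_rVS0 : lebesgue_rVS set0 = 0%E.
Proof. exact: measure0. Qed.

Let lebesgue_rVS_ge0 A : (0 <= lebesgue_rVS A)%E.
Proof. exact: measure_ge0. Qed.

Let lebesgue_rVS_sigma_additive : semi_sigma_additive lebesgue_rVS.
Proof. exact: measure_semi_sigma_additive. Qed.

HB.instance Definition _ := isMeasure.Build _ _ _ lebesgue_rVS
  lebesgue_rVS0 lebesgue_rVS_ge0 lebesgue_rVS_sigma_additive.

End lebesgue_rV_step.

(* Lebesgue measure on R^n (on Borel sets), as an iterated product measure. *)
Fixpoint lebesgue_rV (R : realType) (n : nat) :
    {measure set 'rV[R]_n -> \bar R} :=
  match n with
  | 0 => \d_(0 : 'rV[R]_0)
  | n'.+1 => lebesgue_rVS (lebesgue_rV R n')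
  end.

Lemma lebesgue_rV_box (R : realType) n (A : 'I_n -> set (measurableTypeR R)) :
  (forall i, measurable (A i)) ->
  lebesgue_rV R n [set x : 'rV[R]_n | forall i, A i (x ord0 i)] =
  (\prod_(i < n) @lebesgue_measure R (A i))%E.
Proof.
elim: n A => [|n IHn] A mA.
  by rewrite big_ord0 /= diracE mem_set//= => -[].
rewrite big_ord_recl /= /lebesgue_rVS /pushforward.
rewrite (_ : _ @^-1` _ =
  [set x : 'rV[R]_n | forall i, A (lift ord0 i) (x ord0 i)] `*` A ord0).
  rewrite product_measure1E //.
    by rewrite muleC (IHn (fun i => A (lift ord0 i))).
  rewrite (_ : [set x | _] =
      \bigcap_(i in [set: 'I_n]) (coord_rV i @^-1` A (lift ord0 i))).
    apply: (@fin_bigcap_measurable _ 'rV[R]_n 'I_n).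
      exact: finite_finset.
    move=> i _; rewrite -[X in measurable X]setTI.
    exact: (measurable_coord_rV i measurableT (mA _)).
  by apply/seteqP; split => x /= xA i => [_|]; exact: xA.
have consr (p : 'rV[R]_n * measurableTypeR R) i :
    cons_rV p ord0 (lift ord0 i) = p.1 ord0 i.
  have -> : lift ord0 i = rshift 1 i by exact: val_inj.
  by rewrite (row_mxEr (p.2)%:M).
have cons0 (p : 'rV[R]_n * measurableTypeR R) : cons_rV p ord0 ord0 = p.2.
  rewrite (_ : ord0 = lshift n (ord0 : 'I_1)); last exact: val_inj.
  by rewrite (row_mxEl (p.2)%:M) mxE.
apply/seteqP; split => p /=.
  by move=> Ap; split=> [i|]; [rewrite -consr|rewrite -cons0]; exact: Ap.
by move=> [A1 A0] i; case: (unliftP ord0 i) => [j|] ->;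
  [rewrite consr|rewrite cons0].
Qed.

Section euclidean_space.
Context {R : realType} {N : nat}.
Local Notation E := 'rV[R]_N.
Local Notation mu := (lebesgue_rV R N).
Implicit Types (f g u phi psi : E -> R) (D : set E).

(* The canonical norm `|x| on row vectors is the sup norm. *)
Definition euclid_norm (x : E) : R := Num.sqrt (\sum_(i < N) x ord0 i ^+ 2).

Definition radial u : Prop :=
  forall x y : E, euclid_norm x = euclid_norm y -> u x = u y.

Definition partial (i : 'I_N) f : E -> R := fun x => 'D_(delta_mx ord0 i) f x.

Definition laplacian f : E -> R := fun x => \sum_(i < N) partial i (partial i f) x.

Fixpoint is_Ck (k : nat) f : Prop :=
  if k is k'.+1 then
    continuous f /\
    forall i : 'I_N, (forall x, derivable f x (delta_mx ord0 i)) /\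
      is_Ck k' (partial i f)
  else continuous f.

(* C_c^oo(D), with functions extended by 0 to the whole space. *)
Definition test_function D psi : Prop :=
  (forall k, is_Ck k psi) /\
  exists K : set E,
    [/\ compact K, K `<=` D & forall x, ~ K x -> psi x = 0].

(* Functions on D are represented by functions on the whole space of which
   only the values on D matter. *)
Definition L2 D f : Prop :=
  measurable_fun D f /\ (\int[mu]_(x in D) ((f x) ^+ 2)%:E < +oo)%E.

Definition weak_partial D (i : 'I_N) f g : Prop :=
  [/\ L2 D f, L2 D g &
    forall psi, test_function D psi ->
      \int[mu]_(x in D) (f x * partial i psi x) =
      - \int[mu]_(x in D) (g x * psi x)].

Fixpoint sobolev (k : nat) D f : Prop :=
  if k is k'.+1 then
    L2 D f /\ forall i : 'I_N, exists2 g, weak_partial D i f g & sobolev k' D g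
  else L2 D f.

(* H^1_0(D) is the closure of C_c^oo(D) in H^1(D). *)
Definition sobolev10 D f : Prop :=
  exists2 g : 'I_N -> E -> R, (forall i, weak_partial D i f (g i)) &
    L2 D f /\
    forall e : R, 0 < e -> exists2 psi, test_function D psi &
      (\int[mu]_(x in D) ((f x - psi x) ^+ 2)%:E +
       \sum_(i < N) \int[mu]_(x in D) ((g i x - partial i psi x) ^+ 2)%:E
         < e%:E)%E.

(* As weak derivatives are unique only up to null sets, the weak Laplacian is
   a relation; w is one of its representatives. *)
Definition weak_laplacian D f w : Prop :=
  exists g h : 'I_N -> E -> R,
    (forall i, weak_partial D i f (g i) /\ weak_partial D i (g i) (h i)) /\
    w = (fun x => \sum_(i < N) h i x).

Definition stability_inequality u D : Prop :=
  forall phi lphi : E -> R,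
    sobolev 2 D phi -> sobolev10 D phi -> weak_laplacian D phi lphi ->
    (\int[mu]_(x in D) (expR (u x) * phi x ^+ 2)%:E <=
     \int[mu]_(x in D) (lphi x ^+ 2)%:E)%E.

Definition solution u : Prop :=
  is_Ck 4 u /\ forall x, laplacian (laplacian u) x = expR (u x).

Definition stable u : Prop := stability_inequality u setT.

Definition stable_outside_compact u : Prop :=
  exists2 K : set E, compact K & stability_inequality u (~` K).

End euclidean_space.

(* Main.v *)
(* A radial solution is governed by the profiles U of u and V of - \Delta u. V decreases,
   and it is nonnegative, since otherwise u would blow up at a finite radius. If
   beta < beta' then V' - V >= beta' - beta; hence at most one solution has V -> 0, and it
   has the least beta. If there is one, beta0 is its beta; otherwise any positive number
   below all the betas will do, so that no existence theory is needed. All the other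
   solutions satisfy u <= - c |x|^2, and a Rellich inequality makes them stable outside a
   ball. Stability passes to larger beta by comparison and to limits by Fatou's lemma;
   beta1 is in essence the infimum of the betas of the stable solutions.

   For a solution with V -> 0, let P(r) be the integral of t^3 e^U(t) over [0, r]. If u is
   stable outside a compact set, truncations of the critical power |x|^(-(N-4)/2) give
   P(r) <= H ln r + C with H = N^2 (N-4)^2 / 16. On the other hand the equation and V -> 0
   give - U <= P / k + C with k = 2 (N-2) (N-4), so that e^(P/k) has a derivative at least
   c r^3, and P(r) >= 4 k ln r - C. This is a contradiction, as H < 4 k for N <= 12. *)
Require Import Defs.
From HB Require Import structures.
From mathcomp Require Import all_boot all_order all_algebra.
From mathcomp Require Import all_classical all_reals all_analysis.
From mathcomp Require Import measurable_realfun ring lra.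
Import Order.TTheory GRing.Theory Num.Theory.
Import numFieldNormedType.Exports.

Set Implicit Arguments.
Unset Strict Implicit.
Unset Printing Implicit Defensive.

Local Open Scope classical_set_scope.
Local Open Scope ring_scope.

(** The Rellich inequality is needed for every [phi] in H^2 and H^1_0 of the complement of an
    arbitrary compact set. Test functions approximate such a [phi] in H^1 only, not in H^2, so the
    classical inequality with weight |x|^-4 does not extend from test functions by density. The
    weight (1 + |x|^2)^-1 is used instead: it is smooth with bounded derivatives, two integrations
    by parts survive an H^1 limit, and a quadratic decay of u beats its square.

    The bound on N comes from H < 4 k, that is N^2 (N-4) < 128 (N-2): true at N = 12 (1152 < 1280),
    false at N = 13 (1521 > 1408).

    On the side of the radial equations, estimates are obtained from the monotonicity of explicit
    functions; integrals enter only where stability is turned into a bound on P.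

    That beta0 < beta1 is strict has two sources. If beta0 is attained, its solution is not even
    stable outside a compact set, whereas stability is a closed condition on beta; if it is not,
    beta0 is chosen with a factor 2 of room below all betas. *)

(* Not a class, unlike is_derive: no instance search interferes with the rules
   below, which are stated for lambda-abstractions. *)
Definition has_deriv {R : realType} (f : R -> R) (x a : R) : Prop := is_derive x 1 f a.

(** * Differentiation rules in one variable *)

Section derivative_rules.
Context {R : realType}.
Implicit Types (f g : R -> R) (x a b : R).

Lemma der_eq f x a b : has_deriv f x a -> a = b -> has_deriv f x b.
Proof. by move=> ? <-. Qed.

Lemma derD f g x a b : has_deriv f x a -> has_deriv g x b ->
  has_deriv (fun t => f t + g t) x (a + b).
Proof. by move=> hf hg; exact: is_deriveD. Qed.

Lemma derN f x a : has_deriv f x a -> has_deriv (fun t => - f t) x (- a).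
Proof. by move=> hf; exact: is_deriveN. Qed.

Lemma derM f g x a b : has_deriv f x a -> has_deriv g x b ->
  has_deriv (fun t => f t * g t) x (a * g x + f x * b).
Proof.
move=> hf hg; have := is_deriveM hf hg; move/der_eq; apply.
by rewrite addrC; congr (_ + _); rewrite -[LHS]/(_ * _) // mulrC.
Qed.

Lemma der_cst (c x : R) : has_deriv (fun=> c) x 0.
Proof. exact: is_derive_cst. Qed.

Lemma der_id x : has_deriv (fun t => t) x 1.
Proof. exact: is_derive_id. Qed.

Lemma derX f n x a : has_deriv f x a ->
  has_deriv (fun t => f t ^+ n) x (n%:R * f x ^+ n.-1 * a).
Proof.
elim: n f x a => [|n IHn] f x a hf.
  by rewrite !mul0r; exact: der_cst.
rewrite (_ : (fun t => f t ^+ n.+1) = (fun t => f t * f t ^+ n)); last first.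
  by apply/funext => t; rewrite exprS.
apply: der_eq; first exact: (derM hf (IHn _ _ _ hf)).
case: n {IHn} => [|n] /=; first by rewrite !expr0; ring.
by rewrite (exprS _ n) -[n.+2]addn1 natrD; ring.
Qed.

Lemma der_comp f g x a b : has_deriv g x b -> has_deriv f (g x) a ->
  has_deriv (fun t => f (g t)) x (a * b).
Proof. by move=> hg hf; exact: (is_derive1_comp hf hg). Qed.

Lemma der_expR f x a : has_deriv f x a ->
  has_deriv (fun t => expR (f t)) x (expR (f x) * a).
Proof. by move=> hf; apply: der_comp => //; exact: is_derive_expR. Qed.

Lemma der_ln f x a : 0 < f x -> has_deriv f x a ->
  has_deriv (fun t => ln (f t)) x ((f x)^-1 * a).
Proof. by move=> fx hf; apply: der_comp => //; exact: is_derive1_ln. Qed.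

Lemma der_inv f x a : f x != 0 -> has_deriv f x a ->
  has_deriv (fun t => (f t)^-1) x (- (f x) ^- 2 * a).
Proof. by move=> fx hf; apply: is_deriveV. Qed.

Lemma der_continuous f x a : has_deriv f x a -> {for x, continuous f}.
Proof.
move=> [h _]; apply: differentiable_continuous; exact/derivable1_diffP.
Qed.

End derivative_rules.

(** The derivative is synthesised in an existential variable by following the syntax; there remain
    the nonvanishing conditions of inverses and one equation with the announced derivative, usually
    closed by [ring] or [field]. [eassumption] comes first so that hypotheses on unknown functions
    are used. *)
Ltac derive_all := eapply der_eq;
  [ repeat (first [ eassumption | lazymatch goal with
    | |- has_deriv (fun _ => ?c) _ _ => exact: der_cst
    | |- has_deriv (fun t => t) _ _ => exact: der_id
    | |- has_deriv (fun t => _ + _) _ _ => apply: derD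
    | |- has_deriv (fun t => - _) _ _ => apply: derN
    | |- has_deriv (fun t => _ * _) _ _ => apply: derM
    | |- has_deriv (fun t => _ ^+ _) _ _ => apply: derX
    | |- has_deriv (fun t => _ ^-1) _ _ => apply: der_inv
    | |- has_deriv (fun t => expR _) _ _ => apply: der_expR
    | |- has_deriv (fun t => ln _) _ _ => apply: der_ln
    | |- has_deriv -%R _ _ => exact: (derN (der_id _))
    | |- has_deriv ( *%R ?a) _ _ => exact: (derM (der_cst a _) (der_id _))
    end ]) | cbv beta].

Section monotone.
Context {R : realType}.

Lemma cts_within (f : R -> R) (D : set R) : continuous f -> {within D, continuous f}.
Proof. by move=> cf; apply: continuous_subspaceT. Qed.

(** Continuity up to the ends, but a derivative only inside: the radial equations are singular at r
    = 0, where many applications start. *)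
Lemma derive_ge0_le (f df : R -> R) (a b : R) : a <= b -> {within `[a, b], continuous f} ->
  (forall r, a < r < b -> has_deriv f r (df r)) ->
  (forall r, a < r < b -> 0 <= df r) -> f a <= f b.
Proof.
move=> ab cf dfE df0; case: (ltgtP a b) ab => // [ab _|-> //].
have [|c cab /eqP] := @MVT _ f df a b ab _ cf.
  by move=> x; rewrite in_itv; exact: dfE.
rewrite subr_eq => /eqP ->; rewrite lerDr mulr_ge0 ?subr_ge0 ?(ltW ab) ?df0 //.
Qed.

Lemma derive_le0_ge (f df : R -> R) (a b : R) : a <= b -> {within `[a, b], continuous f} ->
  (forall r, a < r < b -> has_deriv f r (df r)) ->
  (forall r, a < r < b -> df r <= 0) -> f b <= f a.
Proof.
move=> ab cf dfE df0; rewrite -lerN2.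
apply: (@derive_ge0_le (fun t => - f t) (fun t => - df t)) => //.
- by move=> x; apply: cvgN; exact: cf.
- by move=> r rab; exact: derN (dfE _ rab).
- by move=> r rab; rewrite oppr_ge0 df0.
Qed.

End monotone.

(** * Radial profiles *)

(* U is the profile of u, V that of - \Delta u, in dimension n.+1, and A = U', B = V';
   off ]0, +oo[ only continuity is required. *)
Record profile {R : realType} (n : nat) (b : R) (U A V B : R -> R) : Prop := Profile {
  prU : forall r, 0 < r -> has_deriv U r (A r);
  prA : forall r, 0 < r -> has_deriv A r (- V r - n%:R / r * A r);
  prV : forall r, 0 < r -> has_deriv V r (B r);
  prB : forall r, 0 < r -> has_deriv B r (- expR (U r) - n%:R / r * B r);
  cU : continuous U;
  cA : continuous A;
  cV : continuous V;
  cB : continuous B;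
  profile_U0 : U 0 = 0;
  profile_A0 : A 0 = 0;
  profile_V0 : V 0 = b;
  profile_B0 : B 0 = 0 }.

(** [t ^+ n] is the integrating factor of the radial Laplacian: it absorbs the singular term
    [n / r * f]. *)
Lemma der_weight {R : realType} (f : R -> R) (n : nat) (r g : R) : 0 < r ->
  has_deriv f r (g - n%:R / r * f r) ->
  has_deriv (fun t => t ^+ n * f t) r (r ^+ n * g).
Proof.
move=> r0 hf; have rn0 : r != 0 by rewrite gt_eqF.
derive_all.
case: n hf => [|n] hf /=; first by rewrite !expr0; field.
by rewrite !exprS; field.
Qed.

Lemma cts_mul {R : realType} {T : topologicalType} (f g : T -> R) : continuous f -> continuous g ->
  continuous (fun t => f t * g t).
Proof. by move=> cf cg x; apply: cvgM; [exact: cf|exact: cg]. Qed.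

Lemma cts_add {R : realType} {T : topologicalType} (f g : T -> R) : continuous f -> continuous g ->
  continuous (fun t => f t + g t).
Proof. by move=> cf cg x; apply: cvgD; [exact: cf|exact: cg]. Qed.

Lemma cts_opp {R : realType} {T : topologicalType} (f : T -> R) : continuous f ->
  continuous (fun t => - f t).
Proof. by move=> cf x; apply: cvgN; exact: cf. Qed.

Lemma cts_inv {R : realType} {T : topologicalType} (f : T -> R) :
  (forall x, f x != 0) -> continuous f -> continuous (fun t => (f t)^-1).
Proof. by move=> f0 cf x; apply: cvgV => //; exact: cf. Qed.

Lemma cts_id {R : realType} : continuous (fun t : R => t).
Proof. by move=> x; exact: cvg_id. Qed.

Lemma cts_cst {R : realType} {T : topologicalType} (c : R) : continuous (fun t : T => c).
Proof. by move=> x; exact: cvg_cst. Qed.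

Lemma cts_exp {R : realType} {T : topologicalType} (f : T -> R) n : continuous f ->
  continuous (fun t => f t ^+ n).
Proof.
move=> cf; elim: n => [|n IHn].
  by rewrite (_ : (fun t => _) = (fun=> 1)) //; exact: cts_cst.
rewrite (_ : (fun t => f t ^+ n.+1) = (fun t => f t * f t ^+ n)); last first.
  by apply/funext => t; rewrite exprS.
exact: cts_mul.
Qed.

Lemma cts_expR {R : realType} {T : topologicalType} (f : T -> R) : continuous f ->
  continuous (fun t => expR (f t)).
Proof.
move=> cf x; apply: (@continuous_comp _ _ _ f expR); first exact: cf.
exact: continuous_expR.
Qed.

Ltac cts_all := repeat (first [ eassumption | lazymatch goal with
    | |- continuous (fun t => t) => apply: cts_id
    | |- continuous (fun t => _ + _) => apply: cts_add
    | |- continuous (fun t => - _) => apply: cts_opp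
    | |- continuous (fun t => _ * _) => apply: cts_mul
    | |- continuous (fun t => _ ^+ _) => apply: cts_exp
    | |- continuous (fun t => expR _) => apply: cts_expR
    | |- continuous -%R => exact: (cts_opp cts_id)
    | |- continuous ( *%R ?a) => exact: (cts_mul (@cts_cst _ _ a) cts_id)
    | |- _ => apply: cts_cst end ]).

(** * A priori bounds for a single radial profile *)

Section profile_theory.
Context {R : realType} (n : nat) (b : R) (U A V B : R -> R).
Hypothesis n0 : (0 < n)%N.
Hypothesis P : profile n b U A V B.
Let cU := cU P.
Let cA := cA P.
Let cV := cV P.
Let cB := cB P.

Lemma der_wA r : 0 < r -> has_deriv (fun t => t ^+ n * A t) r (r ^+ n * (- V r)).
Proof. by move=> r0; apply: der_weight => //; exact: (prA P). Qed.

Lemma der_wB r : 0 < r -> has_deriv (fun t => t ^+ n * B t) r (r ^+ n * (- expR (U r))).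
Proof. by move=> r0; apply: der_weight => //; exact: (prB P). Qed.

Lemma B_le0 r : 0 <= r -> B r <= 0.
Proof.
rewrite le_eqVlt => /predU1P[<-|r0]; first by rewrite (profile_B0 P).
rewrite -(pmulr_rle0 _ (exprn_gt0 n r0)).
have -> : 0 = 0 ^+ n * B 0 by rewrite (profile_B0 P) mulr0.
apply: (@derive_le0_ge _ (fun t => t ^+ n * B t)
  (fun r => r ^+ n * (- expR (U r))) 0 r (ltW r0)).
- by apply: cts_within; cts_all.
- by move=> x /andP[x0 _]; exact: der_wB.
- move=> x /andP[x0 _]; rewrite mulrN oppr_le0 mulr_ge0 ?expR_ge0 //.
  by rewrite exprn_ge0 // ltW.
Qed.

Lemma V_noninc r s : 0 <= r -> r <= s -> V s <= V r.
Proof.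
move=> r0 rs; apply: (@derive_le0_ge _ V B r s rs); first exact: cts_within.
- by move=> x /andP[rx _]; apply: (prV P); exact: le_lt_trans rx.
- by move=> x /andP[rx _]; apply: B_le0; exact: (le_trans r0 (ltW rx)).
Qed.

Lemma V_le r : 0 <= r -> V r <= b.
Proof. by move=> r0; rewrite -(profile_V0 P) V_noninc. Qed.

(* The iteration steps 2^-m of the blow-up argument add up to less than 2, while each
   of them increases U by 4. *)
Lemma blow_up_step rho M h : 1 <= rho -> 0 <= h -> h <= 1 ->
  (forall r, rho <= r -> 0 <= A r) -> V rho <= 0 -> M <= U rho ->
  M + expR M * 4 ^- n / 24 * h ^+ 4 <= U (rho + h).
Proof.
move=> rho1 h0 h1 A0 V0 MU.
have rho0 : 0 < rho by exact: lt_le_trans rho1.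
have Uge s : rho <= s -> M <= U s.
  move=> rs; apply: (le_trans MU); apply: (@derive_ge0_le _ U A rho s rs).
  - exact: cts_within.
  - by move=> x /andP[rx _]; apply: (prU P); exact: lt_trans rx.
  - by move=> x /andP[rx _]; apply: A0; exact: ltW.
(* Here s <= rho + 1 <= 2 rho. Undoing the weight [t ^+ n] costs this factor once for [B] and once
   for [A], whence [4 ^- n]. *)
have pw s : rho <= s <= rho + h -> 2 ^- n <= (rho / s) ^+ n.
  move=> /andP[rs sh]; rewrite -exprVn; apply: lerXn2r.
  - by rewrite nnegrE.
  - by rewrite nnegrE divr_ge0 // ltW // (lt_le_trans rho0).
  - rewrite ler_pdivlMr; last exact: (lt_le_trans rho0).
    rewrite ler_pdivrMl //; lra.
have eM := expR_gt0 M.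
(* Four integrations of e^U >= e^M, through [B], [V], [A] and [U], raise the power of s - rho to 4;
   the final 24 is 4!. *)
have Bub s : rho <= s <= rho + h -> B s <= - (2 ^- n * expR M * (s - rho)).
  move=> sh; have /andP[rs sh'] := sh; have s0 : 0 < s by exact: lt_le_trans rs.
  have : s ^+ n * B s + rho ^+ n * expR M * (s - rho) <=
      rho ^+ n * B rho + rho ^+ n * expR M * (rho - rho).
    apply: (@derive_le0_ge _ (fun t => t ^+ n * B t + rho ^+ n * expR M * (t - rho))
      (fun t => t ^+ n * (- expR (U t)) + rho ^+ n * expR M) rho s rs).
    - by apply: cts_within; cts_all.
    - move=> x /andP[rx _]; have x0 : 0 < x by exact: lt_trans rx.
      have hw := der_wB x0.
      by derive_all; ring.
    - move=> x /andP[rx _]; have x0 : 0 < x by exact: lt_trans rx.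
      rewrite mulrN addrC subr_le0; apply: ler_pM.
      + by rewrite exprn_ge0 // ltW.
      + exact: ltW.
      + by rewrite lerXn2r ?nnegrE ?ltW.
      + by rewrite ler_expR; apply: Uge; exact: ltW.
  rewrite subrr mulr0 addr0.
  have : rho ^+ n * B rho <= 0 by rewrite pmulr_rle0 ?exprn_gt0 // B_le0 // ltW.
  move=> h2 h3; have h4 := le_trans h3 h2.
  have h5 : B s <= - ((rho / s) ^+ n * expR M * (s - rho)).
    rewrite -subr_le0 opprK -(pmulr_rle0 _ (exprn_gt0 n s0)) mulrDr.
    rewrite (_ : _ + _ = s ^+ n * B s + rho ^+ n * expR M * (s - rho)) //.
    rewrite expr_div_n; field.
    by rewrite expf_neq0 // gt_eqF.
  apply: (le_trans h5); rewrite lerN2; apply: ler_wpM2r; first by rewrite subr_ge0.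
  by apply: ler_wpM2r; [exact: ltW|exact: pw].
have Vub s : rho <= s <= rho + h -> V s <= - (2 ^- n * expR M * (s - rho) ^+ 2 / 2).
  move=> sh; have /andP[rs sh'] := sh.
  rewrite -subr_le0 opprK.
  suff : V s + 2 ^- n * expR M * (s - rho) ^+ 2 / 2 <=
    V rho + 2 ^- n * expR M * (rho - rho) ^+ 2 / 2.
    move=> hh; apply: (le_trans hh); rewrite subrr expr0n /= mulr0 mul0r addr0 //.
  apply: (@derive_le0_ge _ (fun t => V t + 2 ^- n * expR M * (t - rho) ^+ 2 / 2)
      (fun t => B t + 2 ^- n * expR M * (t - rho)) rho s rs).
  - by apply: cts_within; cts_all.
  - move=> x /andP[rx _]; have x0 : 0 < x by exact: lt_trans rx.
    have hw := prV P x0.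
    derive_all; rewrite /=; field.
    by rewrite expf_neq0 // pnatr_eq0.
  - move=> x /andP[rx xs]; rewrite -[X in _ + X]opprK subr_le0; apply: Bub.
    by rewrite (ltW rx) /= (le_trans (ltW xs)).
have Alb s : rho <= s <= rho + h -> 4 ^- n * expR M * (s - rho) ^+ 3 / 6 <= A s.
  move=> sh; have /andP[rs sh'] := sh; have s0 : 0 < s by exact: lt_le_trans rs.
  have : rho ^+ n * A rho - rho ^+ n * 2 ^- n * expR M * (rho - rho) ^+ 3 / 6 <=
      s ^+ n * A s - rho ^+ n * 2 ^- n * expR M * (s - rho) ^+ 3 / 6.
    apply: (@derive_ge0_le _ (fun t => t ^+ n * A t -
        rho ^+ n * 2 ^- n * expR M * (t - rho) ^+ 3 / 6)
      (fun t => t ^+ n * (- V t) - rho ^+ n * (2 ^- n * expR M * (t - rho) ^+ 2 / 2))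
      rho s rs).
    - by apply: cts_within; cts_all.
    - move=> x /andP[rx _]; have x0 : 0 < x by exact: lt_trans rx.
      have hw := der_wA x0.
      derive_all; rewrite /=; field.
      by rewrite expf_neq0 // pnatr_eq0.
    - move=> x /andP[rx xs]; have x0 : 0 < x by exact: lt_trans rx.
      rewrite subr_ge0; apply: ler_pM.
      + by rewrite exprn_ge0 // ltW.
      + rewrite !mulr_ge0 ?invr_ge0 ?exprn_ge0 ?expR_ge0 //; lra.
      + by rewrite lerXn2r ?nnegrE ?ltW.
      + rewrite lerNr; apply: Vub.
        by rewrite (ltW rx) /= (le_trans (ltW xs)).
  rewrite subrr expr0n /= mulr0 mul0r subr0 => h2.
  have h3 : 0 <= s ^+ n * A s - rho ^+ n * 2 ^- n * expR M * (s - rho) ^+ 3 / 6.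
    by apply: le_trans h2; rewrite mulr_ge0 ?A0 // exprn_ge0 // ltW.
  have h5 : (rho / s) ^+ n * 2 ^- n * expR M * (s - rho) ^+ 3 / 6 <= A s.
    rewrite -subr_ge0 -(pmulr_rge0 _ (exprn_gt0 n s0)) mulrDr.
    rewrite (_ : _ + _ = s ^+ n * A s - rho ^+ n * 2 ^- n * expR M * (s - rho) ^+ 3 / 6) //.
    rewrite expr_div_n; field.
    by rewrite !expf_neq0 ?gt_eqF ?pnatr_eq0.
  apply: le_trans h5.
  have -> : 4 ^- n = 2 ^- n * 2 ^- n :> R by rewrite -invfM -exprMn -natrM.
  rewrite -!mulrA; apply: ler_wpM2r; last exact: pw.
  by rewrite !mulr_ge0 ?invr_ge0 ?exprn_ge0 ?expR_ge0 ?subr_ge0.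
have rh : rho <= rho + h by lra.
have : U rho - 4 ^- n * expR M * (rho - rho) ^+ 4 / 24 <=
   U (rho + h) - 4 ^- n * expR M * ((rho + h) - rho) ^+ 4 / 24.
  apply: (@derive_ge0_le _ (fun t => U t - 4 ^- n * expR M * (t - rho) ^+ 4 / 24)
    (fun t => A t - 4 ^- n * expR M * (t - rho) ^+ 3 / 6) rho _ rh).
  - by apply: cts_within; cts_all.
  - move=> x /andP[rx _]; have x0 : 0 < x by exact: lt_trans rx.
    have hw := prU P x0.
    derive_all; rewrite /=; field.
    by rewrite expf_neq0 // pnatr_eq0.
  - move=> x /andP[rx xs]; rewrite subr_ge0; apply: Alb.
    by rewrite (ltW rx) /= (ltW xs).
rewrite subrr expr0n /= mulr0 mul0r subr0 [rho + h]addrC addrK => h2.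
apply: (@le_trans _ _ (U rho + 4 ^- n * expR M * h ^+ 4 / 24)); last lra.
by rewrite lerD // le_eqVlt; apply/orP; left; apply/eqP; ring.
Qed.


End profile_theory.

Section profile_theory_bounds.
Context {R : realType} (n : nat) (b : R) (U A V B : R -> R).
Hypothesis n0 : (0 < n)%N.
Hypothesis P : profile n b U A V B.
Let cU := cU P.
Let cA := cA P.
Let cV := cV P.
Let cB := cB P.

Lemma U_step r s : 0 <= r -> r <= s -> (forall t, r <= t -> 0 <= A t) -> U r <= U s.
Proof.
move=> r0 rs A0; apply: (@derive_ge0_le _ U A r s rs).
- exact: cts_within.
- by move=> x /andP[rx _]; apply: (prU P); exact: le_lt_trans rx.
- by move=> x /andP[rx _]; apply: A0; exact: ltW.
Qed.

(** A gain of 4 in [U] multiplies e^U by at least 16, which offsets the loss in [h ^+ 4] when the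
    step is halved. *)
Lemma expR4_ge16 : 16 <= expR 4 :> R.
Proof.
have e2 : 2 <= expR 1 :> R by have := expR_ge1Dx (1 : R); lra.
have -> : 4 = 4%:R * 1 :> R by rewrite mulr1.
by rewrite expRM_natl (_ : 16 = 2 ^+ 4) ?lerXn2r ?nnegrE ?expR_ge0 // -natrX.
Qed.

Lemma blow_up rho : 1 <= rho -> (forall r, rho <= r -> 0 <= A r) -> V rho <= 0 ->
  96 * 4 ^+ n <= U rho -> False.
Proof.
move=> rho1 A0 V0 Urho; set M := 96 * 4 ^+ n in Urho.
have rho0 : 0 <= rho by lra.
(* The threshold is 4 * 24 * 4^n: with e^M >= M it makes the first step, of length 1, raise [U] by
   4. *)
have M4 : 4 <= expR M * 4 ^- n / 24.
  have : M <= expR M by have := expR_ge1Dx M; lra.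
  have p4 : 0 < 4 ^+ n :> R by rewrite exprn_gt0.
  rewrite ler_pdivlMr // ler_pdivlMr // => h; apply: le_trans h; rewrite /M.
  by rewrite le_eqVlt; apply/orP; left; apply/eqP; ring.
pose rm m := rho + 2 - 2 * 2 ^- m.
have H m : M + (4 * m)%:R <= U (rm m).
  elim: m => [|m IHm]; first by rewrite muln0 addr0 /rm expr0 invr1 mulr1 addrK.
  have -> : rm m.+1 = rm m + 2 ^- m.
    by rewrite /rm exprS; field; rewrite expf_neq0 // pnatr_eq0.
  have p2 : 0 < 2 ^- m :> R by rewrite invr_gt0 exprn_gt0.
  have p2' : 2 ^- m <= 1 :> R by rewrite invf_le1 ?exprn_gt0 // exprn_ege1 // ler1n.
  have rhorm : rho <= rm m by rewrite /rm; lra.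
  apply: (le_trans _ (blow_up_step P _ (ltW p2) p2' _ _ IHm)).
  2: exact: le_trans rhorm.
  2: by move=> r rr; apply: A0; exact: le_trans rr.
  2: by apply: le_trans V0; exact: (V_noninc P).
  rewrite mulnS addnC natrD addrA lerD2l.
  have e16 : 16 ^+ m <= expR (4 * m)%:R :> R.
    rewrite natrM mulrC expRM_natl; apply: lerXn2r; rewrite ?nnegrE ?expR_ge0 //.
    exact: expR4_ge16.
  apply: (le_trans M4); rewrite expRD.
  have -> : (2 ^- m) ^+ 4 = 16^-1 ^+ m :> R.
    by rewrite -exprVn -exprM mulnC exprM exprVn -natrX.
  rewrite [leRHS](_ : _ = (expR M * 4 ^- n / 24) * (expR (4 * m)%:R * 16^-1 ^+ m)); last first.
    by rewrite [16^-1 ^+ m]exprVn; ring.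
  apply: ler_peMr; first by lra.
  by rewrite exprVn ler_pdivlMr ?exprn_gt0 // mul1r.
(* All radii [rm m] stay below rho + 2, so [U (rho + 2)] would have to exceed M + 4 m for every
   m. *)
have [m hm] : exists m : nat, U (rho + 2) - M < m%:R.
  by exists (Num.truncn (U (rho + 2) - M)).+1; exact: truncnS_gt.
have : U (rm m) <= U (rho + 2).
  have p2 : 0 < 2 ^- m :> R by rewrite invr_gt0 exprn_gt0.
  have p2' : 2 ^- m <= 1 :> R by rewrite invf_le1 ?exprn_gt0 // exprn_ege1 // ler1n.
  apply: U_step; rewrite /rm; try lra.
  by move=> t ht; apply: A0; lra.
have := H m; rewrite natrM => h1 h2.
have : 0 <= m%:R :> R by [].
lra.
Qed.

(** Once negative, [V] stays below some - c; the Laplacian of u is then at least c, which pushes [A]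
    above 1 and [U] up to the threshold of [blow_up]. *)
Lemma V_ge0 r : 0 <= r -> 0 <= V r.
Proof.
move=> r0; rewrite leNgt; apply/negP => Vr0; pose c := - V r.
have c0 : 0 < c by rewrite oppr_gt0.
have Vc t : r <= t -> c <= - V t by move=> rt; rewrite lerN2 (V_noninc P).
(* Beyond r3 one has c t >= n + 1, so the derivative t^(n-1) (t (- V) - n) of the function [f] below
   is at least 1. *)
pose r3 := r + 1 + (n%:R + 1) / c.
have nc0 : 0 < (n%:R + 1) / c by rewrite divr_gt0 // ltr_wpDl.
have r31 : 1 <= r3 by rewrite /r3; lra.
have r3r : r <= r3 by rewrite /r3; lra.
have r3c : n%:R + 1 <= c * r3.
  rewrite /r3 2!mulrDr mulrCA divff ?gt_eqF // !mulr1.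
  have : 0 <= c * r by rewrite mulr_ge0 // ltW.
  lra.
pose f t := t ^+ n * (A t - 1).
have fle t : r3 <= t -> f r3 + (t - r3) <= f t.
  move=> rt; suff : f r3 - (r3 - r3) <= f t - (t - r3) by rewrite /f; lra.
  apply: (@derive_ge0_le _ (fun t => f t - (t - r3))
    (fun t => t ^+ n * (- V t) - n%:R * t ^+ n.-1 - 1) r3 t rt).
  - by apply: cts_within; rewrite /f; cts_all.
  - move=> x /andP[rx _]; have x0 : 0 < x by apply: lt_trans rx; lra.
    have hw := der_wA P x0.
    rewrite [X in has_deriv X](_ : _ = fun t => t ^+ n * A t - t ^+ n - (t - r3)); last first.
      by apply/funext => z; rewrite /f; ring.
    by derive_all; ring.
  - move=> x /andP[rx _]; have x0 : 0 < x by apply: lt_trans rx; lra.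
    have x1 : 1 <= x by apply: le_trans (ltW rx).
    have -> : x ^+ n = x ^+ n.-1 * x by rewrite -exprSr prednK.
    have p1 : 1 <= x ^+ n.-1 by exact: exprn_ege1.
    have h1 : c <= - V x by apply: Vc; apply: le_trans (ltW rx).
    have h2 : 1 <= x * - V x - n%:R.
      have : c * r3 <= x * - V x by rewrite mulrC ler_pM //; lra.
      lra.
    have : 1 <= x ^+ n.-1 * (x * - V x - n%:R) by exact: mulr_ege1.
    by rewrite mulrBr mulrA [_ * n%:R]mulrC; lra.
(* By then [f], growing with slope at least 1, is nonnegative, that is, A >= 1. *)
pose r4 := r3 + `|f r3|.
have r43 : r3 <= r4 by rewrite /r4 lerDl.
have A1 t : r4 <= t -> 1 <= A t.
  move=> rt; have t0 : 0 < t by lra.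
  rewrite -subr_ge0 -(pmulr_rge0 _ (exprn_gt0 n t0)).
  apply: le_trans (fle t _); last exact: le_trans rt.
  by have := ler_norm (- f r3); rewrite normrN; rewrite /r4 in rt; lra.
(* With slope at least 1 from r4 on, [U] makes up for a negative [U r4] and reaches the threshold of
   [blow_up]. *)
pose r5 := r4 + `|U r4| + 96 * 4 ^+ n.
have p4 : 0 <= 96 * 4 ^+ n :> R by rewrite mulr_ge0 // exprn_ge0.
have r54 : r4 <= r5 by rewrite /r5 -addrA lerDl addr_ge0.
apply: (@blow_up r5); first lra.
- by move=> t ht; apply: le_trans (A1 t _) => //; exact: le_trans ht.
- by rewrite -oppr_ge0; apply: le_trans (Vc _ _); [exact: ltW|lra].
have : U r4 - r4 <= U r5 - r5.
  apply: (@derive_ge0_le _ (fun t => U t - t) (fun t => A t - 1) _ _ r54).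
  - by apply: cts_within; cts_all.
  - move=> x /andP[rx _]; have hw : has_deriv U x (A x) by apply: (prU P); lra.
    by derive_all; ring.
  - by move=> x /andP[rx _]; rewrite subr_ge0 A1 // ltW.
by have := ler_norm (- U r4); rewrite normrN /r5; lra.
Qed.

Lemma A_le0 r : 0 <= r -> A r <= 0.
Proof.
rewrite le_eqVlt => /predU1P[<-|r0]; first by rewrite (profile_A0 P).
rewrite -(pmulr_rle0 _ (exprn_gt0 n r0)).
have -> : 0 = 0 ^+ n * A 0 by rewrite (profile_A0 P) mulr0.
apply: (@derive_le0_ge _ (fun t => t ^+ n * A t)
  (fun r => r ^+ n * (- V r)) 0 r (ltW r0)).
- by apply: cts_within; cts_all.
- by move=> x /andP[x0 _]; exact: (der_wA P).
- move=> x /andP[x0 _]; rewrite mulrN oppr_le0 mulr_ge0 ?V_ge0 ?ltW //.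
  by rewrite exprn_gt0.
Qed.

Lemma U_noninc r s : 0 <= r -> r <= s -> U s <= U r.
Proof.
move=> r0 rs; apply: (@derive_le0_ge _ U A r s rs); first exact: cts_within.
- by move=> x /andP[rx _]; apply: (prU P); exact: le_lt_trans rx.
- by move=> x /andP[rx _]; apply: A_le0; exact: (le_trans r0 (ltW rx)).
Qed.

Lemma U_le0 r : 0 <= r -> U r <= 0.
Proof. by move=> r0; rewrite -(profile_U0 P) U_noninc. Qed.

Lemma A_le_of_V c r : (forall t, 0 <= t -> c <= V t) -> 0 <= r -> A r <= - (c * r / n.+1%:R).
Proof.
move=> Vc; rewrite le_eqVlt => /predU1P[<-|r0].
  by rewrite (profile_A0 P) mulr0 mul0r oppr0.
rewrite -subr_le0 opprK -(pmulr_rle0 _ (exprn_gt0 n r0)).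
have -> : 0 = 0 ^+ n * A 0 + c * 0 ^+ n.+1 / n.+1%:R.
  by rewrite (profile_A0 P) exprS mulr0 mul0r mulr0 mul0r addr0.
rewrite (_ : r ^+ n * _ = r ^+ n * A r + c * r ^+ n.+1 / n.+1%:R); last first.
  by rewrite exprS; ring.
apply: (@derive_le0_ge _ (fun t => t ^+ n * A t + c * t ^+ n.+1 / n.+1%:R)
  (fun t => t ^+ n * (c - V t)) 0 r (ltW r0)).
- by apply: cts_within; cts_all.
- move=> x /andP[x0 _]; have hw := der_wA P x0.
  by derive_all; rewrite /=; field; rewrite nat1r pnatr_eq0.
- move=> x /andP[x0 _]; rewrite pmulr_rle0 ?exprn_gt0 // subr_le0 Vc // ltW //.
Qed.

(** Comparison with the paraboloid whose Laplacian is - c; this is the source of the Gaussian decay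
    of e^u. *)
Lemma U_le_of_V c r : (forall t, 0 <= t -> c <= V t) -> 0 <= r ->
  U r <= - (c * r ^+ 2 / (2 * n.+1%:R)).
Proof.
move=> Vc r0; rewrite -subr_le0 opprK.
have -> : 0 = U 0 + c * 0 ^+ 2 / (2 * n.+1%:R).
  by rewrite (profile_U0 P) expr0n /= mulr0 mul0r addr0.
apply: (@derive_le0_ge _ (fun t => U t + c * t ^+ 2 / (2 * n.+1%:R))
  (fun t => A t + c * t / n.+1%:R) 0 r r0).
- by apply: cts_within; cts_all.
- move=> x /andP[x0 _]; have hw := prU P x0.
  by derive_all; rewrite /=; field; rewrite nat1r pnatr_eq0.
- move=> x /andP[x0 _]; rewrite -[X in _ + X]opprK subr_le0; apply: A_le_of_V => //.
  exact: ltW.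
Qed.

Lemma U_ge r : 0 <= r -> - (b * r ^+ 2 / (2 * n.+1%:R)) <= U r.
Proof.
have Ab t : 0 <= t -> - (b * t / n.+1%:R) <= A t.
  rewrite le_eqVlt => /predU1P[<-|t0].
    by rewrite (profile_A0 P) mulr0 mul0r oppr0.
  rewrite -subr_ge0 opprK -(pmulr_rge0 _ (exprn_gt0 n t0)).
  have -> : 0 = 0 ^+ n * A 0 + b * 0 ^+ n.+1 / n.+1%:R.
    by rewrite (profile_A0 P) exprS mulr0 mul0r mulr0 mul0r addr0.
  rewrite (_ : t ^+ n * _ = t ^+ n * A t + b * t ^+ n.+1 / n.+1%:R); last first.
    by rewrite exprS; ring.
  apply: (@derive_ge0_le _ (fun t => t ^+ n * A t + b * t ^+ n.+1 / n.+1%:R)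
    (fun t => t ^+ n * (b - V t)) 0 t (ltW t0)).
  - by apply: cts_within; cts_all.
  - move=> x /andP[x0 _]; have hw := der_wA P x0.
    by derive_all; rewrite /=; field; rewrite nat1r pnatr_eq0.
  - by move=> x /andP[x0 _]; rewrite pmulr_rge0 ?exprn_gt0 // subr_ge0 (V_le P) // ltW.
move=> r0; rewrite -subr_ge0 opprK.
have -> : 0 = U 0 + b * 0 ^+ 2 / (2 * n.+1%:R).
  by rewrite (profile_U0 P) expr0n /= mulr0 mul0r addr0.
apply: (@derive_ge0_le _ (fun t => U t + b * t ^+ 2 / (2 * n.+1%:R))
  (fun t => A t + b * t / n.+1%:R) 0 r r0).
- by apply: cts_within; cts_all.
- move=> x /andP[x0 _]; have hw := prU P x0.
  by derive_all; rewrite /=; field; rewrite nat1r pnatr_eq0.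
- by move=> x /andP[x0 _]; rewrite -[X in _ + X]opprK subr_ge0; apply: Ab; exact: ltW.
Qed.

(** Write N = n + 1. On [0, 1] one has U >= - b / (2 N), so e^U >= k >= 1 - b / (2 N), and [V] loses
    at least k / (2 N) there. As [V] stays nonnegative, 2 N b >= k, whence (2 N + 1) b >= 1. A bound
    that is the same for all solutions makes beta0 positive. *)
Lemma beta_ge : (2 * n.+1%:R + 1)^-1 <= b.
Proof.
have b0 : 0 <= b by rewrite -(profile_V0 P) V_ge0.
pose k := expR (- (b / (2 * n.+1%:R))).
have Uk t : 0 <= t <= 1 -> k <= expR (U t).
  move=> /andP[t0 t1]; rewrite ler_expR; apply: le_trans (U_ge t0); rewrite lerN2.
  rewrite ler_pdivrMr // divfK // ler_piMr //; exact: exprn_ile1.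
have Bk t : 0 <= t <= 1 -> B t <= - (k * t / n.+1%:R).
  move=> /andP[]; rewrite le_eqVlt => /predU1P[<- _|t0 t1].
    by rewrite (profile_B0 P) mulr0 mul0r oppr0.
  rewrite -subr_le0 opprK -(pmulr_rle0 _ (exprn_gt0 n t0)).
  have -> : 0 = 0 ^+ n * B 0 + k * 0 ^+ n.+1 / n.+1%:R.
    by rewrite (profile_B0 P) exprS mulr0 mul0r mulr0 mul0r addr0.
  rewrite (_ : t ^+ n * _ = t ^+ n * B t + k * t ^+ n.+1 / n.+1%:R); last first.
    by rewrite exprS; ring.
  apply: (@derive_le0_ge _ (fun t => t ^+ n * B t + k * t ^+ n.+1 / n.+1%:R)
    (fun t => t ^+ n * (k - expR (U t))) 0 t (ltW t0)).
  - by apply: cts_within; cts_all.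
  - move=> x /andP[x0 _]; have hw := der_wB P x0.
    by derive_all; rewrite /=; field; rewrite nat1r pnatr_eq0.
  - move=> x /andP[x0 xt]; rewrite pmulr_rle0 ?exprn_gt0 // subr_le0 Uk //.
    by rewrite (ltW x0) (le_trans (ltW xt)).
have V1 : V 1 + k * 1 ^+ 2 / (2 * n.+1%:R) <= V 0 + k * 0 ^+ 2 / (2 * n.+1%:R).
  apply: (@derive_le0_ge _ (fun t => V t + k * t ^+ 2 / (2 * n.+1%:R))
    (fun t => B t + k * t / n.+1%:R) 0 1 ler01).
  - by apply: cts_within; cts_all.
  - move=> x /andP[x0 _]; have hw := prV P x0.
    by derive_all; rewrite /=; field; rewrite nat1r pnatr_eq0.
  - move=> x /andP[x0 x1]; rewrite -[X in _ + X]opprK subr_le0; apply: Bk.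
    by rewrite (ltW x0) (ltW x1).
move: V1; rewrite expr0n /= expr1n mulr1 mulr0 mul0r addr0 (profile_V0 P).
have V10 := V_ge0 ler01.
have k1 : 1 - b / (2 * n.+1%:R) <= k by exact: expR_ge1Dx.
set N2 := 2 * n.+1%:R in k1 *.
have N20 : 1 <= N2 by rewrite /N2 -natrM ler1n.
move=> h.
have h1 : k / N2 <= b by lra.
have h2 : k <= b * N2 by rewrite -ler_pdivrMr // ; lra.
have h3 : b / N2 <= b by rewrite ler_pdivrMr ?ler_peMr //; lra.
rewrite invf_ple ?posrE; last 2 first.
- lra.
- rewrite lt_def b0 andbT; apply/eqP => bE; move: k1 h2; rewrite bE; lra.
have bp : 0 < b by rewrite lt_def b0 andbT; apply/eqP => bE; move: k1 h2; rewrite bE; lra.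
rewrite invf_ple ?posrE //; last lra.
rewrite invf_ple ?posrE //; last by lra.
rewrite -[b^-1]mul1r ler_pdivrMr //; lra.
Qed.

End profile_theory_bounds.

(** * Comparison and continuous dependence *)

Section comparison.
Context {R : realType} (n : nat) (b1 b2 : R) (U1 A1 V1 B1 U2 A2 V2 B2 : R -> R).
Hypothesis n0 : (0 < n)%N.
Hypothesis P1 : profile n b1 U1 A1 V1 B1.
Hypothesis P2 : profile n b2 U2 A2 V2 B2.
Let cU1 := cU P1.
Let cA1 := cA P1.
Let cV1 := cV P1.
Let cB1 := cB P1.
Let cU2 := cU P2.
Let cA2 := cA P2.
Let cV2 := cV P2.
Let cB2 := cB P2.

(** The ordering V1 <= V2 feeds itself through the system: it gives A2 <= A1, then U2 <= U1, then B1
    <= B2 because the exponential increases, so [V2 - V1] cannot fall below its initial value. *)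
Lemma compare_step c : 0 <= c -> (forall t, 0 < t < c -> V1 t <= V2 t) ->
  U2 c <= U1 c /\ b2 - b1 <= V2 c - V1 c.
Proof.
have wt (f1 f2 g1 g2 : R -> R) s : 0 <= s -> continuous f1 -> continuous f2 ->
    f1 0 = 0 -> f2 0 = 0 ->
    (forall t, 0 < t -> has_deriv (fun t => t ^+ n * f1 t) t (t ^+ n * g1 t)) ->
    (forall t, 0 < t -> has_deriv (fun t => t ^+ n * f2 t) t (t ^+ n * g2 t)) ->
    (forall t, 0 < t < s -> g2 t <= g1 t) -> f2 s <= f1 s.
  move=> s0 cf1 cf2 f10 f20 df1 df2 gle.
  move: s0; rewrite le_eqVlt => /predU1P[<-|s0]; first by rewrite f10 f20.
  rewrite -subr_ge0 -(pmulr_rge0 _ (exprn_gt0 n s0)) mulrBr.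
  have {1}-> : 0 = 0 ^+ n * f1 0 - 0 ^+ n * f2 0 by rewrite f10 f20 subrr.
  apply: (@derive_ge0_le _ (fun t => t ^+ n * f1 t - t ^+ n * f2 t)
    (fun t => t ^+ n * g1 t - t ^+ n * g2 t) 0 s (ltW s0)).
  - by apply: cts_within; cts_all.
  - move=> x /andP[x0 _]; have h1 := df1 _ x0; have h2 := df2 _ x0.
    by derive_all.
  - move=> x /andP[x0 xs]; rewrite -mulrBr mulr_ge0 ?exprn_ge0 ?(ltW x0) //.
    by rewrite subr_ge0 gle // x0.
move=> c0 V12.
have A12 t : 0 <= t <= c -> A2 t <= A1 t.
  move=> /andP[t0 tc]; apply: (@wt A1 A2 (fun t => - V1 t) (fun t => - V2 t)) => //.
  - exact: (profile_A0 P1).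
  - exact: (profile_A0 P2).
  - exact: (der_wA P1).
  - exact: (der_wA P2).
  - by move=> x /andP[x0 xt]; rewrite lerN2 V12 // x0 (lt_le_trans xt).
have U12 t : 0 <= t <= c -> U2 t <= U1 t.
  move=> /andP[t0 tc]; rewrite -subr_ge0.
  have {1}-> : 0 = U1 0 - U2 0 by rewrite (profile_U0 P1) (profile_U0 P2) subrr.
  apply: (@derive_ge0_le _ (fun t => U1 t - U2 t) (fun t => A1 t - A2 t) 0 t t0).
  - by apply: cts_within; cts_all.
  - move=> x /andP[x0 _]; have h1 := prU P1 x0; have h2 := prU P2 x0.
    by derive_all.
  - by move=> x /andP[x0 xs]; rewrite subr_ge0 A12 // (ltW x0) (le_trans (ltW xs)).
have B12 t : 0 <= t <= c -> B1 t <= B2 t.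
  move=> /andP[t0 tc].
  apply: (@wt B2 B1 (fun t => - expR (U2 t)) (fun t => - expR (U1 t))) => //.
  - exact: (profile_B0 P2).
  - exact: (profile_B0 P1).
  - exact: (der_wB P2).
  - exact: (der_wB P1).
  - move=> x /andP[x0 xt]; rewrite lerN2 ler_expR U12 // (ltW x0).
    by rewrite (le_trans (ltW xt)).
split; first by rewrite U12 // c0 lexx.
rewrite -(profile_V0 P1) -(profile_V0 P2).
apply: (@derive_ge0_le _ (fun t => V2 t - V1 t) (fun t => B2 t - B1 t) 0 c c0).
- by apply: cts_within; cts_all.
- move=> x /andP[x0 _]; have h1 := prV P1 x0; have h2 := prV P2 x0.
  by derive_all.
- by move=> x /andP[x0 xs]; rewrite subr_ge0 B12 // (ltW x0) (ltW xs).
Qed.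

Lemma compare r : b1 < b2 -> 0 <= r -> U2 r <= U1 r /\ b2 - b1 <= V2 r - V1 r.
Proof.
(* At [inf Z], the first place where the ordering could fail, [compare_step] still yields a gap of
   b2 - b1 > 0, and continuity carries it past [inf Z]. *)
move=> b12 r0; pose Z := [set t : R | 0 <= t /\ V2 t - V1 t <= 0].
have [Z0|/set0P[z Zz]] := eqVneq Z set0.
  apply: compare_step => // t /andP[t0 _]; rewrite leNgt; apply/negP => h.
  have : Z t by split; [exact: ltW|rewrite subr_le0 ltW].
  by rewrite Z0.
have hZ : has_inf Z by split; [exists z|exists 0 => t []].
exfalso.
have c0 : 0 <= inf Z by apply: lb_le_inf; [exists z|move=> t []].
have /(compare_step c0)[_ hc] : forall t, 0 < t < inf Z -> V1 t <= V2 t.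
  move=> t /andP[t0 tc]; rewrite leNgt; apply/negP => h.
  have : inf Z <= t.
    by apply: ge_inf; [exists 0 => ? []|split; [exact: ltW|rewrite subr_le0 ltW]].
  by rewrite leNgt tc.
have cF : continuous (fun t => V2 t - V1 t) by cts_all.
have Fp : 0 < V2 (inf Z) - V1 (inf Z) by apply: lt_le_trans hc; rewrite subr_gt0.
have /nbhs_ballP[e /= e0 He] : \forall t \near inf Z, 0 < V2 t - V1 t.
  exact: (@cvgr_gt _ _ _ _ (fun t => V2 t - V1 t) _ (cF (inf Z)) _ Fp).
have : inf Z + e <= inf Z.
  apply: lb_le_inf; first by exists z.
  move=> t [t0 Ft]; rewrite leNgt; apply/negP => te.
  have tZ : inf Z <= t by apply: ge_inf; [exists 0 => ? []|].
  have : 0 < V2 t - V1 t.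
    by apply: He; rewrite /ball /= ler0_norm ?subr_le0 // opprB ltrBlDl.
  by rewrite ltNge Ft.
by rewrite gerDl leNgt e0.
Qed.

(** Profiles are nonpositive by [U_le0], and there the exponential has slope at most 1: the
    nonlinearity is Lipschitz in the energy estimate below. *)
Lemma expR_lip (x y : R) : x <= 0 -> y <= 0 -> (expR x - expR y) ^+ 2 <= (x - y) ^+ 2.
Proof.
wlog xy : x y / x <= y.
  move=> h x0 y0; case: (leP x y) => [|/ltW] xy; first exact: h.
  by rewrite -[leLHS]sqrrN -[leRHS]sqrrN !opprB h.
move=> x0 y0; rewrite -[leLHS]sqrrN -[leRHS]sqrrN !opprB.
rewrite lerXn2r ?nnegrE ?subr_ge0 ?ler_expR //.
have -> : expR x = expR y * expR (x - y) by rewrite -expRD addrC subrK.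
have h1 : expR y <= 1 by rewrite -expR0 ler_expR.
have h2 := expR_ge1Dx (x - y).
rewrite -[X in X - _]mulr1 -mulrBr.
have h3 : 1 - expR (x - y) <= y - x by lra.
apply: le_trans h3; rewrite ler_piMl // subr_ge0 -expR0 ler_expR subr_le0 //.
Qed.

(** Gronwall for the squared distance of (U, A, V, B): the singular terms in n / t have the good
    sign, and the rest is at most twice the energy. For equal [b] this is uniqueness, for close ones
    convergence. *)
Lemma continuous_dependence r : 0 <= r ->
  (U1 r - U2 r) ^+ 2 <= (b1 - b2) ^+ 2 * expR (2 * r).
Proof.
move=> r0.
pose E t := (U1 t - U2 t) ^+ 2 + (A1 t - A2 t) ^+ 2 + (V1 t - V2 t) ^+ 2 + (B1 t - B2 t) ^+ 2.
pose dE t := 2 * (U1 t - U2 t) * (A1 t - A2 t)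
  + 2 * (A1 t - A2 t) * (- (V1 t - V2 t) - n%:R / t * (A1 t - A2 t))
  + 2 * (V1 t - V2 t) * (B1 t - B2 t)
  + 2 * (B1 t - B2 t) * (- (expR (U1 t) - expR (U2 t)) - n%:R / t * (B1 t - B2 t)).
have : E r * expR (- (2 * r)) <= E 0 * expR (- (2 * 0)).
  apply: (@derive_le0_ge _ (fun t => E t * expR (- (2 * t)))
     (fun t => (dE t - 2 * E t) * expR (- (2 * t))) 0 r r0).
  - by apply: cts_within; rewrite /E; cts_all.
  - move=> x /andP[x0 _].
    have h1 := prU P1 x0; have h2 := prU P2 x0.
    have h3 := prA P1 x0; have h4 := prA P2 x0.
    have h5 := prV P1 x0; have h6 := prV P2 x0.
    have h7 := prB P1 x0; have h8 := prB P2 x0.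
    rewrite /E /dE; derive_all; rewrite /=; field; exact: lt0r_neq0.
  - move=> x /andP[x0 _]; rewrite pmulr_lle0 ?expR_gt0 // subr_le0.
    have h1 := expR_lip (U_le0 n0 P1 (ltW x0)) (U_le0 n0 P2 (ltW x0)).
    have nx : 0 <= n%:R / x by rewrite divr_ge0 // ltW.
    rewrite /dE /E.
    move: (U1 x - U2 x) (A1 x - A2 x) (V1 x - V2 x) (B1 x - B2 x) h1 => D a F q.
    move: (expR (U1 x) - expR (U2 x)) (n%:R / x) nx => g k k0 gD.
    have ka : 0 <= k * a ^+ 2 by rewrite mulr_ge0 // sqr_ge0.
    have kq : 0 <= k * q ^+ 2 by rewrite mulr_ge0 // sqr_ge0.
    have s1 := sqr_ge0 (D - a); have s2 := sqr_ge0 (a + F).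
    have s3 := sqr_ge0 (F - q); have s4 := sqr_ge0 (q + g).
    nra.
rewrite mulr0 oppr0 expR0 mulr1 {2}/E (profile_U0 P1) (profile_U0 P2) (profile_A0 P1) (profile_A0 P2) (profile_B0 P1) (profile_B0 P2).
rewrite (profile_V0 P1) (profile_V0 P2) !subrr expr0n /= !addr0 add0r => h.
rewrite -[leLHS]mulr1 -[X in _ * X]expR0 -(subrr (- (2 * r))) expRD opprK mulrA.
rewrite ler_pM2r ?expR_gt0 //; apply: le_trans h; rewrite ler_pM2r ?expR_gt0 //.
by rewrite /E -!addrA lerDl !addr_ge0 ?sqr_ge0.
Qed.

End comparison.

(** * A profile with vanishing [V] against a logarithmic bound on its mass *)

Section slow_decay.
Context {R : realType} (m : nat) (b : R) (U A V B : R -> R).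
Hypothesis P : profile m.+4 b U A V B.
Let cU := cU P.
Let cA := cA P.
Let cV := cV P.
Let cB := cB P.

(* Primitive of r^3 e^U, obtained by integrating the equation three times in ln r. *)
Definition mass (r : R) : R := - (r ^+ 3 * B r)
  - m.+1%:R * (r ^+ 2 * V r + 2 * r * A r + 2 * m.+3%:R * U r).

Lemma continuous_mass : continuous mass.
Proof. by rewrite /mass; cts_all. Qed.

Lemma der_mass r : 0 < r -> has_deriv mass r (r ^+ 3 * expR (U r)).
Proof.
move=> r0; have h1 := prU P r0; have h2 := prA P r0.
have h3 := prV P r0; have h4 := prB P r0.
rewrite /mass; derive_all; rewrite /=; field; exact: lt0r_neq0.
Qed.

Lemma slow_decay_absurd (r0 H C : R) : 0 < r0 -> 0 <= H -> 0 <= C ->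
  H < 8 * m.+3%:R * m.+1%:R ->
  (forall e, 0 < e -> exists2 r, 0 <= r & V r < e) ->
  (forall r s, r0 <= r -> r <= s -> mass s - mass r <= H * (ln s - ln r) + C) -> False.
Proof.
move=> r00 H0 C0 Hlt Vinf massle.
(* Two identities make [w] useful: w' = - t e^U, and (t^(m+3) V)' = t^(m+2) w. As t B <= 0 and [V]
   becomes small, [w r] is at most the integral of t e^U beyond r. *)
pose w t := t * B t + m.+3%:R * V t.
have n0 : (0 < m.+4)%N by [].
have Vge := V_ge0 n0 P.
have b0 : 0 <= b by rewrite -(profile_V0 P) Vge.
have wle r : r0 <= r -> w r <= (2 * H + C) / r ^+ 2.
  move=> r0r; have rp : 0 < r by exact: lt_le_trans r0r.
  apply/ler_addgt0Pr => e e0.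
  have [|s s0 Vs] := Vinf (e / m.+3%:R); first by rewrite divr_gt0.
  pose S := Num.max s r.
  have rS : r <= S by rewrite /S le_max lexx orbT.
  have Sp : 0 < S by exact: lt_le_trans rS.
  (* The crude ln z <= z suffices: only the order r^-2 of the bound on [w] matters, not its
     constant. *)
  have massleH t : r <= t -> mass t - mass r <= H * (t / r) + C.
    move=> rt; have tp : 0 < t by exact: lt_le_trans rt.
    apply: (le_trans (massle _ _ r0r rt)).
    rewrite lerD2r; apply: ler_wpM2l => //; rewrite -ln_div ?posrE //.
    have tr : 0 < t / r by rewrite divr_gt0.
    by have := ln_sublinear tr; move/ltW.
  (* The integral of t e^U = mass' / t^2 is integrated by parts, and the resulting 2 (mass t - mass
     r) / t^3 is replaced by its bound from [massleH]. *)
  have : w r + (mass r - mass r) / r ^+ 2 - 2 * H / (r * r) - C / r ^+ 2 <=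
         w S + (mass S - mass r) / S ^+ 2 - 2 * H / (r * S) - C / S ^+ 2.
    apply: (@derive_ge0_le _ (fun t => w t + (mass t - mass r) / t ^+ 2 - 2 * H / (r * t) - C / t ^+ 2)
      (fun t => 2 / t ^+ 3 * (H * (t / r) + C - (mass t - mass r))) r S rS).
    - apply: derivable_within_continuous => x; rewrite in_itv /= => /andP[rx _].
      have x0 : 0 < x by exact: lt_le_trans rx.
      suff [d hd] : exists d, has_deriv (fun t => w t + (mass t - mass r) / t ^+ 2
          - 2 * H / (r * t) - C / t ^+ 2) x d by case: hd.
      have h1 := prV P x0; have h2 := prB P x0; have h3 := der_mass x0.
      eexists; rewrite /w; derive_all; last reflexivity.
      + by rewrite expf_neq0 // lt0r_neq0.
      + by rewrite mulf_neq0 // lt0r_neq0.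
      + by rewrite expf_neq0 // lt0r_neq0.
    - move=> x /andP[rx _]; have x0 : 0 < x by exact: lt_trans rx.
      have h1 := prV P x0; have h2 := prB P x0; have h3 := der_mass x0.
      rewrite /w; derive_all.
      + by rewrite expf_neq0 // lt0r_neq0.
      + by rewrite mulf_neq0 // lt0r_neq0.
      + by rewrite expf_neq0 // lt0r_neq0.
      + by rewrite /=; field; rewrite !lt0r_neq0.
    - move=> x /andP[rx _]; have x0 : 0 < x by exact: lt_trans rx.
      rewrite mulr_ge0 ?divr_ge0 ?exprn_ge0 ?(ltW x0) //.
      by rewrite subr_ge0 massleH // ltW.
  rewrite subrr mul0r addr0 => h.
  have h1 : (mass S - mass r) / S ^+ 2 <= H / (r * S) + C / S ^+ 2.
    rewrite ler_pdivrMr ?exprn_gt0 //; apply: (le_trans (massleH _ rS)).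
    rewrite le_eqVlt; apply/orP; left; apply/eqP; field.
    by rewrite !lt0r_neq0.
  have h2 : w S <= m.+3%:R * V S.
    by rewrite /w gerDr mulr_ge0_le0 ?(ltW Sp) // (B_le0 P) // ltW.
  have h3 : m.+3%:R * V S <= e.
    rewrite mulrC -ler_pdivlMr //; apply: le_trans (ltW Vs).
    by apply: (V_noninc P); rewrite // /S le_max lexx.
  have h4 : 0 <= H / (r * S) by rewrite divr_ge0 // mulr_ge0 // ltW.
  have h5 : (2 * H + C) / r ^+ 2 = 2 * H / (r * r) + C / r ^+ 2.
    by field; rewrite lt0r_neq0.
  rewrite -[X in - X]opprK in h.
  have h6 : 2 * H / (r * S) = 2 * (H / (r * S)) by rewrite mulrA.
  rewrite h6 in h; lra.
pose C1 := 2 * H + C.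
have C10 : 0 <= C1 by rewrite /C1; lra.
pose C2 := r0 ^+ 2 * b + C1.
(* Integrating (t^(m+3) V)' = t^(m+2) w <= C1 t^m turns the bound on [w] into one on r^2 V. *)
have VC2 r : r0 <= r -> r ^+ 2 * V r <= C2.
  move=> r0r; have rp : 0 < r by exact: lt_le_trans r0r.
  have : r ^+ m.+3 * V r - C1 * r ^+ m.+1 / m.+1%:R <=
         r0 ^+ m.+3 * V r0 - C1 * r0 ^+ m.+1 / m.+1%:R.
    apply: (@derive_le0_ge _ (fun r => r ^+ m.+3 * V r - C1 * r ^+ m.+1 / m.+1%:R)
     (fun r => r ^+ m.+2 * (w r - C1 / r ^+ 2)) r0 r r0r).
    - by apply: cts_within; cts_all.
    - move=> x /andP[rx _]; have x0 : 0 < x by exact: lt_trans rx.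
      have h1 := prV P x0; rewrite /w.
      derive_all; rewrite -[m.+3.-1]/(m.+2) -[m.+1.-1]/m !exprS; field.
      by rewrite nat1r pnatr_eq0 /= lt0r_neq0.
    - move=> x /andP[rx _]; have x0 : 0 < x by exact: lt_trans rx.
      by rewrite pmulr_rle0 ?exprn_gt0 // subr_le0 wle // ltW.
  have h0 : 0 <= C1 * r0 ^+ m.+1 / m.+1%:R.
    by rewrite divr_ge0 // mulr_ge0 // exprn_ge0 // ltW.
  have h1 : C1 * r ^+ m.+1 / m.+1%:R <= C1 * r ^+ m.+1.
    by rewrite ler_pdivrMr // ler_peMr ?ler1n // mulr_ge0 // exprn_ge0 // ltW.
  have h2 : r0 ^+ m.+3 * V r0 <= r ^+ m.+1 * (r0 ^+ 2 * b).
    rewrite -[m.+3]addn2 addnC exprD -addn1 addn1 mulrAC [leRHS]mulrC.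
    apply: ler_pM.
    - by rewrite mulr_ge0 ?exprn_ge0 ?Vge // ltW.
    - by rewrite exprn_ge0 // ltW.
    - apply: ler_wpM2l; first by rewrite exprn_ge0 // ltW.
      by apply: (V_le P); exact: ltW.
    - by rewrite lerXn2r // nnegrE ltW.
  move=> h3; rewrite -(ler_pM2l (exprn_gt0 m.+1 rp)) mulrA -exprD addn2.
  rewrite /C2 mulrDr [X in _ <= _ + X]mulrC.
  have lin (x y z t u v : R) : x - y <= z - t -> 0 <= t -> y <= u -> z <= v -> x <= v + u.
    by lra.
  exact: (lin _ _ _ _ _ _ h3 h0 h1 h2).
pose k : R := 2 * m.+3%:R * m.+1%:R.
have k0 : 0 < k by rewrite /k !mulr_gt0.
pose C3 := m.+1%:R * C2.
(* [mass] is solved for [U]: the terms in [B] and [A] have the favourable sign and are dropped, the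
   one in [V] is bounded by [VC2]. *)
have Uge r : r0 <= r -> - (mass r / k) - C3 / k <= U r.
  move=> r0r; have rp : 0 < r by exact: lt_le_trans r0r.
  rewrite -opprD -mulrDl lerNl ler_pdivlMr //.
  have h1 : r ^+ 3 * B r <= 0.
    by rewrite pmulr_rle0 ?exprn_gt0 // (B_le0 P) // ltW.
  have h2 : r * A r <= 0.
    by rewrite pmulr_rle0 // (A_le0 n0 P) // ltW.
  have h3 := VC2 _ r0r.
  have m0 : 0 <= m.+1%:R :> R by [].
  have h4 : m.+1%:R * (r ^+ 2 * V r) <= C3 by apply: ler_wpM2l.
  have h5 : m.+1%:R * (2 * (r * A r)) <= 0.
    by apply: mulr_ge0_le0 => //; apply: mulr_ge0_le0.
  have -> : - U r * k = mass r + r ^+ 3 * B r + m.+1%:R * (r ^+ 2 * V r)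
    + m.+1%:R * (2 * (r * A r)) by rewrite /mass /k; ring.
  lra.
(* Chosen so that c r^4 has the derivative r^3 e^(- C3 / k) / k, a lower bound for that of e^(mass /
   k) by [Uge]. *)
pose c := expR (- (C3 / k)) / (4 * k).
have c0 : 0 < c by rewrite divr_gt0 ?expR_gt0 // mulr_gt0.
have Qge r : r0 <= r -> c * (r ^+ 4 - r0 ^+ 4) <= expR (mass r / k).
  move=> r0r; have : expR (mass r0 / k) - c * r0 ^+ 4 <= expR (mass r / k) - c * r ^+ 4.
    apply: (@derive_ge0_le _ (fun r => expR (mass r / k) - c * r ^+ 4)
      (fun r => r ^+ 3 / k * (expR (mass r / k) * expR (U r) - expR (- (C3 / k)))) r0 r r0r).
    - apply: cts_within; have cm := continuous_mass; cts_all.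
    - move=> x /andP[rx _]; have x0 : 0 < x by exact: lt_trans rx.
      have h1 := der_mass x0.
      derive_all; rewrite /c /=; field; exact: lt0r_neq0.
    - move=> x /andP[rx _]; have x0 : 0 < x by exact: lt_trans rx.
      rewrite mulr_ge0 ?divr_ge0 ?exprn_ge0 ?(ltW k0) ?(ltW x0) //.
      rewrite subr_ge0 -expRD ler_expR.
      by have := Uge _ (ltW rx); lra.
  have := expR_gt0 (mass r0 / k); lra.
pose th := H / k.
have th4 : th < 4 by rewrite /th ltr_pdivrMr // /k; lra.
have th0 : 0 <= th by rewrite divr_ge0 // ltW.
pose C4 := (mass r0 - H * ln r0 + C) / k.
have Qle r : r0 <= r -> expR (mass r / k) <= expR (C4 + th * ln r).
  move=> r0r; rewrite ler_expR /C4 /th mulrAC -mulrDl ler_pM2r ?invr_gt0 //.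
  by have := massle _ _ (lexx r0) r0r; lra.
(* With r = e^L, the lower bound of order r^4 and the upper one of order r^th are divided by r^th;
   e^x >= 1 + x leaves a linear function of L that would have to stay bounded. *)
have key L : 0 <= L -> ln r0 <= L -> c * ((4 - th) * L - r0 ^+ 4) <= expR C4.
  move=> L0 rL; have r0L : r0 <= expR L by rewrite -[leLHS]lnK ?posrE // ler_expR.
  have := le_trans (Qge _ r0L) (Qle _ r0L); rewrite expRK expRD -expRM_natl.
  rewrite -ler_pdivrMr ?expR_gt0 // -expRN -mulrA; apply: le_trans.
  apply: ler_wpM2l; first exact: ltW.
  rewrite [leRHS]mulrBl -expRD -[- (th * L)]mulNr -mulrDl.
  have h1 := expR_ge1Dx ((4 - th) * L).
  have h2 : expR (- th * L) <= 1.
    by rewrite -expR0 ler_expR mulNr oppr_le0 mulr_ge0.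
  have h3 : r0 ^+ 4 * expR (- th * L) <= r0 ^+ 4.
    by apply: ler_piMr => //; rewrite exprn_ge0 // ltW.
  by rewrite -[4%:R]/(4 : R); lra.
have th40 : 0 < 4 - th by rewrite subr_gt0.
pose X := expR C4 / c + 1 + r0 ^+ 4.
pose L := `|ln r0| + `|X| / (4 - th).
have L0 : 0 <= L by rewrite addr_ge0 // divr_ge0 // ltW.
have Lr : ln r0 <= L.
  by apply: (le_trans (ler_norm _)); rewrite lerDl divr_ge0 // ltW.
have := key L L0 Lr; apply/negP; rewrite -ltNge.
rewrite -ltr_pdivrMl // mulrC.
suff : X <= (4 - th) * L by rewrite /X; lra.
rewrite /L mulrDr [X in _ <= _ + X]mulrC divfK ?lt0r_neq0 //.
apply: (le_trans (ler_norm _)); rewrite lerDr mulr_ge0 //; exact: ltW.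
Qed.

End slow_decay.

(** * Partial derivatives and radial functions *)

Section partial_derivatives.
Context {R : realType} {N : nat}.
Local Notation E := 'rV[R]_N.
Local Notation e_ i := (delta_mx ord0 i : E).
Implicit Types (f g : E -> R) (x : E).

(** Restriction to a coordinate line reduces partial derivatives to [has_deriv], so the one-variable
    rules carry over. *)
Definition has_partial f (i : 'I_N) x (d : R) :=
  has_deriv (fun h : R => f (h *: e_ i + x)) 0 d.

Lemma has_partialP f i x d :
  has_partial f i x d <-> derivable f x (e_ i) /\ partial i f x = d.
Proof.
have dE : 'D_(1 : R) (fun h : R => f (h *: e_ i + x)) 0 = partial i f x.
  rewrite /partial /derive.
  set F1 := (fun h => _); set F2 := (fun h => _).
  suff -> : F1 = F2 by [].
  by apply/funext => h; rewrite /F1 /F2 /= addr0 scale0r add0r [_%:A]mulr1.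
rewrite -dE; split=> -[h1 h2]; split => //.
  exact: (derivable1P f x (e_ i)).2 h1.
exact: (derivable1P f x (e_ i)).1 h1.
Qed.

Lemma has_partial_line f i x t d : has_partial f i (t *: e_ i + x) d ->
  has_deriv (fun t => f (t *: e_ i + x)) t d.
Proof.
move=> h; have h1 : has_deriv (fun s => s - t) t 1 by derive_all; rewrite addr0.
have h2 : has_deriv (fun s => f (s *: e_ i + (t *: e_ i + x))) (t - t) d.
  by rewrite subrr.
have := der_comp h1 h2; rewrite mulr1.
rewrite (_ : (fun s => f ((s - t) *: _ + _)) = (fun s => f (s *: e_ i + x))) //.
by apply/funext => s; rewrite addrA -scalerDl subrK.
Qed.

Lemma has_partial_partial k f i x : is_Ck k.+1 f -> has_partial f i x (partial i f x).
Proof. by move=> [_ /(_ i)[/(_ x) h _]]; apply/has_partialP. Qed.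

Lemma has_partial_eq f i x d d' : has_partial f i x d -> d = d' -> has_partial f i x d'.
Proof. by move=> ? <-. Qed.

Lemma has_partial_cst (c : R) i x : has_partial (fun=> c) i x 0.
Proof. exact: der_cst. Qed.

Lemma has_partialD f g i x a b : has_partial f i x a -> has_partial g i x b ->
  has_partial (fun y => f y + g y) i x (a + b).
Proof. exact: derD. Qed.

Lemma has_partialM f g i x a b : has_partial f i x a -> has_partial g i x b ->
  has_partial (fun y => f y * g y) i x (a * g x + f x * b).
Proof. by move=> hf hg; have := derM hf hg; rewrite scale0r add0r. Qed.

Lemma has_partialV f i x a : f x != 0 -> has_partial f i x a ->
  has_partial (fun y => (f y)^-1) i x (- (f x) ^- 2 * a).
Proof.
by move=> fx hf; have := der_inv _ hf; rewrite scale0r add0r; apply.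
Qed.

Lemma has_partial_comp (h : R -> R) f i x a b : has_partial f i x a -> has_deriv h (f x) b ->
  has_partial (fun y => h (f y)) i x (b * a).
Proof.
by move=> hf hh; apply: (der_comp hf); rewrite scale0r add0r.
Qed.

Lemma has_partial_coord (i j : 'I_N) x :
  has_partial (fun y => y ord0 j) i x (i == j)%:R.
Proof.
rewrite /has_partial (_ : (fun h => _) = fun h : R => h * (i == j)%:R + x ord0 j); last first.
  by apply/funext => h; rewrite !mxE eqxx eq_sym.
by derive_all; ring.
Qed.

Lemma has_partial_sum (I : Type) (r : seq I) (F : I -> E -> R) i x (D : I -> R) :
  (forall j, has_partial (F j) i x (D j)) ->
  has_partial (fun y => \sum_(j <- r) F j y) i x (\sum_(j <- r) D j).
Proof.
move=> h; elim: r => [|j r IHr].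
  rewrite big_nil (_ : (fun y => _) = fun=> 0); first exact: has_partial_cst.
  by apply/funext => y; rewrite big_nil.
rewrite big_cons (_ : (fun y => _) = fun y => F j y + \sum_(k <- r) F k y).
  exact: has_partialD.
by apply/funext => y; rewrite big_cons.
Qed.

Definition sqnorm x : R := \sum_(j < N) x ord0 j ^+ 2.

Lemma sqnorm_ge0 x : 0 <= sqnorm x.
Proof. by apply: sumr_ge0 => j _; exact: sqr_ge0. Qed.

Lemma has_partial_sqnorm i x : has_partial sqnorm i x (2 * x ord0 i).
Proof.
rewrite /sqnorm; apply: has_partial_eq.
  apply: (@has_partial_sum _ _ _ _ _ (fun j => 2 * x ord0 j * (i == j)%:R)) => j.
  apply: has_partial_eq; first exact: (has_partialM (has_partial_coord _ _ _)
    (has_partial_coord _ _ _)).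
  by rewrite /=; ring.
rewrite (bigD1 i) //= eqxx mulr1 big1 ?addr0 // => j ji.
by rewrite eq_sym (negPf ji) mulr0.
Qed.

Lemma CkW k f : is_Ck k.+1 f -> is_Ck k f.
Proof.
elim: k f => [f []//|k IHk f [cf hf]]; split => // i.
by have [h1 h2] := hf i; split => //; exact: IHk.
Qed.

Lemma Ck_continuous k f : is_Ck k f -> continuous f.
Proof. by case: k => [//|k []]. Qed.

Lemma CkS k f (g : 'I_N -> E -> R) : continuous f ->
  (forall i x, has_partial f i x (g i x)) -> (forall i, is_Ck k (g i)) -> is_Ck k.+1 f.
Proof.
move=> cf hg cg; split => // i; split => [x|].
  by have /has_partialP[] := hg i x.
rewrite (_ : partial i f = g i) //.
by apply/funext => x; have /has_partialP[] := hg i x.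
Qed.

Lemma Ck_cst k (c : R) : is_Ck k (fun _ : E => c).
Proof.
elim: k c => [|k IHk] c; first exact: cst_continuous.
apply: (@CkS _ _ (fun _ _ => 0)) => // [|i x]; first exact: cst_continuous.
exact: has_partial_cst.
Qed.

Lemma CkD k f g : is_Ck k f -> is_Ck k g -> is_Ck k (fun x => f x + g x).
Proof.
elim: k f g => [|k IHk] f g cf cg.
  exact: cts_add.
apply: (@CkS _ _ (fun i x => partial i f x + partial i g x)).
- exact: (cts_add (Ck_continuous cf) (Ck_continuous cg)).
- move=> i x; exact: (has_partialD (has_partial_partial i x cf) (has_partial_partial i x cg)).
- move=> i; apply: IHk; [exact: (cf.2 i).2|exact: (cg.2 i).2].
Qed.

Lemma CkM k f g : is_Ck k f -> is_Ck k g -> is_Ck k (fun x => f x * g x).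
Proof.
elim: k f g => [|k IHk] f g cf cg.
  exact: cts_mul.
apply: (@CkS _ _ (fun i x => partial i f x * g x + f x * partial i g x)).
- exact: (cts_mul (Ck_continuous cf) (Ck_continuous cg)).
- move=> i x; exact: (has_partialM (has_partial_partial i x cf) (has_partial_partial i x cg)).
- move=> i; apply: CkD; apply: IHk.
  + exact: (cf.2 i).2.
  + exact: CkW.
  + exact: CkW.
  + exact: (cg.2 i).2.
Qed.

Lemma CkZ k f (c : R) : is_Ck k f -> is_Ck k (fun x => c * f x).
Proof. by move=> cf; apply: CkM => //; exact: Ck_cst. Qed.

Lemma Ck_sum k (I : Type) (r : seq I) (F : I -> E -> R) :
  (forall j, is_Ck k (F j)) -> is_Ck k (fun y => \sum_(j <- r) F j y).
Proof.
move=> h; elim: r => [|j r IHr].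
  rewrite (_ : (fun y => _) = fun=> 0); first exact: Ck_cst.
  by apply/funext => y; rewrite big_nil.
rewrite (_ : (fun y => _) = fun y => F j y + \sum_(k <- r) F k y).
  exact: CkD.
by apply/funext => y; rewrite big_cons.
Qed.

Lemma Ck_coord k (j : 'I_N) : is_Ck k (fun x : E => x ord0 j).
Proof.
have c0 : continuous (fun x : E => x ord0 j) by exact: coord_continuous.
case: k => [//|k].
apply: (@CkS _ _ (fun i _ => (i == j)%:R)) => //.
- by move=> i x; exact: has_partial_coord.
- by move=> i; exact: Ck_cst.
Qed.

Lemma Ck_sqnorm k : is_Ck k sqnorm.
Proof. by apply: Ck_sum => j; apply: CkM; exact: Ck_coord. Qed.

Lemma Ck_inv k f : (forall x, f x != 0) -> is_Ck k f -> is_Ck k (fun x => (f x)^-1).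
Proof.
move=> f0; elim: k f f0 => [|k IHk] f f0 cf.
  exact: cts_inv.
have := cf; move=> /CkW cf'.
apply: (@CkS _ _ (fun i x => - 1 * ((f x)^-1 * (f x)^-1) * partial i f x)).
- exact: (cts_inv f0 (Ck_continuous cf)).
- move=> i x; apply: has_partial_eq.
    apply: has_partialV => //; exact: (has_partial_partial _ _ cf).
  by rewrite expr2 invfM mulN1r.
- move=> i; apply: CkM; last exact: (cf.2 i).2.
  by apply: CkZ; apply: CkM; exact: IHk.
Qed.

End partial_derivatives.

(** The derivative is existential, so that closure lemmas can supply formulas for it by induction on
    k. Cutoffs are built in this class and moved to R^n by [Ck_comp]. *)
Fixpoint C1k {R : realType} (k : nat) (f : R -> R) : Prop :=
  if k is k'.+1 then
    continuous f /\ exists2 g, (forall x, has_deriv f x (g x)) & C1k k' g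
  else continuous f.

Section C1k.
Context {R : realType}.
Implicit Types f g : R -> R.

Lemma C1kW k f : C1k k.+1 f -> C1k k f.
Proof.
elim: k f => [f []//|k IHk f [cf [g fg cg]]]; split => //.
by exists g => //; exact: IHk.
Qed.

Lemma C1kS k f g : (forall x, has_deriv f x (g x)) -> C1k k g -> C1k k.+1 f.
Proof.
move=> fg cg; split; last by exists g.
by move=> x; exact: der_continuous (fg x).
Qed.

Lemma C1k_cst k (c : R) : C1k k (fun=> c).
Proof.
elim: k c => [|k IHk] c; first exact: cts_cst.
by apply: C1kS (IHk 0) => x; exact: der_cst.
Qed.

Lemma C1k_id k : C1k k (fun x : R => x).
Proof.
case: k => [|k]; first exact: cts_id.
by apply: C1kS (C1k_cst k 1) => x; exact: der_id.
Qed.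

Lemma C1kD k f g : C1k k f -> C1k k g -> C1k k (fun x => f x + g x).
Proof.
elim: k f g => [|k IHk] f g; first exact: cts_add.
move=> [cf [f' ff' cf']] [cg [g' gg' cg']].
apply: C1kS (IHk _ _ cf' cg') => x; exact: derD.
Qed.

Lemma C1kM k f g : C1k k f -> C1k k g -> C1k k (fun x => f x * g x).
Proof.
elim: k f g => [|k IHk] f g; first exact: cts_mul.
move=> cf cg; have [_ [f' ff' cf']] := cf; have [_ [g' gg' cg']] := cg.
apply: (@C1kS _ _ (fun x => f' x * g x + f x * g' x)) => [x|]; first exact: derM.
by apply: C1kD; apply: IHk => //; exact: C1kW.
Qed.

Lemma C1kN k f : C1k k f -> C1k k (fun x => - f x).
Proof.
elim: k f => [|k IHk] f; first exact: cts_opp.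
move=> [cf [f' ff' cf']]; apply: C1kS (IHk _ cf') => x; exact: derN.
Qed.

Lemma C1k_comp k f g : C1k k f -> C1k k g -> C1k k (fun x => f (g x)).
Proof.
elim: k f g => [|k IHk] f g.
  by move=> cf cg x; apply: continuous_comp; [exact: cg|exact: cf].
move=> [cf [f' ff' cf']] cg; have [_ [g' gg' cg']] := cg.
apply: (@C1kS _ _ (fun x => f' (g x) * g' x)) => [x|]; first exact: der_comp.
by apply: C1kM => //; apply: IHk => //; exact: C1kW.
Qed.

Lemma C1k_expR k : C1k k (@expR R).
Proof.
elim: k => [|k IHk]; first exact: continuous_expR.
by apply: C1kS IHk => x; exact: is_derive_expR.
Qed.

Lemma C1k_inv k f : (forall x, f x != 0) -> C1k k f -> C1k k (fun x => (f x)^-1).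
Proof.
move=> f0; elim: k f f0 => [|k IHk] f f0.
  exact: cts_inv.
move=> cf; have [_ [f' ff' cf']] := cf.
apply: (@C1kS _ _ (fun x => (- 1 * ((f x)^-1 * (f x)^-1)) * f' x)) => [x|].
  apply: der_eq; first by apply: der_inv => //.
  by rewrite expr2 invfM mulN1r.
apply: C1kM => //; apply: C1kM; first exact: C1k_cst.
by apply: C1kM; apply: IHk => //; exact: C1kW.
Qed.

Lemma C1k_ln k f : (forall x, 0 < f x) -> C1k k f -> C1k k (fun x => ln (f x)).
Proof.
move=> f0; case: k => [|k] cf.
  by move=> x; apply: continuous_comp; [exact: cf|exact: continuous_ln].
have [_ [f' ff' cf']] := cf.
apply: (@C1kS _ _ (fun x => (f x)^-1 * f' x)) => [x|].
  exact: der_ln.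
apply: C1kM => //; apply: C1k_inv; last exact: C1kW.
by move=> x; rewrite gt_eqF.
Qed.

Lemma Ck_comp N k f (g : 'rV[R]_N -> R) : C1k k f -> is_Ck k g ->
  is_Ck k (fun x => f (g x)).
Proof.
elim: k f g => [|k IHk] f g.
  by move=> cf cg x; apply: continuous_comp; [exact: cg|exact: cf].
move=> [cf [f' ff' cf']] cg.
apply: (@CkS _ _ _ _ (fun i x => f' (g x) * partial i g x)).
- by move=> x; apply: continuous_comp; [exact: (Ck_continuous cg)|exact: cf].
- move=> i x; apply: has_partial_comp => //; exact: (has_partial_partial _ _ cg).
- move=> i; apply: CkM; last exact: (cg.2 i).2.
  by apply: IHk => //; exact: CkW.
Qed.

End C1k.

(** * Radial functions and their profiles *)

Section radial_functions.
Context {R : realType} {n : nat}.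
Local Notation E := 'rV[R]_n.+1.
Local Notation e0 := (delta_mx ord0 ord0 : E).
Implicit Types (u : E -> R) (x : E).

Lemma euclid_norm_sqr x : euclid_norm x ^+ 2 = sqnorm x.
Proof. by rewrite sqr_sqrtr // sqnorm_ge0. Qed.

Lemma euclid_norm_ge0 x : 0 <= euclid_norm x.
Proof. exact: sqrtr_ge0. Qed.

Lemma sqnorm_axis (r : R) i : sqnorm (r *: (delta_mx ord0 i : E)) = r ^+ 2.
Proof.
rewrite /sqnorm (bigD1 i) //= !mxE !eqxx mulr1 big1 ?addr0 // => j ji.
by rewrite !mxE (negPf ji) andbF mulr0 expr0n.
Qed.

Lemma euclid_norm_axis (r : R) i : euclid_norm (r *: (delta_mx ord0 i : E)) = `|r|.
Proof. by rewrite -[LHS]/(Num.sqrt (sqnorm _)) sqnorm_axis sqrtr_sqr. Qed.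

Lemma euclid_norm_eq0 x : (euclid_norm x == 0) = (x == 0).
Proof.
apply/eqP/eqP => [h|->]; last first.
  by rewrite -(scale0r (delta_mx ord0 ord0)) euclid_norm_axis normr0.
have := euclid_norm_sqr x; rewrite h expr0n /= => /esym/psumr_eq0P s0.
apply/rowP => j; rewrite mxE; apply/eqP; rewrite -sqrf_eq0; apply/eqP.
by apply: s0 => // i _; exact: sqr_ge0.
Qed.

Lemma has_partial_norm i x : x != 0 ->
  has_partial euclid_norm i x (x ord0 i / euclid_norm x).
Proof.
move=> x0; have r0 : 0 < euclid_norm x.
  by rewrite lt_def euclid_norm_eq0 x0 euclid_norm_ge0.
have s0 : 0 < sqnorm x by rewrite -euclid_norm_sqr exprn_gt0.
apply: has_partial_eq.
  apply: (@has_partial_comp _ _ Num.sqrt sqnorm); first exact: has_partial_sqnorm.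
  exact: is_derive1_sqrt.
rewrite -[Num.sqrt _]/(euclid_norm x); field.
by rewrite lt0r_neq0.
Qed.

Variable u : E -> R.
Hypothesis ru : radial u.

Definition prof (r : R) : R := u (r *: e0).
Definition prof1 (r : R) : R := partial ord0 u (r *: e0).
Definition prof2 (r : R) : R := partial ord0 (partial ord0 u) (r *: e0).

Lemma profE x : u x = prof (euclid_norm x).
Proof. by apply: ru; rewrite euclid_norm_axis ger0_norm // euclid_norm_ge0. Qed.

Lemma prof_even r : prof (- r) = prof r.
Proof. by apply: ru; rewrite !euclid_norm_axis normrN. Qed.

Lemma continuous_axis : continuous (fun r : R => r *: e0).
Proof. exact: scalel_continuous. Qed.

Lemma continuous_prof : continuous u -> continuous prof.
Proof.
by move=> cu x; apply: continuous_comp; [exact: continuous_axis|exact: cu].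
Qed.

Lemma has_deriv_axis f k r : is_Ck k.+1 f ->
  has_deriv (fun r : R => f (r *: e0)) r (partial ord0 f (r *: e0)).
Proof.
move=> cf; have := @has_partial_line _ _ f ord0 0 r (partial ord0 f (r *: e0)).
rewrite addr0; under eq_fun do rewrite addr0; apply.
exact: (has_partial_partial _ _ cf).
Qed.

Hypothesis cu : is_Ck 2 u.

Lemma der_prof r : has_deriv prof r (prof1 r).
Proof. exact: (has_deriv_axis _ cu). Qed.

Lemma der_prof1 r : has_deriv prof1 r (prof2 r).
Proof. by have cu1 : is_Ck 1 (partial ord0 u) := (cu.2 ord0).2; exact: (has_deriv_axis r cu1). Qed.

Lemma continuous_prof1 : continuous prof1.
Proof.
move=> r; apply: continuous_comp; first exact: continuous_axis.
have cu1 : is_Ck 1 (partial ord0 u) := (cu.2 ord0).2; exact: (Ck_continuous cu1).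
Qed.

(** [prof] is even, so its derivative at 0 equals its own opposite. *)
Lemma prof1_0 : prof1 0 = 0.
Proof.
have h1 := der_prof 0.
have h2 : has_deriv prof 0 (- prof1 0).
  have h3 : has_deriv (fun t : R => - t) 0 (- 1) by exact: derN (der_id _).
  have h4 : has_deriv prof (- 0) (prof1 0) by rewrite oppr0.
  have := der_comp h3 h4; rewrite mulrN1.
  by under eq_fun do rewrite prof_even.
case: h1 => _; case: h2 => _ ->; lra.
Qed.

Lemma partial_radial i x : partial i u x = prof1 (euclid_norm x) * (x ord0 i / euclid_norm x).
Proof.
suff /has_partialP[] : has_partial u i x (prof1 (euclid_norm x) * (x ord0 i / euclid_norm x)) by [].
(* The formula survives at the origin: the right-hand side is 0 because x_i = 0, and the restriction
   of u to any axis is the even function [prof]. *)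
have [->|x0] := eqVneq x 0.
  rewrite mxE mul0r mulr0 /has_partial.
  have -> : (fun h : R => u (h *: delta_mx ord0 i + 0)) = prof.
    by apply/funext => h; rewrite addr0 profE euclid_norm_axis; case: (ger0P h) => // _; rewrite prof_even.
  by apply: der_eq; [exact: der_prof|exact: prof1_0].
rewrite (_ : u = fun y => prof (euclid_norm y)); last by apply/funext => y; exact: profE.
by apply: has_partial_comp; [exact: has_partial_norm|exact: der_prof].
Qed.

Lemma laplacian_radial x : x != 0 ->
  laplacian u x = prof2 (euclid_norm x) + n%:R / euclid_norm x * prof1 (euclid_norm x).
Proof.
move=> x0; have r0 : 0 < euclid_norm x.
  by rewrite lt_def euclid_norm_eq0 x0 euclid_norm_ge0.
set r := euclid_norm x in r0 *.
have h i : partial i (partial i u) x =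
    (prof2 r / r ^+ 2 - prof1 r / r ^+ 3) * x ord0 i ^+ 2 + prof1 r / r.
  rewrite (_ : partial i u = fun y => prof1 (euclid_norm y) * (y ord0 i * (euclid_norm y)^-1));
    last by apply/funext => y; exact: partial_radial.
  have h1 := @has_partial_norm i x x0.
  have h2 := has_partial_comp h1 (der_prof1 (euclid_norm x)).
  have h3 := has_partialV (lt0r_neq0 r0) h1.
  have /has_partialP[_ ->] := has_partialM h2 (has_partialM (has_partial_coord i i x) h3).
  rewrite eqxx -/r -[true%:R]/(1 : R); field; exact: lt0r_neq0.
rewrite /laplacian; under eq_bigr do rewrite h.
rewrite big_split /= -mulr_sumr -/(sqnorm x) -euclid_norm_sqr -/r.
rewrite sumr_const card_ord -[_ *+ _]mulr_natr -natr1.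
field; exact: lt0r_neq0.
Qed.

(** The radial formula is available off the origin only, but the origin is the single point of its
    sphere. *)
Lemma radial_laplacian : radial (laplacian u).
Proof.
move=> x y xy; have [x0|x0] := eqVneq x 0.
  by have := euclid_norm_eq0 y; rewrite -xy euclid_norm_eq0 x0 eqxx => /esym/eqP ->.
have y0 : y != 0 by rewrite -euclid_norm_eq0 -xy euclid_norm_eq0.
by rewrite !laplacian_radial // xy.
Qed.

End radial_functions.

(** The equations for [A] and [B] are [laplacian_radial] for u and for its Laplacian; continuity at
    r = 0, where they are singular, comes from the regularity of u on the whole space. *)
Lemma solution_profile {R : realType} (n : nat) (u : 'rV[R]_n.+1 -> R) :
  solution u -> radial u -> u 0 = 0 ->
  exists U A V B : R -> R, profile n (- laplacian u 0) U A V B /\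
    forall x, u x = U (euclid_norm x).
Proof.
move=> [cu ueq] ru u0.
have cu2 : is_Ck 2 u by do 2 apply: CkW.
pose L := laplacian u.
have cL : is_Ck 2 L by apply: Ck_sum => i; exact: ((cu.2 i).2.2 i).2.
have rL : radial L by exact: radial_laplacian.
exists (prof u), (prof1 u), (fun r => - prof L r), (fun r => - prof1 L r).
split; last exact: profE.
have xr (r : R) : 0 < r -> (r *: (delta_mx ord0 ord0 : 'rV[R]_n.+1)) != 0.
  by move=> r0; rewrite -euclid_norm_eq0 euclid_norm_axis normr_eq0 lt0r_neq0.
have nr (r : R) : 0 < r -> euclid_norm (r *: (delta_mx ord0 ord0 : 'rV[R]_n.+1)) = r.
  by move=> r0; rewrite euclid_norm_axis gtr0_norm.
split.
- by move=> r r0; exact: der_prof.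
- move=> r r0; apply: der_eq; first exact: der_prof1.
  by rewrite opprK /prof /L laplacian_radial ?xr // nr // addrK.
- by move=> r r0; apply: derN; exact: der_prof.
- move=> r r0; apply: der_eq; first by apply: derN; exact: der_prof1.
  rewrite /prof -ueq -/L (laplacian_radial rL cL (xr _ r0)) nr //; ring.
- exact: continuous_prof (Ck_continuous cu).
- exact: continuous_prof1.
- apply: cts_opp; exact: continuous_prof (Ck_continuous cL).
- apply: cts_opp; exact: continuous_prof1.
- by rewrite /prof scale0r.
- exact: prof1_0.
- by rewrite /prof scale0r.
- by rewrite prof1_0 // oppr0.
Qed.

(** * Lebesgue measure on R^n *)

Section borel_rV.
Context {R : realType} {n : nat}.
Local Notation E := 'rV[R]_n.

Definition box (A : 'I_n -> set (measurableTypeR R)) : set E :=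
  [set x | forall i, A i (x ord0 i)].

Lemma measurable_box A : (forall i, measurable (A i)) -> measurable (box A).
Proof.
move=> mA; rewrite (_ : box A = \bigcap_(i in [set: 'I_n]) (coord_rV i @^-1` A i)).
  apply: (@fin_bigcap_measurable _ E 'I_n); first exact: finite_finset.
  move=> i _; rewrite -[X in measurable X]setTI.
  exact: (measurable_coord_rV i measurableT (mA _)).
by apply/seteqP; split => x /= xA i => [_|]; exact: xA.
Qed.

(** An open set is the union of the cubes with rational centre and half-width 1 / (k + 1) that it
    contains; these are countably many, indexed through [pickle]. *)
Lemma open_measurable_rV (U : set E) : open U -> measurable U.
Proof.
move=> oU.
pose B (p : 'rV[rat]_n * nat) : set E :=
  box (fun i => `](ratr (p.1 ord0 i) - p.2.+1%:R^-1), (ratr (p.1 ord0 i) + p.2.+1%:R^-1)[%classic).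
pose F (k : nat) : set E :=
  if unpickle k is Some p then (if `[< B p `<=` U >] then B p else set0) else set0.
rewrite (_ : U = \bigcup_k F k).
  apply: bigcupT_measurable => k; rewrite /F.
  case: unpickle => [p|]; last exact: measurable0.
  case: asboolP => _; last exact: measurable0.
  by apply: measurable_box => i; exact: measurable_itv.
apply/seteqP; split => [x Ux|x [k _]]; last first.
  by rewrite /F; case: unpickle => // p; case: asboolP => // pU; exact: pU.
have /nbhs_ballP[e /= e0 xeU] : nbhs x U by exact: open_nbhs_nbhs.
(* A cube of half-width below e / 2 that contains x lies in the ball of radius e around x. *)
have [k k0] : exists k, k.+1%:R^-1 < e / 2.
  exists (Num.truncn (2 / e)); rewrite invf_plt ?posrE ?divr_gt0 // invf_div.
  exact: truncnS_gt.
have k1 : 0 < k.+1%:R^-1 :> R by rewrite invr_gt0.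
have hq i : exists q : rat, x ord0 i - k.+1%:R^-1 < ratr q < x ord0 i + k.+1%:R^-1.
  have /rat_in_itvoo[q] : x ord0 i - k.+1%:R^-1 < x ord0 i + k.+1%:R^-1.
    by rewrite ltrD2l; apply: lt_trans k1; rewrite oppr_lt0.
  by rewrite in_itv /=; exists q.
pose q : 'rV[rat]_n := \row_i sval (cid (hq i)).
have Bx : B (q, k) x.
  move=> i /=; rewrite in_itv /= mxE; have /= := svalP (cid (hq i)).
  by rewrite ltrBlDr ltrBlDr andbC.
exists (pickle (q, k)) => //; rewrite /F pickleK; case: asboolP => //; case.
move=> y By; apply: xeU; split => // i j; rewrite (ord1 i) /ball /=.
have := Bx j; have := By j; rewrite /= !in_itv /= => /andP[h1 h2] /andP[h3 h4].
move: (k.+1%:R^-1) k0 h1 h2 h3 h4 => d *.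
by rewrite ltr_norml; apply/andP; split; lra.
Qed.

Lemma closed_measurable_rV (U : set E) : closed U -> measurable U.
Proof.
by move=> cU; rewrite -(setCK U); apply: measurableC; apply: open_measurable_rV; rewrite openC.
Qed.

Lemma continuous_measurable_rV (D : set E) (f : E -> R) : continuous f -> measurable_fun D f.
Proof.
move=> /continuousP cf; apply: measurable_funTS.
apply: (measurability _ (measurable_realfun.RGenOpens.measurableE R)).
move=> _ [_ [a [b ->] <-]]; rewrite setTI; apply: open_measurable_rV.
exact/cf/interval_open.
Qed.

(** Boxes form a pi-system that generates the sigma-algebra, and the cubes [-k, k]^n exhaust the
    space with finite measure. *)
Lemma lebesgue_rV_unique (m : {measure set E -> \bar R}) :
  (forall A, (forall i, measurable (A i)) ->
     m (box A) = (\prod_(i < n) @lebesgue_measure R (A i))%E) ->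
  forall X : set E, measurable X -> lebesgue_rV R n X = m X.
Proof.
move=> mbox X mX.
pose G : set (set E) := [set B | exists2 A, (forall i, measurable (A i)) & B = box A].
pose g (k : nat) : set E := box (fun=> `[- k%:R, k%:R]%classic).
apply: (measure_unique G g) => //.
- apply/seteqP; split.
    apply: smallest_sub; first exact: smallest_sigma_algebra.
    rewrite -bigcup_seq => B [i _ [A mA <-]]; apply: sub_sigma_algebra.
    exists (fun j => if j == i then A else setT).
      by move=> j; case: ifP => // _; exact: measurableT.
    rewrite setTI; apply/seteqP; split => x /=.
      by move=> Ax j; case: eqP => // ->.
    by move=> /(_ i); rewrite eqxx.
  apply: smallest_sub; first exact: (sigma_algebra_measurable E).
  by move=> B [A mA ->]; exact: measurable_box.
- move=> _ _ [A mA ->] [A' mA' ->]; exists (fun i => A i `&` A' i).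
    by move=> i; exact: measurableI.
  apply/seteqP; split => x /=; first by case=> h1 h2 i; split.
  by move=> h; split => i; have [] := h i.
- by move=> k; exists (fun=> `[- k%:R, k%:R]%classic) => // i; exact: measurable_itv.
- apply/seteqP; split => // x _.
  exists (Num.truncn (\sum_(i < n) `|x ord0 i|)).+1 => // i /=.
  rewrite in_itv /= -ler_norml; apply: le_trans (ltW (truncnS_gt _)).
  by rewrite (bigD1 i) //= lerDl sumr_ge0.
- by move=> _ [A mA ->]; rewrite mbox // lebesgue_rV_box.
- move=> k; rewrite lebesgue_rV_box; last by move=> i; exact: measurable_itv.
  under eq_bigr do rewrite lebesgue_measure_itv.
  rewrite -ge0_fin_numE; last by apply: prode_ge0 => j; case: ifP => // h; rewrite sube_ge0 //= lee_fin ltW.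
  by elim/big_ind: _ => // [x y|j _]; [exact: fin_numM|case: ifP].
Qed.

End borel_rV.

(** * Scaling and translation of Lebesgue measure *)

Section affine_maps.
Context {R : realType}.

Definition affine1 (a b : R) (s : measurableTypeR R) : measurableTypeR R := (a * s + b)%R.

Lemma measurable_affine1 a b : measurable_fun setT (affine1 a b).
Proof. by apply: (@continuous_measurable_fun R (fun s => a * s + b)%R); cts_all. Qed.

HB.instance Definition _ a b := isMeasurableFun.Build _ _ _ _ (affine1 a b)
  (@measurable_affine1 a b).

Lemma lebesgue_measure_affine (a b : R) (A : set (measurableTypeR R)) : 0 < a -> measurable A ->
  @lebesgue_measure R A = (a%:E * @lebesgue_measure R (affine1 a b @^-1` A))%E.
Proof.
move=> a0 mA.
pose k : {nonneg R} := NngNum (ltW a0).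
apply: (@lebesgue_measure_unique R (mscale k (pushforward (@lebesgue_measure R) (affine1 a b))))
  => // X [[c d] _ <-] /=.
rewrite /mscale /pushforward /=.
rewrite -[pushforward _ _ _]/(lebesgue_measure (affine1 a b @^-1` `]c, d])).
rewrite (_ : _ @^-1` _ = `](c - b) / a, (d - b) / a]%classic); last first.
  apply/seteqP; split => x; rewrite /affine1 /= !in_itv /= ltr_pdivrMr // ler_pdivlMr //.
    by rewrite ltrBlDr lerBrDr mulrC.
  by rewrite ltrBlDr lerBrDr mulrC.
rewrite !lebesgue_measure_itv /= !lte_fin ltr_pM2r ?invr_gt0 // ltrD2r.
case: ifP => _; last by rewrite mule0.
rewrite -!EFinD -EFinM -mulrBl mulrC divfK ?gt_eqF //; congr (_%:E); ring.
Qed.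

Lemma prode_scale (n : nat) (a : R) (x : 'I_n -> \bar R) :
  (\prod_(i < n) (a%:E * x i) = (a ^+ n)%:E * \prod_(i < n) x i)%E.
Proof.
elim: n x => [|n IHn] x; first by rewrite !big_ord0 expr0 mule1.
by rewrite !big_ord_recl IHn exprS EFinM muleACA.
Qed.

Context {n : nat}.
Local Notation E := 'rV[R]_n.

Definition affine (a : R) (b : E) (x : E) : E := a *: x + b.

Lemma measurable_affine a b : measurable_fun setT (affine a b).
Proof.
apply: measurable_fun_coord_rVP => i.
rewrite (_ : _ \o _ = affine1 a (b ord0 i) \o coord_rV i); last first.
  by apply/funext => x; rewrite /= /coord_rV /affine /affine1 !mxE.
by apply: measurableT_comp; last exact: measurable_coord_rV.
Qed.

HB.instance Definition _ a b := isMeasurableFun.Build _ _ _ _ (affine a b)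
  (@measurable_affine a b).

(** Both sides are measures in [A] that agree on boxes. With b = 0 this gives the volumes of balls,
    with a = 1 the translation invariance behind integration by parts. *)
Lemma lebesgue_rV_affine (a : R) (b : E) (A : set E) : 0 < a -> measurable A ->
  lebesgue_rV R n A = ((a ^+ n)%:E * lebesgue_rV R n (affine a b @^-1` A))%E.
Proof.
move=> a0 mA.
have an0 : 0 <= a ^+ n by rewrite exprn_ge0 // ltW.
pose k : {nonneg R} := NngNum an0.
apply: (@lebesgue_rV_unique R n (mscale k (pushforward (lebesgue_rV R n) (affine a b)))) => //.
move=> X mX.
rewrite -[LHS]/((a ^+ n)%:E * lebesgue_rV R n (affine a b @^-1` box X))%E.
rewrite (_ : _ @^-1` _ = box (fun i => affine1 a (b ord0 i) @^-1` X i)); last first.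
  by apply/seteqP; split => x /= h i; have := h i; rewrite /affine /affine1 !mxE.
have mXa i : measurable (affine1 a (b ord0 i) @^-1` X i).
  by have := @measurable_affine1 a (b ord0 i) measurableT _ (mX i); rewrite setTI.
rewrite lebesgue_rV_box // -prode_scale; apply: eq_bigr => i _.
by rewrite -lebesgue_measure_affine.
Qed.

Lemma integral_translation (b : E) (f : E -> \bar R) : measurable_fun setT f ->
  (lebesgue_rV R n).-integrable setT (fun x => f (x + b)) ->
  (\int[lebesgue_rV R n]_x f (x + b)%R = \int[lebesgue_rV R n]_x f x)%E.
Proof.
move=> mf intf.
have pf A : measurable A -> pushforward (lebesgue_rV R n) (affine 1 b) A = lebesgue_rV R n A.
  by move=> mA; rewrite (lebesgue_rV_affine b ltr01 mA) expr1n mul1e.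
have fE : f \o affine 1 b = (fun x => f (x + b)).
  by apply/funext => x; rewrite /= /affine scale1r.
have -> : (\int[lebesgue_rV R n]_x f x =
    \int[pushforward (lebesgue_rV R n) (affine 1 b)]_x f x)%E.
  by apply: eq_measure_integral => A mA _; exact/esym/pf.
rewrite [RHS](integral_pushforward (@measurable_affine 1 b)) ?preimage_setT ?fE //.
Qed.

End affine_maps.

Lemma has_deriv_seq {R : realType} (f : R -> R) (x d : R) : has_deriv f x d ->
  k.+1%:R * (f (k.+1%:R^-1 + x) - f x) @[k --> \oo] --> d.
Proof.
move=> [/cvg_ex[l hl] dE]; have lE : l = d by rewrite -dE; apply/esym/cvg_lim.
rewrite -lE; move/cvgr_dnbhsP : hl => h.
have {h} := h (@harmonic R) (conj (fun k => lt0r_neq0 (harmonic_gt0 k)) cvg_harmonic).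
by under eq_fun do rewrite /= invrK [_%:A]mulr1.
Qed.

(** * Compactly supported functions and integration by parts *)

Section compact_support.
Context {R : realType} {n : nat}.
Local Notation E := 'rV[R]_n.
Local Notation mu := (lebesgue_rV R n).
Implicit Types (K : set E) (f g F : E -> R).

Definition vanishes_off K f := forall x, ~ K x -> f x = 0.

Lemma rV_coord_le (x : E) i : `|x ord0 i| <= `|x|.
Proof.
have /mapP[j Hj ->] : `|x ord0 i| \in [seq `|x p.1 p.2| | p : 'I_1 * 'I_n].
  by apply/mapP; exists (ord0, i) => //=; rewrite mem_enum.
by rewrite [leRHS]/Num.Def.normr /= mx_normrE; apply/bigmax_geP; right => /=; exists j.
Qed.

Definition cube (M : R) : set E := box (fun=> `[- M, M]%classic).

Lemma cubeP M x : cube M x <-> forall i, `|x ord0 i| <= M.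
Proof.
by split=> h i; have := h i; rewrite /= in_itv /= ler_norml.
Qed.

Lemma measurable_cube M : measurable (cube M).
Proof. by apply: measurable_box => i; exact: measurable_itv. Qed.

Lemma cube_lty M : (mu (cube M) < +oo)%E.
Proof.
rewrite lebesgue_rV_box; last by move=> i; exact: measurable_itv.
under eq_bigr do rewrite lebesgue_measure_itv.
rewrite -ge0_fin_numE; last first.
  by apply: prode_ge0 => j; case: ifP => // h; rewrite sube_ge0 //= lee_fin ltW.
by elim/big_ind: _ => // [x y|j _]; [exact: fin_numM|case: ifP].
Qed.

Lemma compact_cube M : compact (cube M).
Proof.
by apply: (@rV_compact _ _ (fun=> `[- M, M]%classic)) => _; exact: segment_compact.
Qed.

Lemma compact_sub_cube K : compact K -> exists2 M, 0 <= M & K `<=` cube M.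
Proof.
move=> /compact_bounded[M0 [_ hM]]; exists (`|M0| + 1); first by rewrite addr_ge0.
move=> x Kx; apply/cubeP => i; apply: le_trans (rV_coord_le _ _) _.
apply: (hM (`|M0| + 1)) => //; apply: le_lt_trans (ler_norm _) _.
by rewrite ltrDl.
Qed.

Lemma compact_rV_closed K : compact K -> closed K.
Proof. by move=> cK; apply: compact_closed => //; exact: norm_hausdorff. Qed.

Lemma compact_measurable_rV K : compact K -> measurable K.
Proof. by move=> /compact_rV_closed; exact: closed_measurable_rV. Qed.

Lemma compact_lty K : compact K -> (mu K < +oo)%E.
Proof.
move=> cK; have [M _ KM] := compact_sub_cube cK.
apply: le_lt_trans (cube_lty M); apply: le_measure => //; rewrite inE.
  exact: compact_measurable_rV.
exact: measurable_cube.
Qed.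

Lemma continuous_bounded_on K f : compact K -> continuous f ->
  exists2 M, 0 <= M & forall x, K x -> `|f x| <= M.
Proof.
move=> cK cf; have /compact_bounded[M [_ hM]] : compact (f @` K).
  by apply: continuous_compact => //; exact: continuous_subspaceT.
exists (`|M| + 1) => [|x Kx]; first by rewrite addr_ge0.
apply: (hM (`|M| + 1)); last by exists x.
by apply: le_lt_trans (ler_norm _) _; rewrite ltrDl.
Qed.

Lemma vanishing_bounded K f : compact K -> continuous f -> vanishes_off K f ->
  exists2 M, 0 <= M & forall x, `|f x| <= M.
Proof.
move=> cK cf f0; have [M M0 hM] := continuous_bounded_on cK cf.
exists M => // x; have [|nK] := pselect (K x); first exact: hM.
by rewrite f0 // normr0.
Qed.

Lemma integrable_vanishing K f : compact K -> continuous f -> vanishes_off K f ->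
  mu.-integrable setT (EFin \o f).
Proof.
move=> cK cf f0; have mK := compact_measurable_rV cK.
rewrite (_ : EFin \o f = (EFin \o f) \_ K); last first.
  apply/funext => x; rewrite /patch; case: ifPn => // /negP; rewrite inE => nK.
  by rewrite /= f0.
apply/(integrable_mkcond _ mK).1/measurable_bounded_integrable => //.
- exact: compact_lty.
- exact: continuous_measurable_rV.
have [M M0 hM] := continuous_bounded_on cK cf.
exists M; split; first exact: num_real.
by move=> y My x Kx; apply: le_trans (hM _ Kx) (ltW My).
Qed.

Lemma partial_vanishing K f i : closed K -> vanishes_off K f -> vanishes_off K (partial i f).
Proof.
move=> cK f0 x nKx; rewrite /partial.
rewrite (@near_eq_derive _ _ _ f (fun=> 0)).
  by have /has_partialP[] := @has_partial_cst R n 0 i x.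
have : nbhs x (~` K) by apply: open_nbhs_nbhs; split => //; rewrite openC.
by apply: filterS => y nKy; exact: f0.
Qed.

Lemma partial_line_MVT F i x (h M : R) : is_Ck 1 F -> 0 < h ->
  (forall y, `|partial i F y| <= M) ->
  `|F (h *: delta_mx ord0 i + x) - F x| <= M * h.
Proof.
move=> cF h0 hM.
have d t : has_deriv (fun t => F (t *: delta_mx ord0 i + x)) t
    (partial i F (t *: delta_mx ord0 i + x)).
  by apply: has_partial_line; exact: (has_partial_partial _ _ cF).
have [|c _] := @MVT _ (fun t => F (t *: delta_mx ord0 i + x)) _ _ _ h0 (fun t _ => d t).
  by apply: cts_within => t; exact: der_continuous (d t).
rewrite scale0r add0r subr0 => ->; rewrite normrM (gtr0_norm h0).
by rewrite ler_wpM2r // ltW.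
Qed.

(** Translation invariance replaces Fubini: the difference quotients of [F] have integral 0,
    converge to the partial derivative, and are dominated by a constant on a fixed cube by the mean
    value theorem. *)
Lemma integral_partial_eq0 F K i : is_Ck 1 F -> compact K -> vanishes_off K F ->
  \int[mu]_x partial i F x = 0.
Proof.
move=> cF cK F0; have clK := compact_rV_closed cK.
have cdF : continuous (partial i F) := (cF.2 i).2.
have cF0 : continuous F := cF.1.
have [M M0 hM] := vanishing_bounded cK cdF (partial_vanishing i clK F0).
have [L L0 KL] := compact_sub_cube cK.
pose e : E := delta_mx ord0 i.
have cshift (h : R) : continuous (fun x => F (h *: e + x)).
  move=> x; apply: continuous_comp; last exact: cF0.
  apply: (@continuousD _ _ _ (cst (h *: e)) id); first exact: cst_continuous.
  by move=> ?; exact: cvg_id.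
have hk0 k : 0 < k.+1%:R^-1 :> R by rewrite invr_gt0.
have hk1 k : k.+1%:R^-1 <= 1 :> R by rewrite invf_le1 // ler1n.
pose f_ k x := k.+1%:R * (F (k.+1%:R^-1 *: e + x) - F x).
have cf_ k : continuous (f_ k).
  apply: cts_mul; first exact: cts_cst.
  by apply: cts_add; [exact: cshift|exact: cts_opp].
(* Shifts by h <= 1 move the support by at most 1, so the cube of half-width L + 1 serves all
   quotients. *)
have shift_vanish (h : R) : 0 < h -> h <= 1 ->
    vanishes_off (cube (L + 1)) (fun x => F (h *: e + x)).
  move=> h0 h1 x nx; apply: F0 => /KL /cubeP hx; apply: nx; apply/cubeP => j.
  have := hx j; rewrite !mxE; set s := _%:R; move=> hj.
  have s1 : `|h * s| <= 1.
    by rewrite normrM (gtr0_norm h0) /s; case: (_ && _); rewrite ?normr1 ?normr0 ?mulr1 ?mulr0.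
  rewrite -[x ord0 j](addrK (h * s)) addrC.
  apply: (le_trans (ler_normD _ _)); rewrite normrN addrC [x ord0 j + _]addrC.
  exact: lerD.
have F_vanish : vanishes_off (cube (L + 1)) F.
  move=> x nx; apply: F0 => /KL/cubeP hx; apply: nx; apply/cubeP => j.
  by apply: le_trans (hx j) _; rewrite lerDl.
have f_vanish k : vanishes_off (cube (L + 1)) (f_ k).
  by move=> x nx; rewrite /f_ shift_vanish // F_vanish // subrr mulr0.
have intF : mu.-integrable setT (EFin \o F) by exact: (integrable_vanishing cK).
have intshift k : mu.-integrable setT (EFin \o (fun x => F (k.+1%:R^-1 *: e + x))).
  exact: (integrable_vanishing (@compact_cube (L + 1)) (cshift _) (shift_vanish _ (hk0 k) (hk1 k))).
have f_0 k : (\int[mu]_x (f_ k x)%:E = 0)%E.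
  under eq_integral do rewrite EFinM.
  rewrite integralZl //; last first.
    rewrite (_ : (fun x => _) = (fun x => (EFin \o (fun x => F (k.+1%:R^-1 *: e + x)%R)) x - (EFin \o F) x)%E) //.
    exact: integrableB.
  under eq_integral do rewrite EFinB.
  rewrite integralB_EFin //.
  under eq_integral do rewrite addrC.
  have := @integral_translation R n (k.+1%:R^-1 *: e) (EFin \o F).
  move=> /= ->; rewrite ?subee ?mule0 //.
  - by apply: integrable_fin_num.
  - by apply/measurable_EFinP; exact: continuous_measurable_rV.
  - rewrite (_ : (fun x => _) = EFin \o (fun x => F (k.+1%:R^-1 *: e + x))) //.
    by apply/funext => x /=; rewrite addrC.
have [] := @dominated_convergence _ _ _ mu setT measurableT (fun k x => (f_ k x)%:E)
  (fun x => (partial i F x)%:E) (fun x => (M%:E * (\1_(cube (L + 1)) x)%:E)%E).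
- by move=> k; apply/measurable_EFinP; exact: continuous_measurable_rV.
- by apply/measurable_EFinP; exact: continuous_measurable_rV.
- apply: aeW => x _; apply: cvg_EFin; first exact: nearW.
  have := has_deriv_seq (has_partial_partial i x cF).
  by under eq_fun do rewrite addr0 scale0r add0r.
- apply: integrableZl => //; apply/integrableP; split.
    by apply/measurable_EFinP; apply: measurable_indic; exact: measurable_cube.
  under eq_integral do rewrite gee0_abs ?lee_fin //.
  rewrite integral_indic ?setIT //; last exact: measurable_cube.
  exact: cube_lty.
- apply: aeW => x k _ /=; rewrite -EFinM lee_fin /indic.
  case: (boolP (x \in cube (L + 1))) => [xL|/negP]; last first.
    by rewrite inE => nx; rewrite f_vanish // normr0 mulr0.
  rewrite mulr1 /f_ normrM gtr0_norm //.
  have := partial_line_MVT x cF (hk0 k) hM.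
  by rewrite ler_pdivlMr // mulrC.
move=> _ _ h.
have h0 : (fun k => \int[mu]_x (f_ k x)%:E)%E @ \oo --> 0%E.
  by under eq_fun do rewrite f_0; exact: cvg_cst.
by rewrite /Rintegral (cvg_unique _ h h0).
Qed.

End compact_support.

(** * The weighted Rellich inequality *)

Section L2_pairing.
Context {R : realType} {n : nat}.
Local Notation E := 'rV[R]_n.
Local Notation mu := (lebesgue_rV R n).
Implicit Types (D : set E) (a b f g h : E -> R).

Definition bounded_by (M : R) b := forall x, `|b x| <= M.

Lemma L2_integrable D f : measurable D -> L2 D f ->
  mu.-integrable D (EFin \o (fun x => f x ^+ 2)).
Proof.
move=> mD [mf ff]; apply/integrableP; split.
  by apply/measurable_EFinP; exact: measurable_funX.
by under eq_integral do rewrite /= ger0_norm ?sqr_ge0 //.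
Qed.

Lemma integrable_le D f g : measurable D -> measurable_fun D f ->
  (forall x, D x -> `|f x| <= g x) -> mu.-integrable D (EFin \o g) ->
  mu.-integrable D (EFin \o f).
Proof.
move=> mD mf fg ig; apply: (le_integrable mD _ _ ig); first exact/measurable_EFinP.
move=> x Dx /=; rewrite lee_fin; apply: (le_trans (fg x Dx)); exact: ler_norm.
Qed.

Lemma integrable_lin D (k l : R) f g : measurable D -> mu.-integrable D (EFin \o f) ->
  mu.-integrable D (EFin \o g) -> mu.-integrable D (EFin \o (fun x => k * f x + l * g x)).
Proof.
move=> mD hf hg.
have := integrableD mD (integrableZl mD k hf) (integrableZl mD l hg).
by apply: eq_integrable => // x _ /=; rewrite EFinD !EFinM.
Qed.

Lemma Rintegral_lin D (k l : R) f g : measurable D -> mu.-integrable D (EFin \o f) ->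
  mu.-integrable D (EFin \o g) ->
  \int[mu]_(x in D) (k * f x + l * g x) =
  k * \int[mu]_(x in D) f x + l * \int[mu]_(x in D) g x.
Proof.
move=> mD hf hg; rewrite RintegralD //.
- by rewrite !RintegralZl.
- have := integrableZl mD k hf; apply: eq_integrable => // x _ /=; by rewrite EFinM.
- have := integrableZl mD l hg; apply: eq_integrable => // x _ /=; by rewrite EFinM.
Qed.

Lemma amgm_weighted (d x y : R) : 0 < d -> `|x * y| <= d / 2 * x ^+ 2 + d^-1 / 2 * y ^+ 2.
Proof.
move=> d0; have key z : z * y <= d / 2 * z ^+ 2 + d^-1 / 2 * y ^+ 2.
  rewrite -subr_ge0 (_ : _ - _ = d / 2 * (z - d^-1 * y) ^+ 2); last by field; rewrite gt_eqF.
  by rewrite mulr_ge0 ?sqr_ge0 // divr_ge0 // ltW.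
have h1 := key x; have h2 := key (- x); rewrite sqrrN mulNr in h2.
by rewrite ler_norml; apply/andP; split; lra.
Qed.

Lemma L2_mul_integrable D f g : measurable D -> L2 D f -> L2 D g ->
  mu.-integrable D (EFin \o (fun x => f x * g x)).
Proof.
move=> mD Lf Lg; have := integrable_lin (1 / 2) (1^-1 / 2) mD (L2_integrable mD Lf) (L2_integrable mD Lg).
apply: integrable_le => //; first by apply: measurable_funM; [exact: Lf.1|exact: Lg.1].
by move=> x Dx; exact: amgm_weighted.
Qed.

Lemma L2_mulb D f b M : measurable D -> L2 D f -> measurable_fun D b -> bounded_by M b ->
  L2 D (fun x => f x * b x).
Proof.
move=> mD Lf mb bM; split; first by apply: measurable_funM => //; exact: Lf.1.
have /integrableP[_] : mu.-integrable D (EFin \o (fun x => (f x * b x) ^+ 2)).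
  have := integrable_lin (M ^+ 2) 0 mD (L2_integrable mD Lf) (L2_integrable mD Lf).
  apply: integrable_le => //.
    by apply: measurable_funX; apply: measurable_funM => //; exact: Lf.1.
  move=> x _; rewrite mul0r addr0 ger0_norm ?sqr_ge0 // exprMn mulrC.
  apply: ler_wpM2r; first exact: sqr_ge0.
  by rewrite -[leLHS]real_normK ?num_real // lerXn2r ?nnegrE //; exact: le_trans (bM x).
by under eq_integral do rewrite /= ger0_norm ?sqr_ge0 //.
Qed.

Lemma L2D D f g : measurable D -> L2 D f -> L2 D g -> L2 D (fun x => f x + g x).
Proof.
move=> mD Lf Lg; split; first by apply: measurable_funD; [exact: Lf.1|exact: Lg.1].
have /integrableP[_] : mu.-integrable D (EFin \o (fun x => (f x + g x) ^+ 2)).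
  have := integrable_lin 2 2 mD (L2_integrable mD Lf) (L2_integrable mD Lg).
  apply: integrable_le => //.
    by apply: measurable_funX; apply: measurable_funD; [exact: Lf.1|exact: Lg.1].
  move=> x _; rewrite ger0_norm ?sqr_ge0 //.
  by have := sqr_ge0 (f x - g x); nra.
by under eq_integral do rewrite /= ger0_norm ?sqr_ge0 //.
Qed.

Lemma L2N D f : L2 D f -> L2 D (fun x => - f x).
Proof.
move=> [mf Lf]; split; first exact: measurableT_comp.
by under eq_integral do rewrite sqrrN.
Qed.

Lemma L2_sum D (I : Type) (r : seq I) (F : I -> E -> R) : measurable D ->
  (forall i, L2 D (F i)) -> L2 D (fun x => \sum_(i <- r) F i x).
Proof.
move=> mD LF; elim: r => [|i r IHr].
  rewrite (_ : (fun _ => _) = fun=> 0); last by apply/funext => x; rewrite big_nil.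
  split; first exact: measurable_cst.
  by under eq_integral do rewrite expr0n /=; rewrite integral0 ltry.
rewrite (_ : (fun _ => _) = fun x => F i x + \sum_(j <- r) F j x).
  exact: L2D.
by apply/funext => x; rewrite big_cons.
Qed.

Lemma Rintegral_sum D (I : Type) (r : seq I) (F : I -> E -> R) : measurable D ->
  (forall i, mu.-integrable D (EFin \o F i)) ->
  mu.-integrable D (EFin \o (fun x => \sum_(i <- r) F i x)) /\
  \int[mu]_(x in D) (\sum_(i <- r) F i x) = \sum_(i <- r) \int[mu]_(x in D) F i x.
Proof.
move=> mD LF; elim: r => [|i r [IH1 IH2]].
  rewrite (_ : (fun _ => _) = fun=> 0); last by apply/funext => x; rewrite big_nil.
  by rewrite big_nil /Rintegral integral0; split => //; exact: integrable0.
rewrite (_ : (fun _ => _) = fun x => F i x + \sum_(j <- r) F j x).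
  rewrite big_cons RintegralD // IH2; split => //.
  by have := integrableD mD (LF i) IH1; apply: eq_integrable.
by apply/funext => x; rewrite big_cons.
Qed.

(** Weighted Young inequality in place of Cauchy-Schwarz; the free parameter [d] is tuned in
    [pairing_cvg]. *)
Lemma pairing_bound D a f b M (d e : R) : measurable D -> L2 D a -> L2 D f ->
  measurable_fun D b -> bounded_by M b -> 0 < d ->
  \int[mu]_(x in D) (f x ^+ 2) <= e ->
  `|\int[mu]_(x in D) (a x * (f x * b x))| <=
    d / 2 * \int[mu]_(x in D) (a x ^+ 2) + d^-1 / 2 * (M ^+ 2 * e).
Proof.
move=> mD La Lf mb bM d0 fe.
have Lfb := L2_mulb mD Lf mb bM.
have ia := L2_integrable mD La; have iff := L2_integrable mD Lf.
apply: (le_trans (le_normr_Rintegral mD (L2_mul_integrable mD La Lfb))).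
apply: (@le_trans _ _ (d / 2 * \int[mu]_(x in D) (a x ^+ 2)
    + d^-1 / 2 * M ^+ 2 * \int[mu]_(x in D) (f x ^+ 2))).
  rewrite -Rintegral_lin //; apply: le_Rintegral => //.
  - have := L2_mul_integrable mD La Lfb => /integrable_abse; apply: eq_integrable => //.
  - exact: integrable_lin.
  - move=> x Dx; apply: (le_trans (amgm_weighted (a x) (f x * b x) d0)).
    rewrite lerD2l -(mulrA (d^-1 / 2)); apply: ler_wpM2l; first by rewrite divr_ge0 // invr_ge0 ltW.
    rewrite exprMn mulrC; apply: ler_wpM2r; first exact: sqr_ge0.
    by rewrite -[leLHS]real_normK ?num_real // lerXn2r ?nnegrE //; exact: le_trans (bM x).
rewrite lerD2l -(mulrA (d^-1 / 2)); apply: ler_wpM2l; first by rewrite divr_ge0 // invr_ge0 ltW.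
by apply: ler_wpM2l => //; exact: sqr_ge0.
Qed.

Lemma pairing_cvg D a f (f_ : nat -> E -> R) b M : measurable D -> L2 D a -> L2 D f ->
  (forall k, L2 D (f_ k)) -> measurable_fun D b -> bounded_by M b ->
  (forall k, \int[mu]_(x in D) ((f x - f_ k x) ^+ 2) <= k.+1%:R ^- 2) ->
  \int[mu]_(x in D) (a x * (f_ k x * b x)) @[k --> \oo] -->
  \int[mu]_(x in D) (a x * (f x * b x)).
Proof.
move=> mD La Lf Lf_ mb bM fk.
set A := \int[mu]_(x in D) (a x ^+ 2).
have bnd k : `|\int[mu]_(x in D) (a x * (f x * b x)) -
    \int[mu]_(x in D) (a x * (f_ k x * b x))| <= (A / 2 + M ^+ 2 / 2) * k.+1%:R^-1.
  have Ld : L2 D (fun x => f x - f_ k x) by apply: L2D => //; exact: L2N.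
  have k0 : 0 < k.+1%:R^-1 :> R by rewrite invr_gt0.
  (* d = 1 / (k + 1) against a squared error (k + 1)^-2 makes both terms of order 1 / (k + 1). *)
  have := pairing_bound mD La Ld mb bM k0 (fk k).
  rewrite (_ : k.+1%:R^-1 / 2 * _ + _ = (A / 2 + M ^+ 2 / 2) * k.+1%:R^-1); last first.
    by rewrite -/A; field; rewrite nat1r pnatr_eq0.
  apply: le_trans; rewrite -RintegralB //; last 2 first.
  - exact: L2_mul_integrable (L2_mulb mD Lf mb bM).
  - exact: L2_mul_integrable (L2_mulb mD (Lf_ k) mb bM).
  by under [in leRHS]eq_Rintegral do rewrite mulrBl mulrBr.
apply/cvgrPdist_le => e e0.
have cv : (A / 2 + M ^+ 2 / 2) * harmonic k @[k --> \oo] --> 0.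
  rewrite -[X in _ --> X](mulr0 (A / 2 + M ^+ 2 / 2)).
  by apply: cvgM; [exact: cvg_cst|exact: cvg_harmonic].
near=> k; apply: (le_trans (bnd k)).
have : `|0 - (A / 2 + M ^+ 2 / 2) * harmonic k| <= e by near: k; exact: cvgr_dist_le.
by rewrite sub0r normrN; apply: le_trans; exact: ler_norm.
Unshelve. all: by end_near. Qed.

End L2_pairing.

Section test_functions.
Context {R : realType} {n : nat}.
Local Notation E := 'rV[R]_n.
Local Notation mu := (lebesgue_rV R n).
Implicit Types (D : set E) (psi b : E -> R).

Lemma test_mul D psi b : test_function D psi -> (forall k, is_Ck k b) ->
  test_function D (fun x => psi x * b x).
Proof.
move=> [cp [K [cK KD K0]]] cb; split; first by move=> k; exact: CkM.
by exists K; split => // x nK; rewrite K0 // mul0r.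
Qed.

Lemma test_partial D psi i : test_function D psi -> test_function D (partial i psi).
Proof.
move=> [cp [K [cK KD K0]]]; split; first by move=> k; exact: ((cp k.+1).2 i).2.
by exists K; split => //; apply: partial_vanishing => //; exact: compact_rV_closed.
Qed.

Lemma test_continuous D psi : test_function D psi -> continuous psi.
Proof. by move=> [cp _]; exact: (cp 0). Qed.

Lemma test_L2 D psi : measurable D -> test_function D psi -> L2 D psi.
Proof.
move=> mD tp; have cp := test_continuous tp; have [_ [K [cK KD K0]]] := tp.
split; first exact: continuous_measurable_rV.
have : mu.-integrable setT (EFin \o (fun x => psi x ^+ 2)).
  apply: (integrable_vanishing cK); first exact: cts_exp.
  by move=> x nK; rewrite K0 // expr0n.
move=> /(integrableS measurableT mD (@subsetT _ D)) /integrableP[_].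
by under eq_integral do rewrite /= ger0_norm ?sqr_ge0 //.
Qed.

End test_functions.

Lemma cvg_eq_lim {R : realType} (u v : nat -> R) (a b : R) :
  u @ \oo --> a -> v @ \oo --> b -> (forall k, u k = v k) -> a = b.
Proof. by move=> ua vb uv; move: ua; rewrite (funext uv) => ub; exact: (cvg_unique _ ub vb). Qed.

Section weight.
Context {R : realType} {n : nat}.
Local Notation E := 'rV[R]_n.

(** Its square decays like the Rellich weight |x|^-4 but has no singularity; the derivatives that
    occur are bounded, as [pairing_cvg] requires. *)
Definition weight (x : E) : R := (1 + sqnorm x)^-1.

Lemma weight_den_gt0 (x : E) : 0 < 1 + sqnorm x.
Proof. by have := sqnorm_ge0 x; lra. Qed.

Lemma Ck_weight k : is_Ck k weight.
Proof.
apply: Ck_inv; first by move=> x; rewrite lt0r_neq0 // weight_den_gt0.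
by apply: CkD; [exact: Ck_cst|exact: Ck_sqnorm].
Qed.

Lemma weight_gt0 x : 0 < weight x.
Proof. by rewrite invr_gt0 weight_den_gt0. Qed.

Lemma weight_le1 x : weight x <= 1.
Proof. by rewrite invf_le1 ?weight_den_gt0 // lerDl sqnorm_ge0. Qed.

Definition weight1 (i : 'I_n) (x : E) : R := -2 * x ord0 i * weight x ^+ 2.
Definition weight2 (i : 'I_n) (x : E) : R :=
  -2 * weight x ^+ 2 + 8 * x ord0 i ^+ 2 * weight x ^+ 3.

Lemma has_partial_weight (i : 'I_n) (x : E) : has_partial weight i x (weight1 i x).
Proof.
apply: has_partial_eq.
  apply: has_partialV; first by rewrite lt0r_neq0 // weight_den_gt0.
  exact: has_partialD (has_partial_cst _ _ _) (has_partial_sqnorm i x).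
rewrite /weight1 /weight; field; by rewrite lt0r_neq0 // weight_den_gt0.
Qed.

Lemma partial_weight i : partial i weight = weight1 i.
Proof. by apply/funext => x; have /has_partialP[] := has_partial_weight i x. Qed.

Lemma partial_weight1 i : partial i (weight1 i) = weight2 i.
Proof.
apply/funext => x.
suff /has_partialP[] : has_partial (weight1 i) i x (weight2 i x) by [].
have h1 := has_partialM (has_partial_cst (-2) i x) (has_partial_coord i i x).
have h2 := has_partialM (has_partial_weight i x) (has_partial_weight i x).
rewrite (_ : weight1 i = fun y => -2 * y ord0 i * (weight y * weight y)).
  apply: has_partial_eq (has_partialM h1 h2) _.
  rewrite /weight2 /weight1 eqxx -[true%:R]/(1 : R); ring.
by apply/funext => y; rewrite /weight1 expr2.
Qed.

Lemma Ck_weight1 i k : is_Ck k (weight1 i).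
Proof. by rewrite -partial_weight; exact: ((Ck_weight k.+1).2 i).2. Qed.

Lemma Ck_weight2 i k : is_Ck k (weight2 i).
Proof. by rewrite -partial_weight1; exact: ((Ck_weight1 i k.+1).2 i).2. Qed.

Lemma coord_weight (i : 'I_n) (x : E) : x ord0 i ^+ 2 * weight x <= 1.
Proof.
rewrite ler_pdivrMr ?weight_den_gt0 // mul1r.
have : x ord0 i ^+ 2 <= sqnorm x.
  rewrite /sqnorm (bigD1 i) //= lerDl; apply: sumr_ge0 => j _; exact: sqr_ge0.
lra.
Qed.

Lemma weight_bounded : bounded_by 1 weight.
Proof. by move=> x; rewrite gtr0_norm ?weight_gt0 // weight_le1. Qed.

Lemma weight1_bounded i : bounded_by 2 (weight1 i).
Proof.
move=> x; have w0 := weight_gt0 x; have w1 := weight_le1 x.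
have h := coord_weight i x; rewrite /weight1.
have h1 : (x ord0 i * weight x) ^+ 2 <= 1.
  rewrite exprMn (expr2 (weight x)) mulrA.
  have : 0 <= x ord0 i ^+ 2 * weight x by rewrite mulr_ge0 ?sqr_ge0 // ltW.
  nra.
have h2 : `|x ord0 i * weight x| <= 1 by rewrite -(@expr_le1 _ 2) // real_normK ?num_real.
rewrite (_ : _ * _ = -2 * (x ord0 i * weight x) * weight x); last by ring.
rewrite normrM (gtr0_norm w0) normrM normrN (ger0_norm (ler0n _ 2)).
have z0 := normr_ge0 (x ord0 i * weight x).
by rewrite -mulrA ler_piMr // mulr_ile1 // ltW.
Qed.

Lemma weight2_bounded i : bounded_by 10 (weight2 i).
Proof.
move=> x; have w0 := weight_gt0 x; have w1 := weight_le1 x.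
have h := coord_weight i x; rewrite /weight2.
have q0 : 0 <= x ord0 i ^+ 2 * weight x by rewrite mulr_ge0 ?sqr_ge0 // ltW.
have w2 : weight x ^+ 2 <= 1 by rewrite exprn_ile1 // ltW.
have w20 : 0 <= weight x ^+ 2 by exact: sqr_ge0.
have -> : 8 * x ord0 i ^+ 2 * weight x ^+ 3 = 8 * (x ord0 i ^+ 2 * weight x) * weight x ^+ 2.
  by ring.
have h3 : (x ord0 i ^+ 2 * weight x) * weight x ^+ 2 <= 1 by rewrite mulr_ile1.
have h4 : 0 <= (x ord0 i ^+ 2 * weight x) * weight x ^+ 2 by rewrite mulr_ge0.
by rewrite ler_norml; apply/andP; split; lra.
Qed.

(** As |x|^2 w = 1 - w, the Laplacian of w is (8 - 2 n) w^2 - 8 w^3, and 8 - 2 n <= -2 exactly from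
    n = 5 on. *)
Lemma sum_weight2 (x : E) : (5 <= n)%N -> \sum_(i < n) weight2 i x <= - (2 * weight x ^+ 2).
Proof.
move=> n5; rewrite /weight2 big_split /= sumr_const card_ord -mulr_suml -mulr_sumr.
rewrite -/(sqnorm x).
have sw : sqnorm x * weight x = 1 - weight x.
  by rewrite /weight; field; rewrite lt0r_neq0 // weight_den_gt0.
have -> : 8 * sqnorm x * weight x ^+ 3 = 8 * (sqnorm x * weight x) * weight x ^+ 2 by ring.
rewrite sw -mulr_natr.
have n5' : 5 <= n%:R :> R by rewrite ler_nat.
have w20 : 0 <= weight x ^+ 2 by exact: sqr_ge0.
have w30 : 0 <= weight x * weight x ^+ 2 by rewrite mulr_ge0 // ltW // weight_gt0.
have : 5 * weight x ^+ 2 <= n%:R * weight x ^+ 2 by apply: ler_wpM2r.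
nra.
Qed.

End weight.

Section rellich.
Context {R : realType} {n : nat}.
Local Notation E := 'rV[R]_n.
Local Notation mu := (lebesgue_rV R n).

(* Testing the weak Laplacian with [weight * phi] and integrating by parts; as the
   weight is superharmonic, the gradient terms can be dropped. The gradients in
   [weak_laplacian] and [sobolev10] are only equal almost everywhere, but they have the
   same pairings with test functions, which suffices. *)
Lemma rellich (D : set E) (phi lphi : E -> R) : (5 <= n)%N -> measurable D ->
  sobolev10 D phi -> weak_laplacian D phi lphi ->
  (\int[mu]_(x in D) ((weight x * phi x) ^+ 2)%:E <= \int[mu]_(x in D) (lphi x ^+ 2)%:E)%E.
Proof.
move=> n5 mD [g wg [Lphi approx]] [g0 [h [wh ->]]].
have Lg i : L2 D (g i) by have [] := wg i.
have Lh i : L2 D (h i) by have [_ []] := wh i.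
have /choice[psi psiP] : forall k : nat, exists psi, test_function D psi /\
    (\int[mu]_(x in D) ((phi x - psi x) ^+ 2)%:E +
     \sum_(i < n) \int[mu]_(x in D) ((g i x - partial i psi x) ^+ 2)%:E
         < (k.+1%:R ^- 2)%:E)%E.
  move=> k; have [|psi tp hp] := approx (k.+1%:R ^- 2); first by rewrite invr_gt0 exprn_gt0.
  by exists psi.
have tpsi k : test_function D (psi k) by have [] := psiP k.
have int0 f : (0 <= \int[mu]_(x in D) (f x ^+ 2)%:E)%E.
  by apply: integral_ge0 => x _; rewrite lee_fin sqr_ge0.
have fine_int f (e : R) : (\int[mu]_(x in D) (f x ^+ 2)%:E <= e%:E)%E ->
    \int[mu]_(x in D) (f x ^+ 2) <= e.
  move=> fe; rewrite /Rintegral -lee_fin fineK //.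
  by rewrite ge0_fin_numE //; apply: le_lt_trans fe (ltry _).
have phik k : \int[mu]_(x in D) ((phi x - psi k x) ^+ 2) <= k.+1%:R ^- 2.
  apply: fine_int; have [_ /ltW] := psiP k; apply: le_trans.
  by rewrite leeDl // sume_ge0 // => i _; exact: int0.
have gk i k : \int[mu]_(x in D) ((g i x - partial i (psi k) x) ^+ 2) <= k.+1%:R ^- 2.
  apply: fine_int; have [_ /ltW] := psiP k; apply: le_trans.
  by rewrite (bigD1 i) //= addeCA leeDl // adde_ge0 // sume_ge0.
have mb (b : E -> R) : is_Ck 0 b -> measurable_fun D b by exact: continuous_measurable_rV.
have mw := mb _ (Ck_weight 0); have bw := @weight_bounded R n.
have mw1 i := mb _ (Ck_weight1 i 0); have bw1 := @weight1_bounded R n.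
have mw2 i := mb _ (Ck_weight2 i 0); have bw2 := @weight2_bounded R n.
have Lpsi k : L2 D (psi k) by exact: test_L2.
have Ldpsi i k : L2 D (partial i (psi k)) by apply: test_L2 => //; exact: test_partial.
have test_sym i chi : test_function D chi ->
    \int[mu]_(x in D) (g i x * chi x) = \int[mu]_(x in D) (g0 i x * chi x).
  move=> tc; have [_ _ /(_ _ tc) e1] := wg i; have [[_ _ /(_ _ tc) e2] _] := wh i.
  by apply: oppr_inj; rewrite -e1 e2.
(* The derivative of [g0 i] is tested with [psi k * weight], then k tends to infinity; only [psi k]
   and its first derivatives occur, which is what H^1_0 controls. *)
have E1 i : \int[mu]_(x in D) (g i x * (phi x * weight1 i x)) +
    \int[mu]_(x in D) (g i x * (g i x * weight x)) =
    - \int[mu]_(x in D) (h i x * (phi x * weight x)).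
  apply: (@cvg_eq_lim _ (fun k => \int[mu]_(x in D) (g i x * (psi k x * weight1 i x)) +
     \int[mu]_(x in D) (g i x * (partial i (psi k) x * weight x)))
     (fun k => - \int[mu]_(x in D) (h i x * (psi k x * weight x)))).
  - by apply: cvgD; [exact: (pairing_cvg mD (Lg i) Lphi Lpsi (mw1 i) (bw1 i))|
      exact: (pairing_cvg mD (Lg i) (Lg i) (Ldpsi i) mw bw)].
  - by apply: cvgN; exact: (pairing_cvg mD (Lh i) Lphi Lpsi mw bw).
  - move=> k; have tc := test_mul (tpsi k) (@Ck_weight R n).
    have [_ [_ _ /(_ _ tc) <-]] := wh i.
    rewrite -test_sym; last exact: test_partial.
    rewrite -RintegralD //; last 2 first.
    + exact: L2_mul_integrable (L2_mulb mD (Lpsi k) (mw1 i) (bw1 i)).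
    + exact: L2_mul_integrable (L2_mulb mD (Ldpsi i k) mw bw).
    apply: eq_Rintegral => x _; rewrite -mulrDr; congr (_ * _).
    have c1 : is_Ck 1 (psi k) := (tpsi k).1 1%N.
    have /has_partialP[_ ->] := has_partialM (has_partial_partial i x c1) (has_partial_weight i x).
    by rewrite addrC.
(* Likewise [phi] is tested with [psi k * weight1 i]; this expresses the cross term by second
   derivatives of the weight. *)
have E2 i : \int[mu]_(x in D) (phi x * (g i x * weight1 i x)) +
    \int[mu]_(x in D) (phi x * (phi x * weight2 i x)) =
    - \int[mu]_(x in D) (g i x * (phi x * weight1 i x)).
  apply: (@cvg_eq_lim _ (fun k => \int[mu]_(x in D) (phi x * (partial i (psi k) x * weight1 i x)) +
     \int[mu]_(x in D) (phi x * (psi k x * weight2 i x)))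
     (fun k => - \int[mu]_(x in D) (g i x * (psi k x * weight1 i x)))).
  - by apply: cvgD; [exact: (pairing_cvg mD Lphi (Lg i) (Ldpsi i) (mw1 i) (bw1 i))|
      exact: (pairing_cvg mD Lphi Lphi Lpsi (mw2 i) (bw2 i))].
  - by apply: cvgN; exact: (pairing_cvg mD (Lg i) Lphi Lpsi (mw1 i) (bw1 i)).
  - move=> k; have tc := test_mul (tpsi k) (@Ck_weight1 R n i).
    have [_ _ /(_ _ tc) <-] := wg i.
    rewrite -RintegralD //; last 2 first.
    + exact: L2_mul_integrable (L2_mulb mD (Ldpsi i k) (mw1 i) (bw1 i)).
    + exact: L2_mul_integrable (L2_mulb mD (Lpsi k) (mw2 i) (bw2 i)).
    apply: eq_Rintegral => x _; rewrite -mulrDr; congr (_ * _).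
    have c1 : is_Ck 1 (psi k) := (tpsi k).1 1%N.
    have cw : is_Ck 1 (weight1 i : E -> R) := Ck_weight1 i 1.
    have /has_partialP[_ ->] := has_partialM (has_partial_partial i x c1) (has_partial_partial i x cw).
    by rewrite partial_weight1.
have E3 i : \int[mu]_(x in D) (phi x * (g i x * weight1 i x)) =
    \int[mu]_(x in D) (g i x * (phi x * weight1 i x)).
  by apply: eq_Rintegral => x _; ring.
have iP i : mu.-integrable D (EFin \o (fun x => phi x * (phi x * weight2 i x))).
  exact: L2_mul_integrable (L2_mulb mD Lphi (mw2 i) (bw2 i)).
have iH i : mu.-integrable D (EFin \o (fun x => h i x * (phi x * weight x))).
  exact: L2_mul_integrable (L2_mulb mD Lphi mw bw).
(* Half of [E2] is inserted into [E1]; the remaining term g^2 w is nonnegative and dropped. *)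
have E4 i : - (2^-1 * \int[mu]_(x in D) (phi x * (phi x * weight2 i x))) <=
    - \int[mu]_(x in D) (h i x * (phi x * weight x)).
  have gg0 : 0 <= \int[mu]_(x in D) (g i x * (g i x * weight x)).
    apply: Rintegral_ge0 => x _; rewrite mulrA mulr_ge0 ?(ltW (weight_gt0 x)) //.
    by rewrite -expr2 sqr_ge0.
  have := E1 i; have := E2 i; rewrite E3; lra.
have {E1 E2 E3}E4 : - (2^-1 * \int[mu]_(x in D) (\sum_(i < n) phi x * (phi x * weight2 i x))) <=
    - \int[mu]_(x in D) (\sum_(i < n) h i x * (phi x * weight x)).
  have [_ ->] := Rintegral_sum (index_enum 'I_n) mD iP.
  have [_ ->] := Rintegral_sum (index_enum 'I_n) mD iH.
  rewrite mulr_sumr -!sumrN; apply: ler_sum => i _; exact: E4.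
pose l x := \sum_(i < n) h i x.
have Ll : L2 D l by exact: L2_sum.
have Lw : L2 D (fun x => phi x * weight x) by exact: L2_mulb bw.
have iw := L2_integrable mD Lw; have il := L2_integrable mD Ll.
set X := \int[mu]_(x in D) ((phi x * weight x) ^+ 2).
set Y := \int[mu]_(x in D) (l x ^+ 2).
(* With [E4] this bounds X by minus the integral of l phi w, hence by Y / 2 + X / 2 through [h2],
   and X is absorbed. *)
have h1 : 2 * X <= - \int[mu]_(x in D) (\sum_(i < n) phi x * (phi x * weight2 i x)).
  have [iS _] := Rintegral_sum (index_enum 'I_n) mD iP.
  rewrite -[leRHS]mulN1r -!RintegralZl //; apply: le_Rintegral => //.
  - by have := integrableZl mD 2 iw; apply: eq_integrable => // x _ /=; rewrite EFinM.
  - by have := integrableZl mD (-1) iS; apply: eq_integrable => // x _ /=; rewrite EFinM.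
  move=> x _; rewrite -mulr_sumr -mulr_sumr mulN1r mulrA -expr2 -mulrN.
  rewrite (_ : 2 * _ = phi x ^+ 2 * (2 * weight x ^+ 2)); last by ring.
  by rewrite ler_wpM2l ?sqr_ge0 // lerNr; exact: sum_weight2.
have h2 : - (\int[mu]_(x in D) (\sum_(i < n) h i x * (phi x * weight x))) <=
    1 / 2 * Y + 1^-1 / 2 * X.
  have le_opp_norm (z : R) : - z <= `|z| by rewrite -normrN ler_norm.
  apply: (le_trans (le_opp_norm _)).
  have [iS _] := Rintegral_sum (index_enum 'I_n) mD iH.
  apply: (le_trans (le_normr_Rintegral mD iS)).
  rewrite -Rintegral_lin //; apply: le_Rintegral => //.
  - by have := iS => /integrable_abse; apply: eq_integrable.
  - exact: integrable_lin.
  - by move=> x _; rewrite -mulr_suml; exact: amgm_weighted.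
have XY : X <= Y by lra.
have fX : (\int[mu]_(x in D) ((phi x * weight x) ^+ 2)%:E)%E \is a fin_num.
  by rewrite ge0_fin_numE //; case: Lw.
have fY : (\int[mu]_(x in D) (l x ^+ 2)%:E)%E \is a fin_num.
  by rewrite ge0_fin_numE //; case: Ll.
under eq_integral do rewrite mulrC.
by rewrite -(fineK fX) -(fineK fY) lee_fin.
Qed.

End rellich.

(** * Integrals of radial functions *)

Section shells.
Context {R : realType} {n : nat}.
Local Notation E := 'rV[R]_n.+1.
Local Notation mu := (lebesgue_rV R n.+1).

Definition eball (r : R) : set E := [set x | euclid_norm x <= r].

Lemma continuous_euclid_norm : continuous (@euclid_norm R n.+1).
Proof.
move=> x; apply: (@continuous_comp _ _ _ sqnorm Num.sqrt); last exact: sqrt_continuous.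
exact: (@Ck_sqnorm R n.+1 0).
Qed.

Lemma closed_eball r : closed (eball r).
Proof.
rewrite (_ : eball r = (@euclid_norm R n.+1) @^-1` [set y | y <= r]) //.
by apply: (continuous_closedP _).1; [exact: continuous_euclid_norm|exact: closed_le].
Qed.

Lemma coord_le_norm (x : E) i : `|x ord0 i| <= euclid_norm x.
Proof.
rewrite -sqrtr_sqr ler_sqrt ?sqnorm_ge0 // -/(sqnorm x).
by rewrite /sqnorm (bigD1 i) //= lerDl; apply: sumr_ge0 => j _; exact: sqr_ge0.
Qed.

Lemma eball_sub_cube r : eball r `<=` cube r.
Proof. by move=> x /= xr; apply/cubeP => i; apply: le_trans (coord_le_norm x i) xr. Qed.

Lemma compact_eball r : compact (eball r).
Proof.
by apply: subclosed_compact (@closed_eball r) (@compact_cube R n.+1 r) (@eball_sub_cube r).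
Qed.

Lemma measurable_eball r : measurable (eball r).
Proof. exact: (compact_measurable_rV (@compact_eball r)). Qed.

Lemma eball_lty r : (mu (eball r) < +oo)%E.
Proof. exact: (compact_lty (@compact_eball r)). Qed.

Lemma euclid_normZ (r : R) (x : E) : 0 <= r -> euclid_norm (r *: x) = r * euclid_norm x.
Proof.
move=> r0; rewrite /euclid_norm -[X in X * _](ger0_norm r0) -sqrtr_sqr -sqrtrM ?sqr_ge0 //.
by rewrite mulr_sumr; congr Num.sqrt; apply: eq_bigr => i _; rewrite mxE exprMn.
Qed.

(** Never computed: it cancels from the stability inequality as a positive factor.
    [ball_vol * n.+1%:R] is the area of the unit sphere. *)
Definition ball_vol : R := fine (mu (eball 1)).

Lemma mu_eball r : 0 < r -> mu (eball r) = (ball_vol * r ^+ n.+1)%:E.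
Proof.
move=> r0; rewrite (lebesgue_rV_affine 0 r0); last exact: measurable_eball.
rewrite (_ : _ @^-1` _ = eball 1); last first.
  apply/seteqP; split => x; rewrite /eball /affine /= addr0 euclid_normZ ?(ltW r0) //.
    by rewrite -[X in _ <= X]mulr1 ler_pM2l.
  by move=> x1; rewrite -[X in _ <= X]mulr1 ler_pM2l.
rewrite mulrC EFinM /ball_vol fineK // ge0_fin_numE //.
exact: eball_lty.
Qed.

Lemma ball_vol_gt0 : 0 < ball_vol.
Proof.
have N0 : 0 < n.+1%:R^-1 :> R by rewrite invr_gt0.
have mc := @measurable_cube R n.+1 n.+1%:R^-1.
have mb := measurable_eball 1.
rewrite -lte_fin fineK; last by rewrite ge0_fin_numE //; exact: eball_lty.
apply: (@lt_le_trans _ _ (mu (cube n.+1%:R^-1))).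
  rewrite lebesgue_rV_box; last by move=> i; exact: measurable_itv.
  under eq_bigr do rewrite lebesgue_measure_itv /= lte_fin gtrN ?N0 //.
  elim/big_ind: _ => //; first by move=> *; exact: mule_gt0.
  by move=> i _; rewrite -EFinD lte_fin opprK addr_gt0.
apply: le_measure; rewrite ?inE // => x /cubeP xN; rewrite /eball /=.
rewrite -sqrtr1 ler_sqrt // (@le_trans _ _ (\sum_(i < n.+1) n.+1%:R^-1)) //.
  apply: ler_sum => i _; rewrite -real_normK ?num_real //.
  rewrite -[leRHS]mulr1 expr2; apply: ler_pM => //; apply: le_trans (xN i) _.
  by rewrite invf_le1 // ler1n.
by rewrite sumr_const card_ord -[leLHS]mulr_natr mulVf ?pnatr_eq0.
Qed.

(** Half-open, so that adjacent shells are disjoint and join to a shell. *)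
Definition shell (a b : R) : set E := [set x | a < euclid_norm x <= b].

Lemma shellE a b : shell a b = eball b `\` eball a.
Proof.
apply/seteqP; split => x; rewrite /shell /eball /=.
  by move=> /andP[h1 h2]; split => //; apply/negP; rewrite -ltNge.
by move=> [h1 /negP]; rewrite -ltNge => ->.
Qed.

Lemma measurable_shell a b : measurable (shell a b).
Proof.
rewrite shellE.
by apply: measurableD; exact: measurable_eball.
Qed.

Lemma mu_shell a b : 0 < a -> a <= b ->
  mu (shell a b) = (ball_vol * (b ^+ n.+1 - a ^+ n.+1))%:E.
Proof.
move=> a0 ab.
rewrite shellE.
have b0 : 0 < b by exact: lt_le_trans ab.
have mb := measurable_eball.
rewrite measureD //; last exact: eball_lty.
rewrite setIidr; last by move=> x /= xa; exact: le_trans xa ab.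
rewrite -[X in (X - _)%E]/(mu (eball b)) -[X in (_ - X)%E]/(mu (eball a)).
by rewrite !mu_eball // -EFinB mulrBr.
Qed.

Variables (G Gam : R -> R) (a0 : R).
Hypothesis a00 : 0 < a0.
Hypothesis cG : continuous G.
Hypothesis dGam : forall t, a0 < t -> has_deriv Gam t (t ^+ n * G t).

Let g (x : E) : R := G (euclid_norm x).

Let cg : continuous g.
Proof.
by move=> x; apply: continuous_comp; [exact: continuous_euclid_norm|exact: cG].
Qed.

Lemma radial_integrable a b : mu.-integrable (shell a b) (EFin \o g).
Proof.
apply: (@integrableS _ _ _ _ (eball b)).
- exact: measurable_eball.
- exact: measurable_shell.
- by move=> x /= /andP[].
apply: measurable_bounded_integrable.
- exact: measurable_eball.
- exact: eball_lty.
- exact: continuous_measurable_rV.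
have [M M0 hM] := continuous_bounded_on (@compact_eball b) cg.
exists M; split; first exact: num_real.
by move=> y My x Kx; apply: le_trans (hM _ Kx) (ltW My).
Qed.

Let J (t : R) : R := \int[mu]_(x in shell a0 t) g x.

Lemma J_diff t t' : a0 <= t -> t <= t' -> J t' - J t = \int[mu]_(x in shell t t') g x.
Proof.
move=> at0 tt'; rewrite /J (_ : shell a0 t' = shell a0 t `|` shell t t').
  rewrite Rintegral_setU; first by rewrite addrC addKr.
  - exact: measurable_shell.
  - exact: measurable_shell.
  - rewrite (_ : _ `|` _ = shell a0 t'); first exact: radial_integrable.
    apply/seteqP; split => x /=; rewrite /shell /=; first by case=> /andP[]; lra.
    by move=> /andP[]; case: (leP (euclid_norm x) t); [left|right]; lra.
  - apply/disj_setPS => x []; rewrite /shell /=; lra.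
apply/seteqP; split => x /=; rewrite /shell /=; last by case=> /andP[]; lra.
by move=> /andP[]; case: (leP (euclid_norm x) t); [left|right]; lra.
Qed.

Lemma J_bound t t' m e : a0 <= t -> t <= t' -> (forall z, t <= z <= t' -> `|G z - m| <= e) ->
  `|J t' - J t - m * (ball_vol * (t' ^+ n.+1 - t ^+ n.+1))| <=
    e * (ball_vol * (t' ^+ n.+1 - t ^+ n.+1)).
Proof.
move=> at0 tt' hm; have t0 : 0 < t by exact: lt_le_trans at0.
have mS := measurable_shell t t'.
have fS : fine (mu (shell t t')) = ball_vol * (t' ^+ n.+1 - t ^+ n.+1) by rewrite mu_shell.
have ic (k : R) : mu.-integrable (shell t t') (EFin \o (fun=> k)).
  apply: measurable_bounded_integrable => //.
  - by rewrite mu_shell // ltry.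
  exists `|k|; split; first exact: num_real.
  by move=> y My x Kx; exact: ltW.
have ig := radial_integrable t t'.
have cstE (k : R) : \int[mu]_(x in shell t t') k = k * (ball_vol * (t' ^+ n.+1 - t ^+ n.+1)).
  by rewrite -fS Rintegral_cst.
rewrite J_diff // -!cstE -RintegralB //.
apply: (le_trans (le_normr_Rintegral mS _)).
  have := integrableB mS ig (ic m); apply: eq_integrable => // x _ /=; by rewrite EFinB.
apply: le_Rintegral => //.
  have := integrableB mS ig (ic m) => /integrable_abse; apply: eq_integrable => // x _ /=.
by move=> x /= /andP[tx xt]; apply: hm; rewrite (ltW tx).
Qed.

(** Polar coordinates without a change of variables: on a thin shell [G] is nearly constant, so [J]
    varies like G(t) times the ball volume [W], which is known from scaling. *)
Lemma der_J t : a0 < t -> has_deriv J t (ball_vol * n.+1%:R * (t ^+ n * G t)).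
Proof.
move=> at0; have t0 : 0 < t by exact: lt_trans at0.
pose W (s : R) := ball_vol * s ^+ n.+1.
have dW : has_deriv W t (ball_vol * (n.+1%:R * t ^+ n)).
  by rewrite /W; derive_all; rewrite /= ; ring.
have WJ e : 0 < e -> \forall h \near (0 : R),
    `|(J (h + t) - J t) - G t * (W (h + t) - W t)| <= e * `|W (h + t) - W t|.
  move=> e0; have := @cG t => /cvgrPdist_le /(_ _ e0) /nbhs_ballP[d /= d0 hd].
  apply/nbhs_ballP; exists (Num.min d (t - a0)) => /=; first by rewrite lt_min d0 subr_gt0.
  move=> h; rewrite /ball /= sub0r normrN lt_min => /andP[h1 h2].
  have hG z : `|z - t| <= `|h| -> `|G z - G t| <= e.
    move=> zh; rewrite distrC; apply: hd; rewrite /ball /= distrC.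
    exact: le_lt_trans zh h1.
  have ath : a0 <= h + t by move: h2; rewrite ltr_norml; lra.
  have Wmono s s' : 0 <= s -> s <= s' -> 0 <= W s' - W s.
    move=> s0 ss; rewrite /W -mulrBr mulr_ge0 ?(ltW ball_vol_gt0) //.
    by rewrite subr_ge0 lerXn2r // nnegrE // (le_trans s0).
  case: (leP 0 h) => hs.
    have tht : t <= h + t by lra.
    have := @J_bound t (h + t) (G t) e (ltW at0) tht.
    rewrite mulrBr -/(W t) -/(W (h + t)) (ger0_norm (Wmono _ _ (ltW t0) tht)); apply.
    move=> z tz; apply: hG; rewrite (ger0_norm hs) ger0_norm; lra.
  have tht : h + t <= t by lra.
  have ht0 : 0 <= h + t by exact: le_trans (ltW a00) ath.
  have := @J_bound (h + t) t (G t) e ath tht.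
  rewrite mulrBr -/(W t) -/(W (h + t)) (ler0_norm (_ : W (h + t) - W t <= 0)); last first.
    by rewrite -oppr_ge0 opprB Wmono.
  rewrite opprB -normrN => hb; apply: le_trans (hb _); last first.
    by move=> z /andP[z1 z2]; apply: hG; rewrite (ltr0_norm hs) (ler0_norm (_ : z - t <= 0)); lra.
  by rewrite le_eqVlt; apply/orP; left; apply/eqP; congr `|_|; ring.
have [/cvg_ex[l hl] dE] := dW.
have lE : l = ball_vol * (n.+1%:R * t ^+ n) by rewrite -dE; apply/esym/cvg_lim.
have lims : h^-1 *: ((J \o shift t) (h *: (1:R)) - J t) @[h --> 0^'] -->
    ball_vol * n.+1%:R * (t ^+ n * G t).
  have -> : ball_vol * n.+1%:R * (t ^+ n * G t) = 0 + G t * l by rewrite lE; ring.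
  rewrite (_ : (fun h => _) = (fun h => h^-1 * ((J (h + t) - J t) - G t * (W (h + t) - W t))
     + G t * (h^-1 *: ((W \o shift t) (h *: (1 : R)) - W t)))); last first.
    by apply/funext => h /=; rewrite [_%:A]mulr1 /GRing.scale /=; ring.
  apply: cvgD; last by apply: cvgM; [exact: cvg_cst|exact: hl].
  apply/cvgrPdist_le => e e0.
  have e1 : 0 < e / (`|l| + 1) by rewrite divr_gt0 // ltr_wpDl.
  near=> h.
  rewrite sub0r normrN normrM.
  have l1 : `|h^-1 *: ((W \o shift t) (h *: (1 : R)) - W t)| <= `|l| + 1.
    near: h; have /cvgrPdist_le/(_ _ ltr01) := hl; apply: filterS => h hh.
    rewrite -[X in `|X|](subrK l) addrC; apply: (le_trans (ler_normD _ _)).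
    by rewrite lerD2l distrC.
  rewrite /= [_%:A]mulr1 normrM in l1.
  have : `|(J (h + t) - J t) - G t * (W (h + t) - W t)| <=
     e / (`|l| + 1) * `|W (h + t) - W t|.
    near: h; exact: (nbhs_dnbhs (WJ _ e1)).
  move=> /(ler_wpM2l (normr_ge0 h^-1))/le_trans; apply.
  rewrite mulrCA mulrAC -[leRHS]mulr1 -mulrA; apply: ler_wpM2l; first exact: ltW.
  by rewrite ler_pdivrMr ?mul1r // ltr_wpDl.
split; first by apply/cvg_ex; eexists; exact: lims.
by apply: cvg_lim.
Unshelve. all: by end_near. Qed.

Lemma radial_integral a b : a0 < a -> a <= b ->
  \int[mu]_(x in shell a b) G (euclid_norm x) = ball_vol * n.+1%:R * (Gam b - Gam a).
Proof.
move=> aa ab; rewrite -J_diff ?(ltW aa) //.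
set k := ball_vol * n.+1%:R.
have dd t : a0 < t -> has_deriv (fun t => J t - k * Gam t) t 0.
  by move=> at0; have h1 := der_J at0; have h2 := dGam at0; derive_all; rewrite /k; ring.
have cc : {within `[a, b], continuous (fun t => J t - k * Gam t)}.
  apply: derivable_within_continuous => x; rewrite in_itv /= => /andP[ax _].
  by have [] := dd x (lt_le_trans aa ax).
have h1 := @derive_ge0_le _ _ (fun=> 0) a b ab cc (fun t ht => dd t (lt_trans aa (proj1 (andP ht))))
  (fun _ _ => lexx 0).
have h2 := @derive_le0_ge _ _ (fun=> 0) a b ab cc (fun t ht => dd t (lt_trans aa (proj1 (andP ht))))
  (fun _ _ => lexx 0).
rewrite mulrBr; lra.
Qed.

End shells.

(** * Truncated critical powers *)

Lemma has_deriv_near {R : realType} (f g : R -> R) (x a : R) :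
  (\forall y \near x, f y = g y) -> has_deriv f x a -> has_deriv g x a.
Proof. by move=> fg; apply: near_eq_is_derive. Qed.

Lemma has_deriv_unique {R : realType} (f : R -> R) (x a b : R) :
  has_deriv f x a -> has_deriv f x b -> a = b.
Proof. by move=> [_ <-] [_ <-]. Qed.

Section smooth_step.
Context {R : realType}.

(** The functions p(1/t) e^(-1/t), extended by 0, are closed under differentiation; carrying the
    polynomial along makes smoothness an induction for all p at once. *)
Definition flat_exp (p : {poly R}) (t : R) : R :=
  if 0 < t then p.[t^-1] * expR (- t^-1) else 0.

(** The exponential beats every power of 1/t; a quadratic bound is what makes the derivative at 0
    exist and vanish. *)
Lemma flat_exp_bound (p : {poly R}) : exists2 C : R, 0 <= C &
  forall t, 0 < t <= 1 -> `|flat_exp p t| <= C * t ^+ 2.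
Proof.
pose S := \sum_(i < size p) `|p`_i|; pose m := size p.
have S0 : 0 <= S by exact: sumr_ge0.
exists (S * (m.+2)`!%:R) => [|t /andP[t0 t1]]; first by rewrite mulr_ge0.
rewrite /flat_exp t0; set y := t^-1.
have y0 : 0 < y by rewrite invr_gt0.
have y1 : 1 <= y by rewrite invf_ge1.
have py : `|p.[y]| <= S * y ^+ m.
  rewrite horner_coef mulr_suml; apply: (le_trans (ler_norm_sum _ _ _)).
  apply: ler_sum => i _; rewrite normrM (ger0_norm (exprn_ge0 i (ltW y0))).
  apply: ler_wpM2l => //; apply: ler_weXn2l => //; exact: ltnW (ltn_ord i).
have ey : expR (- y) <= (m.+2)`!%:R * t ^+ m.+2.
  have tp : 0 < t ^+ m.+2 by exact: exprn_gt0.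
  have ft : 0 < (m.+2)`!%:R * t ^+ m.+2 by rewrite mulr_gt0 // ltr0n fact_gt0.
  rewrite expRN invf_ple ?posrE ?expR_gt0 //.
  have := @expR_ge1Dxn R y m.+1 (ltW y0).
  rewrite invfM -exprVn -/y mulrC; lra.
rewrite normrM (gtr0_norm (expR_gt0 _)).
apply: (le_trans (ler_pM _ (expR_ge0 _) py ey)) => //.
rewrite le_eqVlt; apply/orP; left; apply/eqP.
rewrite -[m.+2]addn2 exprD /y exprVn; field.
by rewrite expf_neq0 // lt0r_neq0.
Qed.

(** With y = 1/t one has dy/dt = - y^2, and p(y) e^(-y) has the y-derivative (p' - p)(y) e^(-y). *)
Definition flat_deriv (p : {poly R}) : {poly R} := 'X^2 * (p - p^`()).

Lemma der_flat_exp p t : has_deriv (flat_exp p) t (flat_exp (flat_deriv p) t).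
Proof.
have [t0|t0|->] := ltgtP t 0.
- rewrite [X in has_deriv _ _ X]/flat_exp ltNge (ltW t0) /=.
  apply: (@has_deriv_near _ (fun=> 0)); last exact: der_cst.
  near=> s; rewrite /flat_exp ltNge (_ : s <= 0) //.
  by apply: ltW; near: s; exact: lt_nbhsl.
- apply: (@has_deriv_near _ (fun s => p.[s^-1] * expR (- s^-1))).
    by near=> s; rewrite /flat_exp ifT //; near: s; exact: lt_nbhsr.
  have tn0 : t != 0 by rewrite gt_eqF.
  have h1 : has_deriv (fun s : R => s^-1) t (- t ^- 2).
    by apply: der_eq; first exact: der_inv tn0 (der_id _); rewrite mulr1.
  have h2 : has_deriv (fun s => p.[s^-1]) t (p^`().[t^-1] * - t ^- 2).
    apply: der_comp h1 _; exact: is_derive_poly.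
  derive_all; rewrite /flat_exp t0 /flat_deriv hornerM hornerXn hornerD hornerN; field.
  exact: tn0.
- have [C C0 hC] := flat_exp_bound p.
  have F0 q : flat_exp q 0 = 0 by rewrite /flat_exp ltxx.
  rewrite F0.
  have lim0 : h^-1 *: ((flat_exp p \o shift 0) (h *: (1 : R)) - flat_exp p 0) @[h --> 0^'] --> (0 : R).
    apply/cvgrPdist_le => e e0; near=> h.
    rewrite F0 subr0 sub0r normrN /= addr0 [_%:A]mulr1.
    have hn0 : h != 0 by near: h; exact: nbhs_dnbhs_neq.
    have h1 : `|h| < 1 by near: h; apply: dnbhs0_lt.
    have h2 : `|h| < e / (C + 1) by near: h; apply: dnbhs0_lt; rewrite divr_gt0 // ltr_wpDl.
    rewrite normrM normfV ler_pdivrMl ?normr_gt0 //.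
    case: (leP h 0) => hs.
      by rewrite /flat_exp ltNge hs /= normr0 mulr_ge0 // ltW.
    rewrite (gtr0_norm hs) in h1 h2 *; have := hC h; rewrite hs (ltW h1) => /(_ isT) /le_trans; apply.
    have : h * (C + 1) < e by rewrite -ltr_pdivlMr // ltr_wpDl.
    nra.
  split; first by apply/cvg_ex; exists 0; exact: lim0.
  by apply: cvg_lim.
Unshelve. all: by end_near. Qed.

Lemma C1k_flat_exp k p : C1k k (flat_exp p).
Proof.
elim: k p => [|k IHk] p; last exact: C1kS (der_flat_exp p) (IHk _).
by move=> x; exact: der_continuous (der_flat_exp p x).
Qed.

Let rho := flat_exp 1.

Let rho_ge0 t : 0 <= rho t.
Proof. by rewrite /rho /flat_exp; case: ifP => // _; rewrite hornerE mul1r expR_ge0. Qed.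

Let rho_gt0 t : 0 < t -> 0 < rho t.
Proof. by rewrite /rho /flat_exp => ->; rewrite hornerE mul1r expR_gt0. Qed.

Let rho_eq0 t : t <= 0 -> rho t = 0.
Proof. by rewrite /rho /flat_exp ltNge => ->. Qed.

Let den_gt0 t : 0 < rho t + rho (1 - t).
Proof.
case: (ltP 0 t) => t0; first by rewrite ltr_pwDl ?rho_gt0.
by rewrite ltr_wpDl // rho_gt0 //; lra.
Qed.

Definition smooth_step (t : R) : R := rho t / (rho t + rho (1 - t)).

Lemma C1k_smooth_step k : C1k k smooth_step.
Proof.
have c1 : C1k k (fun t : R => rho (1 - t)).
  apply: C1k_comp; first exact: C1k_flat_exp.
  apply: C1kD; first exact: C1k_cst.
  exact: C1kN (C1k_id k).
apply: C1kM; first exact: C1k_flat_exp.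
apply: C1k_inv; first by move=> x; rewrite lt0r_neq0 // den_gt0.
by apply: C1kD => //; exact: C1k_flat_exp.
Qed.

Lemma smooth_step0 t : t <= 0 -> smooth_step t = 0.
Proof. by move=> t0; rewrite /smooth_step rho_eq0 // mul0r. Qed.

Lemma smooth_step1 t : 1 <= t -> smooth_step t = 1.
Proof.
move=> t1; rewrite /smooth_step [rho (1 - t)]rho_eq0 ?addr0; last lra.
by rewrite divff // lt0r_neq0 // rho_gt0 //; lra.
Qed.

Lemma smooth_step_ge0 t : 0 <= smooth_step t.
Proof. by rewrite divr_ge0 // ltW. Qed.

Lemma smooth_step_le1 t : smooth_step t <= 1.
Proof. by rewrite ler_pdivrMr // mul1r lerDl. Qed.

End smooth_step.

Lemma has_deriv_locally_cst {R : realType} (f : R -> R) (x c d : R) :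
  (\forall y \near x, f y = c) -> has_deriv f x d -> d = 0.
Proof.
move=> fc hd; apply: has_deriv_unique hd _.
by apply: (@has_deriv_near _ (fun=> c)); [apply: filterS fc|exact: der_cst].
Qed.

Section cutoff.
Context {R : realType}.

Definition cutoff (s : R) : R := smooth_step (s - 1).

Lemma C1k_cutoff k : C1k k cutoff.
Proof.
apply: C1k_comp; first exact: C1k_smooth_step.
by apply: C1kD; [exact: C1k_id|exact: C1k_cst].
Qed.

Lemma cutoff_derivs : exists chi1 chi2 : R -> R, exists2 M : R, 0 <= M &
  [/\ forall s, has_deriv cutoff s (chi1 s), forall s, has_deriv chi1 s (chi2 s),
    forall s, s < 1 \/ 2 < s -> chi1 s = 0 /\ chi2 s = 0,
    forall s, `|s * chi1 s| <= M & forall s, `|s ^+ 2 * chi2 s| <= M].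
Proof.
have [_ [c1 d1 [cc1 [c2 d2 cc2]]]] := C1k_cutoff 2.
have z1 s : s < 1 \/ 2 < s -> c1 s = 0.
  case=> hs.
    apply: (has_deriv_locally_cst (c := 0) _ (d1 s)); near=> t.
    rewrite /cutoff smooth_step0 // subr_le0 ltW //; near: t; exact: lt_nbhsl.
  apply: (has_deriv_locally_cst (c := 1) _ (d1 s)); near=> t.
  rewrite /cutoff smooth_step1 // lerBrDr ltW //; near: t; exact: lt_nbhsr.
have z2 s : s < 1 \/ 2 < s -> c2 s = 0.
  move=> hs; apply: (has_deriv_locally_cst (c := 0) _ (d2 s)).
  case: hs => hs.
    by near=> t; apply: z1; left; near: t; exact: lt_nbhsl.
  by near=> t; apply: z1; right; near: t; exact: lt_nbhsr.
have bnd (f : R -> R) : continuous f -> (forall s, s < 1 \/ 2 < s -> f s = 0) ->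
    exists2 M, 0 <= M & forall s, `|f s| <= M.
  move=> cf f0; have /compact_bounded[M [_ hM]] : compact (f @` `[1, 2]%classic).
    apply: continuous_compact; first exact: continuous_subspaceT.
    exact: segment_compact.
  exists (`|M| + 1) => [|s]; first by rewrite addr_ge0.
  case: (ltP s 1) => s1; first by rewrite f0 ?normr0 ?addr_ge0 //; left.
  case: (ltP 2 s) => s2; first by rewrite f0 ?normr0 ?addr_ge0 //; right.
  apply: (hM (`|M| + 1)); last by exists s => //=; rewrite in_itv /= s1.
  by apply: le_lt_trans (ler_norm _) _; rewrite ltrDl.
have [M1 M10 hM1] : exists2 M, 0 <= M & forall s, `|s * c1 s| <= M.
  apply: bnd; first by cts_all.
  by move=> s hs; rewrite z1 // mulr0.
have [M2 M20 hM2] : exists2 M, 0 <= M & forall s, `|s ^+ 2 * c2 s| <= M.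
  apply: bnd; first by cts_all.
  by move=> s hs; rewrite z2 // mulr0.
exists c1, c2, (M1 + M2); first exact: addr_ge0.
split => // s; first by move=> hs; split; [exact: z1|exact: z2].
  by apply: (le_trans (hM1 s)); rewrite lerDl.
by apply: (le_trans (hM2 s)); rewrite lerDr.
Unshelve. all: by end_near. Qed.

Lemma cutoff0 s : s <= 1 -> cutoff s = 0.
Proof. by move=> s1; rewrite /cutoff smooth_step0 // subr_le0. Qed.

Lemma cutoff1 s : 2 <= s -> cutoff s = 1.
Proof. by move=> s1; rewrite /cutoff smooth_step1 //; lra. Qed.

Lemma cutoff_ge0 s : 0 <= cutoff s. Proof. exact: smooth_step_ge0. Qed.

Lemma cutoff_le1 s : cutoff s <= 1. Proof. exact: smooth_step_le1. Qed.

End cutoff.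

Section radial_test_profile.
Context {R : realType} (m : nat).

(* r ^- (m+1)/2, as a function of s = r ^ 2; in dimension N = m + 5 this is the
   critical exponent (N - 4) / 2 of the Hardy-Rellich inequality. *)
Let al : R := m.+1%:R / 4.
Let p (s : R) : R := expR (- al * ln s).

Lemma critical_power_sqr (r : R) : 0 < r -> p (r ^+ 2) ^+ 2 = r ^- m.+1.
Proof.
move=> r0; rewrite /p -expRM_natl lnXn //.
rewrite (_ : 2 * _ = - (m.+1%:R * ln r)); last first.
  by rewrite /al -mulr_natl; field.
by rewrite expRN expRM_natl lnK.
Qed.

(** The classical Rellich constant: for N = m + 5 the Laplacian of |x|^(-(N-4)/2) is - N (N-4) / 4
    times |x|^(-N/2). *)
Definition hardy_rellich : R := (m.+4.+1%:R * m.+1%:R / 4) ^+ 2.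

(** [f] is a function of s = r^2, so that the test function is smooth at the origin; [L] is its
    Laplacian in these terms. The point is that [C] does not depend on a and b: the truncations cost
    a bounded amount, while the main part grows with ln (b / a). *)
Lemma radial_test_profile : exists2 C : R, 0 <= C & forall a b : R, 0 < a -> a <= b ->
  exists f f1 f2 : R -> R,
  [/\ forall k, C1k k f,
     (forall s, has_deriv f s (f1 s)) /\ (forall s, has_deriv f1 s (f2 s)),
     forall s, s < a ^+ 2 / 2 \/ 4 * b ^+ 2 < s -> f s = 0,
     forall r, a < r -> r <= b -> f (r ^+ 2) ^+ 2 = r ^- m.+1 &
     let L r := 4 * r ^+ 2 * f2 (r ^+ 2) + 2 * m.+4.+1%:R * f1 (r ^+ 2) in
     [/\ forall r, 0 <= r -> r <= a / 2 \/ 2 * b < r -> L r = 0,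
        forall r, a / 2 < r -> L r ^+ 2 <= C ^+ 2 * r ^- m.+4.+1 &
        forall r, a < r -> r <= b -> L r ^+ 2 <= hardy_rellich * r ^- m.+4.+1]].
Proof.
have e5 : m.+4.+1 = (m.+1 + 4)%N by rewrite addn4.
have [x1 [x2 [M M0 [dx1 dx2 x0 Mx1 Mx2]]]] := @cutoff_derivs R.
have al0 : 0 <= al by rewrite /al divr_ge0.
(* Triangle inequality for the expression in [rL], with the cutoffs bounded by 1 and their scaled
   derivatives by [M]. *)
pose C := 4 * (al * (al + 1) + 4 * al * M + 2 * M + 2 * M ^+ 2) + 2 * m.+4.+1%:R * (al + 2 * M).
have C0 : 0 <= C.
  have h1 : 0 <= al * M by exact: mulr_ge0.
  have h2 : 0 <= al * (al + 1) by rewrite mulr_ge0 // addr_ge0.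
  have h3 : 0 <= m.+4.+1%:R * (al + 2 * M) by rewrite mulr_ge0 // addr_ge0 // mulr_ge0.
  have h4 := sqr_ge0 M; rewrite /C; lra.
exists C => //.
move=> a b a0 ab; have b0 : 0 < b by exact: lt_le_trans ab.
(* As [cutoff] varies between 1 and 2, the rise takes place for s in [a^2/2, a^2] and the fall for s
   in [2 b^2, 4 b^2]. *)
pose A := a ^+ 2 / 2; pose B := 2 * b ^+ 2.
have A0 : 0 < A by rewrite /A divr_gt0 // exprn_gt0.
have B0 : 0 < B by rewrite /B mulr_gt0 // exprn_gt0.
(* [h] is smooth, positive, and equal to s beyond A / 2, so [ln (h s)] is smooth on the whole line;
   the first cutoff vanishes up to A and hides the change. *)
pose T s := smooth_step (4 / A * s - 1).
pose h s := s * T s + (1 - T s) * A.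
have h0 s : 0 < h s.
  rewrite /h; have t0 := smooth_step_ge0 (4 / A * s - 1); have t1 := smooth_step_le1 (4 / A * s - 1).
  rewrite -/(T s) in t0 t1.
  case: (ltP 0 s) => s0; last first.
    rewrite /T smooth_step0 ?mulr0 ?add0r ?subr0 ?mul1r //.
    by rewrite subr_le0 (le_trans _ ler01) // pmulr_rle0 // divr_gt0.
  have [->|tn] := eqVneq (T s) 0; first by rewrite mulr0 add0r subr0 mul1r.
  have tp : 0 < T s by rewrite lt_def tn.
  by apply: ltr_pwDl; [exact: mulr_gt0|rewrite mulr_ge0 ?subr_ge0 // ltW].
have hE s : A / 2 < s -> h s = s.
  move=> sA; rewrite /h /T smooth_step1; first by rewrite mulr1 subrr mul0r addr0.
  have : 2 <= 4 / A * s by rewrite mulrAC ler_pdivlMr //; lra.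
  lra.
pose f s := expR (- al * ln (h s)) * cutoff (A^-1 * s) * (1 - cutoff (B^-1 * s)).
have cS k (c : R) : C1k k (fun s => cutoff (c * s)).
  by apply: C1k_comp; [exact: C1k_cutoff|apply: C1kM; [exact: C1k_cst|exact: C1k_id]].
have cf k : C1k k f.
  have cT : C1k k T.
    apply: C1k_comp; first exact: C1k_smooth_step.
    by apply: C1kD; [apply: C1kM; [exact: C1k_cst|exact: C1k_id]|exact: C1k_cst].
  have ch : C1k k h.
    apply: C1kD; first by apply: C1kM => //; exact: C1k_id.
    apply: C1kM; last exact: C1k_cst.
    by apply: C1kD; [exact: C1k_cst|exact: C1kN].
  apply: C1kM; last by apply: C1kD; [exact: C1k_cst|exact: C1kN].
  apply: C1kM => //; apply: C1k_comp; first exact: C1k_expR.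
  by apply: C1kM; [exact: C1k_cst|exact: C1k_ln].
have f0 s : s <= A \/ 2 * B < s -> f s = 0.
  case=> hs; rewrite /f.
    by rewrite [cutoff (A^-1 * _)]cutoff0 ?mulr0 ?mul0r // ler_pdivrMl // mulr1.
  by rewrite [cutoff (B^-1 * _)]cutoff1 ?subrr ?mulr0 // ler_pdivlMl // mulrC ltW.
have [_ [f1 df1 [cf1 [f2 df2 _]]]] := cf 2.
have z1 s : s < A \/ 2 * B < s -> f1 s = 0.
  move=> hs; apply: (has_deriv_locally_cst (c := 0) _ (df1 s)).
  case: hs => hs.
    by near=> t; apply: f0; left; apply: ltW; near: t; exact: lt_nbhsl.
  by near=> t; apply: f0; right; near: t; exact: lt_nbhsr.
have z2 s : s < A \/ 2 * B < s -> f2 s = 0.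
  move=> hs; apply: (has_deriv_locally_cst (c := 0) _ (df2 s)).
  case: hs => hs.
    by near=> t; apply: z1; left; near: t; exact: lt_nbhsl.
  by near=> t; apply: z1; right; near: t; exact: lt_nbhsr.
pose c s := cutoff (A^-1 * s); pose d s := 1 - cutoff (B^-1 * s).
have dc s : has_deriv c s (x1 (A^-1 * s) * A^-1).
  rewrite /c; apply: der_comp (dx1 _).
  by derive_all; ring.
have dc1 s : has_deriv (fun s => x1 (A^-1 * s) * A^-1) s (x2 (A^-1 * s) * A^-1 * A^-1).
  have : has_deriv (fun s => x1 (A^-1 * s)) s (x2 (A^-1 * s) * A^-1).
    by apply: der_comp (dx2 _); derive_all; ring.
  by move=> h1; derive_all; ring.
have dd s : has_deriv d s (- (x1 (B^-1 * s) * B^-1)).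
  have : has_deriv (fun s => cutoff (B^-1 * s)) s (x1 (B^-1 * s) * B^-1).
    by apply: der_comp (dx1 _); derive_all; ring.
  by move=> h1; rewrite /d; derive_all; ring.
have dd1 s : has_deriv (fun s => - (x1 (B^-1 * s) * B^-1)) s (- (x2 (B^-1 * s) * B^-1 * B^-1)).
  have : has_deriv (fun s => x1 (B^-1 * s)) s (x2 (B^-1 * s) * B^-1).
    by apply: der_comp (dx2 _); derive_all; ring.
  by move=> h1; derive_all; ring.
have dp s : 0 < s -> has_deriv p s (- al * s^-1 * p s).
  move=> s0; have hl : has_deriv (@ln R) s s^-1 by exact: is_derive1_ln.
  by rewrite /p; derive_all; ring.
have A20 : 0 < A / 2 by rewrite divr_gt0.
have fE s : A / 2 < s -> f s = p s * c s * d s.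
  by move=> sA; rewrite /f hE.
pose F1 s := - al * s^-1 * p s * c s * d s + p s * (x1 (A^-1 * s) * A^-1) * d s
   + p s * c s * (- (x1 (B^-1 * s) * B^-1)).
have f1E s : A / 2 < s -> f1 s = F1 s.
  move=> sA; have s0 : 0 < s by exact: lt_trans sA.
  apply: (has_deriv_unique (df1 s)).
  apply: (@has_deriv_near _ (fun s => p s * c s * d s)).
    by near=> t; rewrite fE //; near: t; exact: lt_nbhsr.
  have h1 := dp _ s0; have h2 := dc s; have h3 := dd s.
  by derive_all; rewrite /F1; ring.
pose X1 s := A^-1 * s * x1 (A^-1 * s); pose X2 s := (A^-1 * s) ^+ 2 * x2 (A^-1 * s).
pose Y1 s := - (B^-1 * s * x1 (B^-1 * s)); pose Y2 s := - ((B^-1 * s) ^+ 2 * x2 (B^-1 * s)).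
have sf1 s : A / 2 < s -> s * f1 s = p s * (- al * c s * d s + X1 s * d s + c s * Y1 s).
  move=> sA; have s0 : 0 < s by exact: lt_trans sA.
  by rewrite f1E // /F1 /X1 /Y1; field; rewrite !lt0r_neq0.
have sf2 s : A / 2 < s -> s ^+ 2 * f2 s = p s * (al * (al + 1) * c s * d s
   - 2 * al * (X1 s * d s + c s * Y1 s) + X2 s * d s + 2 * X1 s * Y1 s + c s * Y2 s).
  move=> sA; have s0 : 0 < s by exact: lt_trans sA.
  have -> : f2 s = al * (al + 1) * s ^- 2 * p s * c s * d s
     - 2 * al * s^-1 * p s * (x1 (A^-1 * s) * A^-1 * d s - c s * (x1 (B^-1 * s) * B^-1))
     + p s * (x2 (A^-1 * s) * A^-1 * A^-1) * d s
     - 2 * p s * (x1 (A^-1 * s) * A^-1) * (x1 (B^-1 * s) * B^-1)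
     - p s * c s * (x2 (B^-1 * s) * B^-1 * B^-1).
    apply: (has_deriv_unique (df2 s)).
    apply: (@has_deriv_near _ F1).
      by near=> t; rewrite f1E //; near: t; exact: lt_nbhsr.
    have h1 := dp _ s0; have h2 := dc s; have h3 := dd s; have h4 := dc1 s; have h5 := dd1 s.
    have hi : has_deriv (fun t : R => t^-1) s (- s ^- 2 * 1).
      exact: der_inv (lt0r_neq0 s0) (der_id _).
    rewrite /F1; derive_all.
    by field; rewrite !lt0r_neq0.
  by rewrite /X1 /X2 /Y1 /Y2; field; rewrite !lt0r_neq0.
have bX1 s : `|X1 s| <= M by exact: Mx1.
have bX2 s : `|X2 s| <= M by exact: Mx2.
have bY1 s : `|Y1 s| <= M by rewrite normrN; exact: Mx1.
have bY2 s : `|Y2 s| <= M by rewrite normrN; exact: Mx2.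
have c01 s : 0 <= c s <= 1 by rewrite cutoff_ge0 cutoff_le1.
have d01 s : 0 <= d s <= 1 by rewrite subr_ge0 cutoff_le1 gerBl cutoff_ge0.
have aA r : a / 2 < r -> A / 2 < r ^+ 2.
  move=> ar; rewrite /A (_ : a ^+ 2 / 2 / 2 = (a / 2) ^+ 2); last by field.
  by rewrite ltrXn2r ?nnegrE //; lra.
pose L r := 4 * r ^+ 2 * f2 (r ^+ 2) + 2 * m.+4.+1%:R * f1 (r ^+ 2).
(* Squaring p gives r^-(m+1) and dividing by r^2 gives r^-4, together r^-N. *)
have LE r (z : R) : a / 2 < r -> r ^+ 2 * L r = p (r ^+ 2) * z ->
    L r ^+ 2 = z ^+ 2 * r ^- m.+4.+1.
  move=> ar rL; have r0 : 0 < r by lra.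
  have -> : L r = p (r ^+ 2) * z / r ^+ 2.
    by rewrite -rL mulrC mulKf // expf_neq0 // lt0r_neq0.
  rewrite expr_div_n exprMn critical_power_sqr // e5 exprD; field.
  by rewrite !expf_neq0 // lt0r_neq0.
have rL r : a / 2 < r -> r ^+ 2 * L r = p (r ^+ 2) *
   (4 * (al * (al + 1) * c (r ^+ 2) * d (r ^+ 2)
   - 2 * al * (X1 (r ^+ 2) * d (r ^+ 2) + c (r ^+ 2) * Y1 (r ^+ 2)) + X2 (r ^+ 2) * d (r ^+ 2)
   + 2 * X1 (r ^+ 2) * Y1 (r ^+ 2) + c (r ^+ 2) * Y2 (r ^+ 2))
   + 2 * m.+4.+1%:R * (- al * c (r ^+ 2) * d (r ^+ 2) + X1 (r ^+ 2) * d (r ^+ 2)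
      + c (r ^+ 2) * Y1 (r ^+ 2))).
  move=> ar; rewrite [RHS]mulrDr mulrCA -sf2 ?aA // [X in _ + X]mulrCA -sf1 ?aA //.
  by rewrite /L; ring.
exists f, f1, f2; split => //.
- by move=> s hs; apply: f0; case: hs => hs; [left; exact: ltW|right; rewrite /B; lra].
- move=> r ar rb; have r0 : 0 < r by exact: lt_trans ar.
  have r2 : a ^+ 2 <= r ^+ 2 by rewrite lerXn2r ?nnegrE ?ltW.
  have rb2 : r ^+ 2 <= b ^+ 2 by rewrite lerXn2r // nnegrE ltW.
  rewrite fE; last by apply: aA; lra.
  rewrite /c /d cutoff1 ?cutoff0 ?subr0 ?mulr1 ?critical_power_sqr //.
    by rewrite ler_pdivrMl // mulr1 /B; have := exprn_gt0 2 b0; lra.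
  by rewrite ler_pdivlMl // /A; lra.
- rewrite /= -/L; split.
  + move=> r r0 hr; have h1 : r ^+ 2 < A \/ 2 * B < r ^+ 2.
      case: hr => hr; [left|right].
        apply: (@le_lt_trans _ _ ((a / 2) ^+ 2)); first by rewrite lerXn2r ?nnegrE //; lra.
        by rewrite /A; have := exprn_gt0 2 a0; rewrite expr_div_n; lra.
      rewrite (_ : 2 * B = (2 * b) ^+ 2); last by rewrite /B; ring.
      by rewrite ltrXn2r ?nnegrE // mulr_ge0 // ltW.
    by rewrite /L z1 // z2 // !mulr0 addr0.
  + move=> r ar; rewrite (LE _ _ ar (rL _ ar)); apply: ler_wpM2r.
      by rewrite invr_ge0 exprn_ge0 //; lra.
    set cc := c _; set dd' := d _; set e1 := X1 _; set e2 := X2 _; set g1 := Y1 _; set g2 := Y2 _.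
    have hcc : `|cc| <= 1 by have := c01 (r ^+ 2); rewrite -/cc => /andP[? ?]; rewrite ger0_norm.
    have hdd : `|dd'| <= 1 by have := d01 (r ^+ 2); rewrite -/dd' => /andP[? ?]; rewrite ger0_norm.
    have he1 : `|e1| <= M by exact: bX1.
    have he2 : `|e2| <= M by exact: bX2.
    have hg1 : `|g1| <= M by exact: bY1.
    have hg2 : `|g2| <= M by exact: bY2.
    have prod (x y X Y : R) : `|x| <= X -> `|y| <= Y -> `|x * y| <= X * Y.
      by move=> hx hy; rewrite normrM ler_pM.
    have hcd := prod _ _ _ _ hcc hdd; have he1d := prod _ _ _ _ he1 hdd.
    have hcg1 := prod _ _ _ _ hcc hg1; have he2d := prod _ _ _ _ he2 hdd.
    have he1g := prod _ _ _ _ he1 hg1; have hcg2 := prod _ _ _ _ hcc hg2.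
    rewrite -[leLHS]real_normK ?num_real // lerXn2r ?nnegrE //.
    have n0 : 0 <= m.+4.+1%:R :> R by [].
    have hal : `|al| <= al by rewrite ger0_norm.
    have hal1 : `|al * (al + 1)| <= al * (al + 1) by rewrite ger0_norm // mulr_ge0 // addr_ge0.
    have t1 := prod _ _ _ _ hal1 hcd.
    have hs1 : `|e1 * dd' + cc * g1| <= 2 * M.
      by apply: (le_trans (ler_normD _ _)); lra.
    have t2 := prod _ _ _ _ hal hs1.
    have t3 := prod _ _ _ _ hal hcd.
    rewrite (_ : 4 * _ + _ = 4 * (al * (al + 1) * (cc * dd') - 2 * (al * (e1 * dd' + cc * g1))
       + e2 * dd' + 2 * (e1 * g1) + cc * g2)
       + 2 * (m.+4.+1%:R * ((e1 * dd' + cc * g1) - al * (cc * dd')))); last by ring.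
    have t4 : `|m.+4.+1%:R * ((e1 * dd' + cc * g1) - al * (cc * dd'))| <=
        m.+4.+1%:R * (al + 2 * M).
      apply: prod; first by rewrite ger0_norm.
      by apply: (le_trans (ler_normB _ _)); lra.
    rewrite /C; move: t1 t2 he2d he1g hcg2 t4; rewrite !mul1r !mulr1 -expr2.
    rewrite !ler_norml => /andP[? ?] /andP[? ?] /andP[? ?] /andP[? ?] /andP[? ?] /andP[? ?].
    by apply/andP; split; lra.
  + move=> r ar rb; have r0 : 0 < r by exact: lt_trans ar.
    have ar2 : a / 2 < r by lra.
    have r2 : a ^+ 2 < r ^+ 2 by rewrite ltrXn2r ?nnegrE ?(ltW a0) ?(ltW r0).
    have rb2 : r ^+ 2 <= b ^+ 2 by rewrite lerXn2r // nnegrE ltW.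
    have sA : 2 < A^-1 * r ^+ 2 by rewrite ltr_pdivlMl // /A; lra.
    have sB : B^-1 * r ^+ 2 < 1.
      by rewrite ltr_pdivrMl // mulr1 /B; have := exprn_gt0 2 b0; lra.
    (* Between the two transition zones c = d = 1 and all cutoff derivatives vanish, which leaves z
       = 4 al (al + 1) - 2 N al = - N (N-4) / 4. *)
    rewrite (LE _ _ ar2 (rL _ ar2)) /X1 /X2 /Y1 /Y2 /c /d.
    have [-> ->] := x0 _ (or_intror sA); have [-> ->] := x0 _ (or_introl sB).
    rewrite cutoff1 ?(ltW sA) // cutoff0 ?(ltW sB) // subr0 !mulr0 !mulr1 !mul0r !oppr0 !addr0.
    apply: ler_wpM2r; first by rewrite invr_ge0 exprn_ge0 // ltW.
    rewrite /hardy_rellich le_eqVlt; apply/orP; left; apply/eqP.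
    by rewrite /al e5 natrD; field.
Unshelve. all: by end_near. Qed.

End radial_test_profile.

(** * Stability outside a compact set and the mass of e^u *)

Section test_functions_sobolev.
Context {R : realType} {n : nat}.
Local Notation E := 'rV[R]_n.
Local Notation mu := (lebesgue_rV R n).
Implicit Types (D : set E) (psi : E -> R).

(** The derivative of [psi * chi] vanishes off the support of [psi], so its integral over D is one
    over the whole space, where [integral_partial_eq0] applies. *)
Lemma test_weak_partial D psi i : measurable D -> test_function D psi ->
  weak_partial D i psi (partial i psi).
Proof.
move=> mD tp; have tdp := test_partial i tp.
split; [exact: test_L2|exact: test_L2|move=> chi tc].
have tdc := test_partial i tc.
have i1 : mu.-integrable D (EFin \o (fun x => psi x * partial i chi x)).
  by apply: L2_mul_integrable => //; exact: test_L2.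
have i2 : mu.-integrable D (EFin \o (fun x => partial i psi x * chi x)).
  by apply: L2_mul_integrable => //; exact: test_L2.
apply/eqP; rewrite -addr_eq0 -RintegralD //; apply/eqP.
have [cpsi [K [cK KD K0]]] := tp; have [cchi _] := tc.
have c1 : is_Ck 1 (fun x => psi x * chi x) by exact: CkM (cpsi 1%N) (cchi 1%N).
have v1 : vanishes_off K (fun x => psi x * chi x) by move=> x nK; rewrite K0 // mul0r.
rewrite -(integral_partial_eq0 i c1 cK v1) Rintegral_mkcond; apply: eq_Rintegral => x _.
have -> : partial i (fun x => psi x * chi x) x = psi x * partial i chi x + partial i psi x * chi x.
  have /has_partialP[_ ->] := has_partialM (has_partial_partial i x (cpsi 1%N))
    (has_partial_partial i x (cchi 1%N)).
  by rewrite addrC.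
rewrite /patch; case: ifPn => // /negP; rewrite inE => nD.
have nK : ~ K x by move=> /KD.
by rewrite K0 // (partial_vanishing i (compact_rV_closed cK) K0 nK) !mul0r addr0.
Qed.

Lemma test_sobolev2 D psi : measurable D -> test_function D psi -> sobolev 2 D psi.
Proof.
move=> mD tp; split=> [|i]; first exact: test_L2.
have tdp := test_partial i tp; exists (partial i psi); first exact: test_weak_partial.
split=> [|j]; first exact: test_L2.
exists (partial j (partial i psi)); first exact: test_weak_partial.
by apply: test_L2 => //; exact: test_partial.
Qed.

Lemma test_sobolev10 D psi : measurable D -> test_function D psi -> sobolev10 D psi.
Proof.
move=> mD tp; exists (fun i => partial i psi); first by move=> i; exact: test_weak_partial.
split=> [|e e0]; first exact: test_L2.
exists psi => //.
have z (f : E -> R) : (\int[mu]_(x in D) ((f x - f x) ^+ 2)%:E = 0)%E.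
  by under eq_integral do rewrite subrr expr0n /=; rewrite integral0.
by rewrite z add0e big1 ?lte_fin // => i _; exact: z.
Qed.

Lemma test_weak_laplacian D psi : measurable D -> test_function D psi ->
  weak_laplacian D psi (laplacian psi).
Proof.
move=> mD tp; exists (fun i => partial i psi), (fun i => partial i (partial i psi)).
split=> // i; split; first exact: test_weak_partial.
by apply: test_weak_partial => //; exact: test_partial.
Qed.

Lemma laplacian_sqnorm (f f1 f2 : R -> R) (x : E) :
  (forall s, has_deriv f s (f1 s)) -> (forall s, has_deriv f1 s (f2 s)) ->
  laplacian (fun y => f (sqnorm y)) x =
  4 * sqnorm x * f2 (sqnorm x) + 2 * n%:R * f1 (sqnorm x).
Proof.
move=> df1 df2.
have h i : partial i (partial i (fun y => f (sqnorm y))) x =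
    4 * f2 (sqnorm x) * x ord0 i ^+ 2 + 2 * f1 (sqnorm x).
  rewrite (_ : partial i (fun y => f (sqnorm y)) = fun y => f1 (sqnorm y) * (2 * y ord0 i)); last first.
    apply/funext => y.
    by have /has_partialP[_ ->] := has_partial_comp (has_partial_sqnorm i y) (df1 (sqnorm y)).
  have h1 := has_partial_comp (has_partial_sqnorm i x) (df2 (sqnorm x)).
  have /has_partialP[_ ->] := has_partialM h1
    (has_partialM (has_partial_cst 2 i x) (has_partial_coord i i x)).
  rewrite eqxx -[true%:R]/(1 : R); ring.
rewrite /laplacian; under eq_bigr do rewrite h.
rewrite big_split /= -mulr_sumr -/(sqnorm x) sumr_const card_ord -mulr_natr; ring.
Qed.

End test_functions_sobolev.

Section shell_estimates.
Context {R : realType} {n : nat}.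
Local Notation E := 'rV[R]_n.+1.
Local Notation mu := (lebesgue_rV R n.+1).

(* max r c, in a form that is continuous by composition. *)
Let reg (c r : R) : R := (r + c + `|r - c|) / 2.

Let regE c r : c <= r -> reg c r = r.
Proof. by move=> cr; rewrite /reg ger0_norm ?subr_ge0 //; field. Qed.

Let reg_gt0 c r : 0 < c -> 0 < reg c r.
Proof.
move=> c0; have := ler_norm (- (r - c)); rewrite normrN /reg => h.
by rewrite divr_gt0 //; lra.
Qed.

Let continuous_reg c k : 0 < c -> continuous (fun r => reg c r ^- k).
Proof.
move=> c0; apply: cts_inv; first by move=> x; rewrite expf_neq0 // lt0r_neq0 // reg_gt0.
apply: cts_exp; apply: cts_mul; last exact: cts_cst.
apply: cts_add; first by cts_all.
move=> x; apply: (@continuous_comp _ _ _ (fun r => r - c) Num.Def.normr); last exact: norm_continuous.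
by apply: cts_add; [exact: cts_id|exact: cts_cst].
Qed.

(** [radial_integral] wants a density continuous at all radii; [reg] removes the singularity of the
    power at 0 without changing it on the shell. *)
Lemma shell_weight_integral (g Gam : R -> R) (k : nat) (a b : R) : 0 < a -> a <= b ->
  continuous g -> (forall t, 0 < t -> has_deriv Gam t (t ^+ n * (g t * t ^- k))) ->
  (forall t, 0 <= g t) ->
  (\int[mu]_(x in shell a b) (g (euclid_norm x) * euclid_norm x ^- k)%:E =
   (@ball_vol R n * n.+1%:R * (Gam b - Gam a))%:E)%E.
Proof.
move=> a0 ab cg dGam g0; have a2 : 0 < a / 2 by rewrite divr_gt0.
have aa : a / 2 < a by lra.
pose G t := g t * reg (a / 2) t ^- k.
have cG : continuous G by apply: cts_mul => //; exact: continuous_reg.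
have dG t : a / 2 < t -> has_deriv Gam t (t ^+ n * G t).
  by move=> at0; rewrite /G regE ?ltW //; apply: dGam; exact: lt_trans at0.
rewrite -(radial_integral a2 cG dG aa ab) /Rintegral fineK; last first.
  have := @radial_integrable R n G cG a b.
  by move=> /integrable_fin_num; apply; exact: measurable_shell.
apply: eq_integral => x; rewrite inE /shell /= => /andP[ax xb].
by rewrite /G regE // ltW // (lt_trans aa).
Qed.

(** |x|^-N is the borderline power: its integral over a shell is the area of the unit sphere times
    ln (b / a). *)
Lemma shell_log_bound (w : E -> R) (k a b : R) : 0 < a -> a <= b -> 0 <= k ->
  continuous w -> (forall x, 0 <= w x) ->
  (forall x, shell a b x -> w x <= k * euclid_norm x ^- n.+1) ->
  (\int[mu]_(x in shell a b) (w x)%:E <=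
    (@ball_vol R n * n.+1%:R * (k * (ln b - ln a)))%:E)%E.
Proof.
move=> a0 ab k0 cw w0 hw; have mS := @measurable_shell R n a b.
have dG t : 0 < t -> has_deriv (fun t => k * ln t) t (t ^+ n * (k * t ^- n.+1)).
  move=> t0; have hl : has_deriv (@ln R) t t^-1 by exact: is_derive1_ln.
  derive_all; rewrite exprS; field.
  by rewrite expf_neq0 // lt0r_neq0.
have := @shell_weight_integral (fun=> k) (fun t => k * ln t) n.+1 a b a0 ab
  (@cts_cst _ _ _) dG (fun _ => k0).
rewrite -mulrBr => <-; apply: ge0_le_integral => //.
- by move=> x _; rewrite lee_fin.
- by apply/measurable_EFinP; exact: continuous_measurable_rV.
- have a2 : 0 < a / 2 by rewrite divr_gt0.
  apply/measurable_EFinP.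
  apply: (@eq_measurable_fun _ _ _ _ _ (fun x => k * reg (a / 2) (euclid_norm x) ^- n.+1)).
    move=> x; rewrite inE => /andP[ax _]; rewrite regE //; lra.
  apply: continuous_measurable_rV; apply: cts_mul; first exact: cts_cst.
  move=> x; apply: (@continuous_comp _ _ _ (@euclid_norm R n.+1) (fun r => reg (a / 2) r ^- n.+1)).
    exact: continuous_euclid_norm.
  exact: continuous_reg.
Qed.

End shell_estimates.

Section stability_mass.
Context {R : realType} (m : nat).
Local Notation E := 'rV[R]_(m.+4.+1).
Local Notation mu := (lebesgue_rV R m.+4.+1).
Variables (b : R) (U A V B : R -> R) (u : E -> R).
Hypothesis P : profile m.+4 b U A V B.
Hypothesis uE : forall x, u x = U (euclid_norm x).

(** With phi^2 = |x|^-(N-4) on the shell, the left side of the stability inequality controls the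
    increment of [mass], since r^(N-1) r^-(N-4) = r^3. On the right the main part gives
    [hardy_rellich] times the logarithm, and each transition zone, of ratio 2, at most C^2 ln 2. *)
Lemma stable_outside_mass (K : set E) : compact K -> stability_inequality u (~` K) ->
  exists2 r0 : R, 0 < r0 & exists2 C : R, 0 <= C & forall r s, r0 <= r -> r <= s ->
    mass m U A V B s - mass m U A V B r <= hardy_rellich m * (ln s - ln r) + C.
Proof.
move=> cK stab; have [M M0 KM] := compact_sub_cube cK.
have mD : measurable (~` K) by apply: measurableC; exact: compact_measurable_rV.
have [C C0 test] := @radial_test_profile R m.
(* On the cube containing K one has |x|^2 <= N M^2 < a^2 / 2 for a >= r0, so K misses the support of
   the test function; the + 1 keeps r0 positive when M = 0. *)
pose r0 : R := 2 * (m.+4.+1%:R * M + 1).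
have NM0 : 0 <= m.+4.+1%:R * M by exact: mulr_ge0.
have r00 : 0 < r0 by rewrite /r0; lra.
exists r0 => //; exists (2 * (C ^+ 2 * ln 2)).
  by rewrite !mulr_ge0 ?sqr_ge0 // ln_ge0 // ler1n.
move=> a c ra ac; have a0 : 0 < a by exact: lt_le_trans ra.
have c0 : 0 < c by exact: lt_le_trans ac.
have [f [f1 [f2 [cf [df1 df2] f0 flat [L0 Lall Lflat]]]]] := test a c a0 ac.
pose phi (x : E) : R := f (sqnorm x).
have sqK x : K x -> sqnorm x < a ^+ 2 / 2.
  move=> /KM/cubeP xM; apply: (@le_lt_trans _ _ (m.+4.+1%:R * M ^+ 2)).
    rewrite /sqnorm (@le_trans _ _ (\sum_(i < m.+4.+1) M ^+ 2)) //.
      by apply: ler_sum => i _; rewrite -real_normK ?num_real // lerXn2r ?nnegrE.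
    by rewrite sumr_const card_ord mulr_natl lexx.
  have h1 : r0 ^+ 2 <= a ^+ 2 by rewrite lerXn2r ?nnegrE ?(ltW r00) ?(ltW a0).
  have N1 : 1 <= m.+4.+1%:R :> R by rewrite ler1n.
  have h2 : m.+4.+1%:R * M ^+ 2 <= (m.+4.+1%:R * M) ^+ 2.
    rewrite exprMn; apply: ler_wpM2r; first exact: sqr_ge0.
    by rewrite expr2 ler_peMr // ler0n.
  have h3 : r0 ^+ 2 = 4 * (m.+4.+1%:R * M) ^+ 2 + 8 * (m.+4.+1%:R * M) + 4 by rewrite /r0; ring.
  have h4 := sqr_ge0 (m.+4.+1%:R * M).
  lra.
have csq : continuous (@sqnorm R m.+4.+1) by exact: (@Ck_sqnorm R m.+4.+1 0).
have tphi : test_function (~` K) phi.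
  split; first by move=> k; apply: Ck_comp; [exact: cf|exact: Ck_sqnorm].
  exists (sqnorm @^-1` `[a ^+ 2 / 2, 4 * c ^+ 2]%classic); split.
  - apply: (@subclosed_compact _ _ (eball (2 * c))) => //.
    + by apply: (continuous_closedP _).1 => //; exact: itv_closed.
    + exact: compact_eball.
    + move=> x /=; rewrite in_itv /= => /andP[_ xc]; rewrite /eball /=.
      rewrite -[2 * c]gtr0_norm ?mulr_gt0 // -sqrtr_sqr ler_sqrt ?sqr_ge0 //.
      by rewrite exprMn -natrX.
  - by move=> x /=; rewrite in_itv /= => /andP[xa _] /sqK; rewrite ltNge xa.
  - move=> x; rewrite /= in_itv /= => /negP; rewrite negb_and -!ltNge => /orP xx.
    by apply: f0; case: xx; [left|right].
have := stab phi (laplacian phi) (test_sobolev2 mD tphi) (test_sobolev10 mD tphi)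
  (test_weak_laplacian mD tphi).
pose L r := 4 * r ^+ 2 * f2 (r ^+ 2) + 2 * m.+4.+1%:R * f1 (r ^+ 2).
have lapE x : laplacian phi x = L (euclid_norm x).
  by rewrite /phi (laplacian_sqnorm x df1 df2) /L euclid_norm_sqr.
have phi_sq x : shell a c x -> phi x ^+ 2 = euclid_norm x ^- m.+1.
  by move=> /andP[ax xc]; rewrite /phi -euclid_norm_sqr flat.
have cphi : continuous phi by exact: test_continuous tphi.
have clap : continuous (laplacian phi).
  by apply: (@Ck_continuous _ _ 0); apply: Ck_sum => i; exact: (((tphi.1 2).2 i).2.2 i).2.
have cu : continuous u.
  rewrite (_ : u = fun x => U (euclid_norm x)); last by apply/funext => x; exact: uE.
  by move=> x; apply: continuous_comp; [exact: continuous_euclid_norm|exact: (cU P)].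
have mlap2 D : measurable_fun D (fun x => (laplacian phi x ^+ 2)%:E).
  by apply/measurable_EFinP; apply: continuous_measurable_rV; exact: cts_exp.
have lower : ((@ball_vol R m.+4 * m.+4.+1%:R * (mass m U A V B c - mass m U A V B a))%:E <=
    \int[mu]_(x in ~` K) (expR (u x) * phi x ^+ 2)%:E)%E.
  rewrite -(@shell_weight_integral R m.+4 (fun t => expR (U t)) (mass m U A V B) m.+1 a c a0 ac).
  - rewrite (eq_integral (fun x => (expR (u x) * phi x ^+ 2)%:E)); last first.
      by move=> x; rewrite inE => Sx; rewrite uE phi_sq.
    apply: ge0_subset_integral => //.
    + exact: measurable_shell.
    + apply/measurable_EFinP; apply: continuous_measurable_rV; apply: cts_mul.
        exact: cts_expR.
      exact: cts_exp.
    + by move=> x _; rewrite lee_fin mulr_ge0 ?expR_ge0 ?sqr_ge0.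
    + move=> x /andP[ax xc] /sqK; rewrite -euclid_norm_sqr; apply/negP; rewrite -leNgt.
      have : a ^+ 2 <= euclid_norm x ^+ 2 by rewrite lerXn2r ?nnegrE ?euclid_norm_ge0 ?(ltW a0) ?ltW.
      by have := sqr_ge0 a; lra.
  - by apply: cts_expR; exact: (cU P).
  - move=> t t0; apply: der_eq; first exact: (der_mass P).
    rewrite (_ : t ^+ m.+4 = t ^+ 3 * t ^+ m.+1); last by rewrite -exprD.
    by field; rewrite expf_neq0 // lt0r_neq0.
  - by move=> t; exact: expR_ge0.
pose c2 : R := 2 * c.
have ac2 : a / 2 < a by lra.
have cc2 : c <= c2 by rewrite /c2; lra.
have upper : (\int[mu]_(x in ~` K) (laplacian phi x ^+ 2)%:E <=
   (@ball_vol R m.+4 * m.+4.+1%:R * (hardy_rellich m * (ln c - ln a) + 2 * (C ^+ 2 * ln 2)))%:E)%E.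
  have lap0 x : ~ shell (a / 2) c2 x -> laplacian phi x = 0.
    move=> nS; rewrite lapE; apply: L0; first exact: euclid_norm_ge0.
    apply/orP; apply: contra_notT nS; rewrite negb_or -!ltNge -leNgt => /andP[h1 h2].
    by rewrite /shell /= h1.
  apply: (@le_trans _ _ (\int[mu]_(x in shell (a / 2) c2) (laplacian phi x ^+ 2)%:E)%E).
    rewrite integral_mkcond [leRHS]integral_mkcond; apply: ge0_le_integral => //.
    - by move=> x _; apply: erestrict_ge0 => y _; rewrite lee_fin sqr_ge0.
    - exact: ((measurable_restrictT _ mD).1 (@mlap2 _)).
    - exact: ((measurable_restrictT _ (@measurable_shell _ _ _ _)).1 (@mlap2 _)).
    move=> x _; rewrite /patch; case: (boolP (x \in shell (a / 2) c2)) => [_|/negP].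
      by case: ifP => _ //; rewrite lee_fin sqr_ge0.
    by rewrite inE => /lap0 ->; rewrite expr0n /=; case: ifP.
  have sh_split (r s t : R) : r <= s -> s <= t ->
      (\int[mu]_(x in shell r t) (laplacian phi x ^+ 2)%:E =
       \int[mu]_(x in shell r s) (laplacian phi x ^+ 2)%:E +
       \int[mu]_(x in shell s t) (laplacian phi x ^+ 2)%:E)%E.
    move=> rs st; rewrite -ge0_integral_setU //.
    - congr (integral _ _ _); apply/seteqP; split => x /=; rewrite /shell /=.
        by move=> /andP[h1 h2]; case: (leP (euclid_norm x) s) => h; [left|right]; apply/andP.
      by case=> /andP[h1 h2]; apply/andP; split; lra.
    - exact: measurable_shell.
    - exact: measurable_shell.
    - by move=> x _; rewrite lee_fin sqr_ge0.
    - apply/disj_setPS => x []; rewrite /shell /=; lra.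
  rewrite (sh_split (a / 2) a c2) ?(ltW ac2) //; last lra.
  rewrite (sh_split a c c2) //.
  have clap2 : continuous (fun x => laplacian phi x ^+ 2) by exact: cts_exp.
  have lap20 x : 0 <= laplacian phi x ^+ 2 by exact: sqr_ge0.
  have a20 : 0 < a / 2 by rewrite divr_gt0.
  have i1 := @shell_log_bound R m.+4 (fun x => laplacian phi x ^+ 2) (C ^+ 2) (a / 2) a a20 (ltW ac2)
    (sqr_ge0 _) clap2 lap20.
  have i2 := @shell_log_bound R m.+4 (fun x => laplacian phi x ^+ 2) (hardy_rellich m) a c a0 ac
    (sqr_ge0 _) clap2 lap20.
  have i3 := @shell_log_bound R m.+4 (fun x => laplacian phi x ^+ 2) (C ^+ 2) c c2 c0 cc2
    (sqr_ge0 _) clap2 lap20.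
  have ln1 : ln a - ln (a / 2) = ln 2.
    by rewrite ln_div ?posrE // opprB addrC subrK.
  have ln3 : ln c2 - ln c = ln 2.
    by rewrite /c2 lnM ?posrE // addrK.
  apply: (le_trans (leeD (i1 _) (leeD (i2 _) (i3 _)))).
  - by move=> x /andP[h1 _]; rewrite lapE; exact: Lall.
  - by move=> x /andP[h1 h2]; rewrite lapE; exact: Lflat.
  - by move=> x /andP[h1 _]; rewrite lapE; apply: Lall; lra.
  by rewrite ln1 ln3 -!EFinD lee_fin le_eqVlt; apply/orP; left; apply/eqP; ring.
move=> st; have := le_trans lower (le_trans st upper).
by rewrite lee_fin ler_pM2l // mulr_gt0 // ball_vol_gt0.
Qed.

End stability_mass.

(** * The thresholds *)

Lemma fatou_le {d} {T : measurableType d} {R : realType} (mu : {measure set T -> \bar R})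
    (D : set T) (f_ : nat -> T -> \bar R) (f : T -> \bar R) (C : \bar R) : measurable D ->
  (forall k, measurable_fun D (f_ k)) -> (forall k x, D x -> (0 <= f_ k x)%E) ->
  (forall x, D x -> f_ ^~ x @ \oo --> f x) ->
  (forall k, (\int[mu]_(x in D) f_ k x <= C)%E) -> (\int[mu]_(x in D) f x <= C)%E.
Proof.
move=> mD mf f0 ff fC.
rewrite (eq_integral (fun x => limn_einf (f_ ^~ x))); last first.
  by move=> x /set_mem Dx; have [->] := cvg_limn_einf_sup (ff x Dx).
apply: (le_trans (fatou mu mD mf f0)).
rewrite limn_einf_lim; apply: lime_le; first exact: is_cvg_einfs.
apply: nearW => k; apply: le_trans (fC k).
by apply: ereal_inf_lbound; exists k => /=.
Qed.

Section stability_criteria.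
Context {R : realType} {n : nat}.
Local Notation E := 'rV[R]_n.
Local Notation mu := (lebesgue_rV R n).
Implicit Types (u w : E -> R) (D : set E).

Lemma stability_of_weight u D : (5 <= n)%N -> measurable D -> continuous u ->
  (forall x, D x -> expR (u x) <= weight x ^+ 2) -> stability_inequality u D.
Proof.
move=> n5 mD cu uw phi lphi [[mphi _] _] h10 wl.
apply: le_trans (rellich n5 mD h10 wl); apply: ge0_le_integral => //.
- by move=> x _; rewrite lee_fin mulr_ge0 ?expR_ge0 ?sqr_ge0.
- apply/measurable_EFinP; apply: measurable_funM; last exact: measurable_funX.
  by apply: continuous_measurable_rV; exact: cts_expR.
- apply/measurable_EFinP; apply: measurable_funX; apply: measurable_funM => //.
  by apply: continuous_measurable_rV; exact: (@Ck_weight R n 0).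
- move=> x Dx; rewrite lee_fin exprMn; apply: ler_wpM2r; first exact: sqr_ge0.
  exact: uw.
Qed.

Lemma stability_monotone u w D : measurable D -> continuous u -> continuous w ->
  (forall x, w x <= u x) -> stability_inequality u D -> stability_inequality w D.
Proof.
move=> mD cu cw wu su phi lphi h2 h10 wl; apply: le_trans (su _ _ h2 h10 wl).
have [[mphi _] _] := h2.
have mm v : continuous v -> measurable_fun D (fun x => (expR (v x) * phi x ^+ 2)%:E).
  move=> cv; apply/measurable_EFinP; apply: measurable_funM; last exact: measurable_funX.
  by apply: continuous_measurable_rV; exact: cts_expR.
apply: ge0_le_integral => //.
- by move=> x _; rewrite lee_fin mulr_ge0 ?expR_ge0 ?sqr_ge0.
- exact: mm.
- exact: mm.
- by move=> x _; rewrite lee_fin ler_wpM2r ?sqr_ge0 // ler_expR.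
Qed.

(** For a fixed [phi] the right-hand side does not depend on k, so Fatou's lemma keeps the bound. *)
Lemma stability_limit (u_ : nat -> E -> R) u D : measurable D ->
  (forall k, continuous (u_ k)) -> (forall x, u_ k x @[k --> \oo] --> u x) ->
  (forall k, stability_inequality (u_ k) D) -> stability_inequality u D.
Proof.
move=> mD cu uu su phi lphi h2 h10 wl; have [[mphi _] _] := h2.
apply: (@fatou_le _ _ _ _ _ (fun k x => (expR (u_ k x) * phi x ^+ 2)%:E)) => //.
- move=> k; apply/measurable_EFinP; apply: measurable_funM; last exact: measurable_funX.
  by apply: continuous_measurable_rV; exact: cts_expR.
- by move=> k x _; rewrite lee_fin mulr_ge0 ?expR_ge0 ?sqr_ge0.
- move=> x _; apply: cvg_EFin; first exact: nearW.
  apply: cvgM; last exact: cvg_cst.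
  by apply: continuous_cvg; [exact: continuous_expR|exact: uu].
- by move=> k; exact: su h2 h10 wl.
Qed.

Lemma stable_outsideW u : stable u -> stable_outside_compact u.
Proof. by move=> su; exists set0; [exact: compact0|rewrite setC0]. Qed.

End stability_criteria.

Section radial_solutions.
Context {R : realType} {n : nat}.
Local Notation E := 'rV[R]_n.+1.
Hypothesis n4 : (4 <= n)%N.
Implicit Types (u : E -> R).

Let n0 : (0 < n)%N. Proof. exact: leq_trans n4. Qed.

Definition radial_solution u := [/\ solution u, radial u & u 0 = 0].

Definition beta u : R := - laplacian u 0.

Lemma radial_solution_continuous u : radial_solution u -> continuous u.
Proof. by move=> [[cu _] _ _]; exact: Ck_continuous cu. Qed.

Lemma radial_solution_profile u : radial_solution u -> exists U A V B : R -> R,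
  profile n (beta u) U A V B /\ forall x, u x = U (euclid_norm x).
Proof. by move=> [su ru u0]; exact: solution_profile. Qed.

Lemma beta_lower u : radial_solution u -> (2 * n.+1%:R + 1)^-1 <= beta u.
Proof. by move=> /radial_solution_profile[U [A [V [B [P _]]]]]; exact: (beta_ge n0 P). Qed.

Lemma quadratic_decay u U A V B l : profile n (beta u) U A V B ->
  (forall x, u x = U (euclid_norm x)) -> (forall r, 0 <= r -> l <= V r) ->
  forall x, u x <= - (l / (2 * n.+1%:R) * sqnorm x).
Proof.
move=> P uE Vl x; rewrite uE -euclid_norm_sqr mulrAC.
exact: (U_le_of_V P Vl (euclid_norm_ge0 x)).
Qed.

(** The solution of smaller beta has nonnegative [V], so the [V] of the other one is at least the
    gap of the betas, and [quadratic_decay] applies to it. *)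
Lemma beta_lt u w : radial_solution u -> radial_solution w -> beta u < beta w ->
  (forall x, w x <= u x) /\
  (forall x, w x <= - ((beta w - beta u) / (2 * n.+1%:R) * sqnorm x)).
Proof.
move=> su sw uw.
have [U [A [V [B [P uE]]]]] := radial_solution_profile su.
have [U' [A' [V' [B' [P' wE]]]]] := radial_solution_profile sw.
split=> [x|].
  by rewrite uE wE; have [] := compare P P' uw (euclid_norm_ge0 x).
apply: (quadratic_decay P' wE) => r r0.
have [_ h] := compare P P' uw r0.
by apply: (le_trans h); rewrite gerBl (V_ge0 n0 P).
Qed.

(** With s = |x|^2, e^(- 2 s) <= (1 + s)^-2: at rate 2, e^u lies below the squared weight
    everywhere. *)
Lemma decay_stable u (c : R) : 2 <= c -> continuous u ->
  (forall x, u x <= - (c * sqnorm x)) -> stable u.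
Proof.
move=> c2 cu uc; apply: stability_of_weight => // x _.
have s0 := sqnorm_ge0 x; apply: (@le_trans _ _ (expR (2 * - sqnorm x))).
  rewrite ler_expR; apply: (le_trans (uc x)); rewrite mulrN lerN2.
  by apply: ler_wpM2r.
rewrite expRM_natl lerXn2r ?nnegrE ?expR_ge0 ?(ltW (weight_gt0 x)) //.
rewrite expRN /weight lef_pV2 ?posrE ?expR_gt0 ?weight_den_gt0 //.
exact: expR_ge1Dx.
Qed.

Lemma decay_stable_outside u (c : R) : 0 < c -> continuous u ->
  (forall x, u x <= - (c * sqnorm x)) -> stable_outside_compact u.
Proof.
(* e^(c s / 2) >= 1 + c^2 s^2 / 8 is at least 1 + s once s >= 8 / c^2; the + 1 gives r^2 >= r, which
   avoids a square root. *)
move=> c0 cu uc; pose r := 8 / c ^+ 2 + 1.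
have cc : 0 < c ^+ 2 by rewrite exprn_gt0.
have rc : 0 < 8 / c ^+ 2 by rewrite divr_gt0.
exists (eball r); first exact: compact_eball.
apply: stability_of_weight => // [|x].
  by apply: measurableC; exact: measurable_eball.
rewrite /eball /= => /negP; rewrite -ltNge => rx.
have s0 := sqnorm_ge0 x.
have sr : 8 / c ^+ 2 <= sqnorm x.
  rewrite -euclid_norm_sqr expr2; apply: (@le_trans _ _ r); first by rewrite /r; lra.
  apply: (@le_trans _ _ (r * r)); first by rewrite ler_peMr // /r; lra.
  by rewrite ler_pM // ?ltW // /r; lra.
apply: (@le_trans _ _ (expR (2 * - (c * sqnorm x / 2)))).
  rewrite ler_expR; apply: (le_trans (uc x)); rewrite mulrN lerN2; lra.
rewrite expRM_natl lerXn2r ?nnegrE ?expR_ge0 ?(ltW (weight_gt0 x)) //.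
rewrite expRN /weight lef_pV2 ?posrE ?expR_gt0 ?weight_den_gt0 //.
have h : 0 <= c * sqnorm x / 2 by rewrite divr_ge0 // mulr_ge0 // ltW.
have := @expR_ge1Dxn R (c * sqnorm x / 2) 1 h; apply: le_trans.
rewrite lerD2l (_ : (c * sqnorm x / 2) ^+ 2 / 2`!%:R = sqnorm x * (c ^+ 2 * sqnorm x / 8)).
  rewrite ler_peMr // ler_pdivlMr // mul1r mulrC -ler_pdivrMr //.
by rewrite -[2`!]/2%N; field.
Qed.

Lemma beta_eq u w : radial_solution u -> radial_solution w -> beta u = beta w -> u = w.
Proof.
move=> su sw uw.
have [U [A [V [B [P uE]]]]] := radial_solution_profile su.
have [U' [A' [V' [B' [P' wE]]]]] := radial_solution_profile sw.
apply/funext => x; have := continuous_dependence n0 P P' (euclid_norm_ge0 x).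
rewrite uw subrr expr0n /= mul0r -uE -wE => h; apply/eqP.
by rewrite -subr_eq0 -sqrf_eq0 eq_le h sqr_ge0.
Qed.

(** Close betas give solutions that are close at every point, by [continuous_dependence], so
    [stability_limit] applies. *)
Lemma stable_closed u : radial_solution u ->
  (forall e, 0 < e -> exists w, [/\ radial_solution w, stable w & `|beta w - beta u| < e]) ->
  stable u.
Proof.
move=> su happ.
have /choice[w hw] : forall k : nat, exists w, [/\ radial_solution w, stable w &
    `|beta w - beta u| < k.+1%:R^-1].
  by move=> k; apply: happ; rewrite invr_gt0.
have [U [A [V [B [P uE]]]]] := radial_solution_profile su.
apply: (@stability_limit _ _ w) => //.
- by move=> k; have [sw _ _] := hw k; exact: radial_solution_continuous.
- move=> x; apply/cvgrPdist_le => e e0.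
  have cv : k.+1%:R^-1 * expR (euclid_norm x) @[k --> \oo] --> (0 : R).
    rewrite -[X in _ --> X](mul0r (expR (euclid_norm x))).
    by apply: cvgM; [exact: cvg_harmonic|exact: cvg_cst].
  near=> k.
  have ek : k.+1%:R^-1 * expR (euclid_norm x) <= e.
    have : `|0 - k.+1%:R^-1 * expR (euclid_norm x)| <= e by near: k; exact: cvgr_dist_le.
    by rewrite sub0r normrN; apply: le_trans; exact: ler_norm.
  apply: le_trans ek; have [sw _ /ltW bw] := hw k.
  have [U' [A' [V' [B' [P' wE]]]]] := radial_solution_profile sw.
  have := continuous_dependence n0 P P' (euclid_norm_ge0 x); rewrite -uE -wE.
  rewrite expRM_natl -exprMn => h.
  have z0 : 0 <= k.+1%:R^-1 * expR (euclid_norm x) by rewrite mulr_ge0 ?expR_ge0 // invr_ge0.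
  rewrite -(@ler_pXn2r _ 2) ?nnegrE // real_normK ?num_real //; apply: (le_trans h).
  rewrite !exprMn ler_pM2r ?exprn_gt0 ?expR_gt0 //.
  by rewrite -[leLHS]real_normK ?num_real // distrC lerXn2r ?nnegrE // invr_ge0.
- by move=> k; have [_ sw _] := hw k.
Unshelve. all: by end_near. Qed.

End radial_solutions.

(** This is where N <= 12 is decided, by one numerical check for each N from 5 to 12. *)
Lemma hardy_rellich_lt {R : realType} m : (m <= 7)%N ->
  hardy_rellich m < 8 * m.+3%:R * m.+1%:R :> R.
Proof.
by case: m => [|[|[|[|[|[|[|[|//]]]]]]]] _; rewrite /hardy_rellich; lra.
Qed.

Lemma slow_decay_unstable {R : realType} (m : nat) (u : 'rV[R]_(m.+4.+1) -> R) (b : R)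
    (U A V B : R -> R) : (m <= 7)%N -> profile m.+4 b U A V B ->
  (forall x, u x = U (euclid_norm x)) ->
  (forall e, 0 < e -> exists2 r, 0 <= r & V r < e) -> ~ stable_outside_compact u.
Proof.
move=> m7 P uE Vinf [K cK stab].
have [r0 r00 [C C0 hm]] := stable_outside_mass P uE cK stab.
apply: (slow_decay_absurd P r00 _ C0 _ Vinf hm); first exact: sqr_ge0.
exact: hardy_rellich_lt.
Qed.

(** The disjunction prepares the strict inequality between the thresholds: either beta0 is attained,
    by a solution far from stable, or there is a factor 2 of room above it. *)
Lemma existence_of_thresholds {R : realType} (m : nat) (m7 : (m <= 7)%N) :
  exists beta0 : R, [/\ 0 < beta0,
    (exists2 u0 : 'rV[R]_(m.+4.+1) -> R, radial_solution u0 & beta u0 = beta0) \/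
    (forall u : 'rV[R]_(m.+4.+1) -> R, radial_solution u -> 2 * beta0 <= beta u) &
    forall u : 'rV[R]_(m.+4.+1) -> R, radial_solution u ->
    [/\ beta0 <= beta u, beta u = beta0 -> ~ stable_outside_compact u &
      beta0 < beta u -> stable_outside_compact u]].
Proof.
have n4 : (4 <= m.+4)%N by [].
have n0 : (0 < m.+4)%N by [].
have N0 : 0 < 2 * m.+4.+1%:R :> R by rewrite mulr_gt0.
(* As [V] does not increase, arbitrarily small values mean that it tends to 0. *)
pose slow (u : 'rV[R]_(m.+4.+1) -> R) := radial_solution u /\ exists U A V B : R -> R,
  [/\ profile m.+4 (beta u) U A V B, forall x, u x = U (euclid_norm x) &
    forall e, 0 < e -> exists2 r, 0 <= r & V r < e].
have [[u0 [su0 [U0 [A0 [V0 [B0 [P0 u0E V0inf]]]]]]]|noslow] := pselect (exists u, slow u).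
  exists (beta u0); split.
  - apply: lt_le_trans (beta_lower n4 su0); rewrite invr_gt0; lra.
  - by left; exists u0.
  move=> u su; split.
  (* A solution of smaller beta would keep [V0] above the gap of the betas, against [V0inf]. *)
  - rewrite leNgt; apply/negP => uu0.
    have [U [A [V [B [P uE]]]]] := radial_solution_profile su.
    have [|r rp Vr] := V0inf (beta u0 - beta u); first by rewrite subr_gt0.
    have [_ h] := compare P P0 uu0 rp.
    by have := lt_le_trans Vr h; rewrite ltrDl oppr_gt0 ltNge (V_ge0 n0 P).
  - move=> /(beta_eq n4 su su0) ->; exact: slow_decay_unstable P0 u0E V0inf.
  - move=> uu0; have [_ h] := beta_lt n4 su0 su uu0.
    apply: decay_stable_outside h => //; last exact: radial_solution_continuous.
    by rewrite divr_gt0 // subr_gt0.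
(* The bound of [beta_lower]; half of it lies below all betas with a factor 2 to spare, so the case
   of equality is void. *)
pose l : R := (2 * m.+4.+1%:R + 1)^-1.
have l0 : 0 < l by rewrite invr_gt0; lra.
have l2 : l / 2 < l by lra.
exists (l / 2); split; first by rewrite divr_gt0.
  right=> u su; rewrite mulrC divfK //; exact: beta_lower.
move=> u su; have hb := beta_lower n4 su; rewrite -/l in hb.
split; first exact: le_trans (ltW l2) hb.
  by move=> bE; move: hb; rewrite bE leNgt l2.
move=> _; have [U [A [V [B [P uE]]]]] := radial_solution_profile su.
have [[e [e0 Ve]]|nV] := pselect (exists e : R, 0 < e /\ forall r, 0 <= r -> e <= V r).
  have h := quadratic_decay P uE Ve.
  apply: decay_stable_outside h => //; last exact: radial_solution_continuous.
  by rewrite divr_gt0.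
exfalso; apply: noslow; exists u; split => //; exists U, A, V, B; split => // e e0.
apply: contrapT => nr; apply: nV; exists e; split => // r r0.
by rewrite leNgt; apply/negP => Vr; apply: nr; exists r.
Qed.

Unset Implicit Arguments.

Theorem proposition1p1 (R : realType) (N : nat) (hN : (5 <= N <= 12)%N) :
  exists beta0 beta1 : R,
    [/\ 0 < beta0, beta0 < beta1 &
      forall u : 'rV[R]_N -> R,
        solution u -> radial u -> u 0 = 0 ->
        let v := fun x => - laplacian u x in
        let beta := v 0 in
        [/\ beta0 <= beta,
            beta = beta0 -> ~ stable_outside_compact u,
            beta0 < beta /\ beta < beta1 -> ~ stable u /\ stable_outside_compact u &
            beta1 <= beta -> stable u]].
Proof.
case: N hN => [//|[//|[//|[//|[//|m]]]]] hm.
have m7 : (m <= 7)%N by case/andP: hm.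
have n4 : (4 <= m.+4)%N by [].
pose sol (u : 'rV[R]_(m.+4.+1) -> R) := radial_solution u.
have N0 : 0 < m.+4.+1%:R :> R by [].
(* Without any radial solution the claims are void and any two thresholds will do. *)
have [[w sw]|nosol] := pselect (exists w, sol w); last first.
  exists 1, 2; split; [by []|lra|move=> u su ru u0].
  by exfalso; apply: nosol; exists u.
have [b0 [b00 b0alt b0P]] := @existence_of_thresholds R m m7.
(* A gap of 4 N above [beta w] gives the decay rate 4 N / (2 N) = 2 of [decay_stable]. *)
pose bw := beta w + 4 * m.+4.+1%:R.
have bwP u : sol u -> bw <= beta u -> stable u.
  move=> su wu; have wlt : beta w < beta u by apply: lt_le_trans wu; rewrite /bw ltrDl mulr_gt0.
  have [_ h] := beta_lt n4 sw su wlt.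
  apply: decay_stable h => //; last exact: radial_solution_continuous.
  rewrite ler_pdivlMr ?mulr_gt0 // lerBrDl mulrA -natrM; exact: wu.
(* [bw] is added to keep the set nonempty even if no solution is stable; by [bwP] this does no
   harm. *)
pose T := [set b : R | b = bw \/ exists u, [/\ sol u, stable u & beta u = b]].
have Tb0 : lbound T b0.
  move=> b [->|[u [su _ <-]]]; last by have [] := b0P u su.
  have [h _ _] := b0P w sw; apply: (le_trans h); by rewrite /bw lerDl mulr_ge0.
have hT : has_inf T by split; [exists bw; left|exists b0].
have b0le : b0 <= inf T by apply: lb_le_inf => //; exists bw; left.
(* The minimum in [e'] excludes [bw], so that the nearly minimal element of [T] is the beta of an
   actual stable solution. *)
have Tclose u : sol u -> inf T <= beta u -> beta u < bw ->
    forall e, 0 < e -> exists w, [/\ sol w, stable w & beta w < beta u + e].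
  move=> su Tu ubw e e0; pose e' := Num.min e (bw - beta u).
  have e'0 : 0 < e' by rewrite lt_min e0 subr_gt0.
  have [b Tb bT] := inf_adherent e'0 hT.
  have be : b < beta u + e' by apply: lt_le_trans bT _; rewrite lerD2r.
  case: Tb be => [->|[v [sv stv <-]]] be.
    exfalso; move: be; apply/negP; rewrite -leNgt -lerBrDl /e' ge_min lexx orbT //.
  exists v; split => //; apply: (lt_le_trans be); by rewrite lerD2l /e' ge_min lexx.
have stable_ge u : sol u -> inf T <= beta u -> stable u.
  move=> su Tu; case: (leP bw (beta u)) => [|ubw]; first exact: bwP.
  (* Either a stable solution of smaller beta lies above u, or there are stable solutions whose
     betas are arbitrarily close to [beta u] from above, and stability passes to the limit. *)
  have [[v [sv stv vu]]|nv] := pselect (exists v, [/\ sol v, stable v & beta v < beta u]).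
    have [vu' _] := beta_lt n4 sv su vu.
    apply: stability_monotone vu' stv => //; exact: radial_solution_continuous.
  apply: (stable_closed n4 su) => e e0.
  have [v [sv stv ve]] := Tclose u su Tu ubw e e0.
  exists v; split => //.
  have uv : beta u <= beta v by rewrite leNgt; apply/negP => vu; apply: nv; exists v.
  by rewrite ger0_norm ?subr_ge0 // ltrBlDl.
(* In case of equality, a solution attaining b0 would be stable by [stable_ge], against its
   instability outside every compact set; if none attains it, [T] lies above 2 b0. *)
have b01 : b0 < inf T.
  rewrite lt_def b0le andbT; apply/eqP => Tb0E.
  case: b0alt => [[u0 su0 u0b]|b2].
    have st0 : stable u0 by apply: stable_ge => //; rewrite u0b Tb0E.
    have [_ /(_ u0b) + _] := b0P u0 su0; apply; exact: stable_outsideW.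
  have : 2 * b0 <= inf T.
    apply: lb_le_inf; first by exists bw; left.
    move=> b [->|[u [su _ <-]]]; last exact: b2.
    by apply: (le_trans (b2 w sw)); rewrite /bw lerDl mulr_ge0.
  by rewrite Tb0E leNgt ltr_pMl // ltr1n.
exists b0, (inf T); split => // u su ru u0 /=.
have ssu : sol u by split.
have [h1 h2 h3] := b0P u ssu; split => //.
- move=> [lt0 lt1]; split; last exact: h3.
  move=> stu; have : inf T <= beta u by apply: ge_inf; [exists b0|right; exists u].
  by rewrite leNgt lt1.
- exact: stable_ge.
Qed.
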